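(* Let $\{X_\lambda\}_{\lambda\in\Lambda}$ be an ensemble of random matrices satisfying condition (G) with data $(PM_c,f_c)$. Then this ensemble has second-order limit distribution $(A,\varphi_1,\varphi_2)$, where $A$ is the algebra of noncommutative polynomials in indeterminates $x_\lambda$, $\lambda\in\pm\Lambda$ (with $x_\lambda^{(1)}=x_\lambda$, $x_\lambda^{(-1)}=x_{-\lambda}$), and $\varphi_1$, $\varphi_2$ are defined by extending the following expressions by linearity: for $\varepsilon:[n]\to\{1,-1\}$ and $\lambda_1,\ldots,\lambda_n\in\Lambda$, $$\varphi_1\left(x_{\lambda_1}^{(\varepsilon(1))}\cdots x_{\lambda_n}^{(\varepsilon(n))}\right)=\sum_{\substack{\pi\in S_{\mathrm{disc-nc}}(\gamma)\\ \delta_\varepsilon\pi_+\pi_-^{-1}\delta_\varepsilon\in PM_c(\pm[n])}}\lim_{N\to\infty}f_c(\delta_\varepsilon\pi_+\pi_-^{-1}\delta_\varepsilon)$$ with $\gamma=(1,\ldots,n)$; and for $\varepsilon:[m+n]\to\{1,-1\}$ and $\lambda_1,\ldots,\lambda_{m+n}\in\Lambda$, $$\begin{aligned}\varphi_2\left(x_{\lambda_1}^{(\varepsilon(1))}\cdots x_{\lambda_m}^{(\varepsilon(m))},\,x_{\lambda_{m+1}}^{(\varepsilon(m+1))}\cdots x_{\lambda_{m+n}}^{(\varepsilon(m+n))}\right)={}&\sum_{\substack{\pi\in S_{\mathrm{ann-nc}}(\gamma)\\ \delta_\varepsilon\pi_+\pi_-^{-1}\delta_\varepsilon\in PM_c(\pm[m+n])}}\lim_{N\to\infty}f_c(\delta_\varepsilon\pi_+\pi_-^{-1}\delta_\varepsilon)\\&+\sum_{\substack{\pi\in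 S_{\mathrm{ann-nc}}(\gamma_{\mathrm{op}})\\ \delta_\varepsilon\pi_+\pi_-^{-1}\delta_\varepsilon\in PM_c(\pm[m+n])}}\lim_{N\to\infty}f_c(\delta_\varepsilon\pi_+\pi_-^{-1}\delta_\varepsilon)\end{aligned}$$ with $\gamma=(1,\ldots,m)(m+1,\ldots,m+n)$ and $\gamma_{\mathrm{op}}=(1,\ldots,m)(-m-n,\ldots,-m-1)$. (Here $m,n\geq1$; on constants $\varphi_1(1)=1$ and $\varphi_2(1,a)=\varphi_2(a,1)=0$.)
   Context: **Second-order limit distribution.** A noncommutative probability space $(A,\varphi_1)$ is a unital algebra $A$ with a tracial linear functional $\varphi_1$, $\varphi_1(1_A)=1$. A second-order probability space $(A,\varphi_1,\varphi_2)$ is in addition equipped with a bilinear functional $\varphi_2$, tracial in each argument, with $\varphi_2(1_A,a)=\varphi_2(a,1_A)=0$ for all $a$. The classical cumulants $k_1,k_2,\ldots$ are the multilinear functions of random variables determined by $\mathbb{E}(X_1\cdots X_n)=\sum_{\pi}\prod_{\{i_1,\ldots,i_s\}\in\pi}k_s(X_{i_1},\ldots,X_{i_s})$, the sum over all partitions $\pi$ of $[n]$. The family of $N\times N$ random matrices $X_\lambda$, $\lambda\in\pm\Lambda$, where $X_{-\lambda}:=X_\lambda^T$, has second-order limit distribution $(A,\varphi_1,\varphi_2)$ with elements $x_\lambda\in A$ if for all noncommutative polynomials $p_1,p_2,\ldots$ and all choices of indices, $\lim_{N\to\infty}k_1(\mathrm{tr}(p_1(X_{\lambda_{1,1}},\ldots,X_{\lambda_{1,n_1}})))=\varphi_1(p_1(x_{\lambda_{1,1}},\ldots,x_{\lambda_{1,n_1}}))$;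 $\lim_{N\to\infty}k_2(\mathrm{Tr}(p_1(X_{\lambda_{1,1}},\ldots)),\mathrm{Tr}(p_2(X_{\lambda_{2,1}},\ldots)))=\varphi_2(p_1(x_{\lambda_{1,1}},\ldots),p_2(x_{\lambda_{2,1}},\ldots))$; for all $r\ge3$, $\lim_{N\to\infty}k_r(\mathrm{Tr}(p_1(X_{\lambda_{1,1}},\ldots)),\ldots,\mathrm{Tr}(p_r(X_{\lambda_{r,1}},\ldots)))=0$; and there is an involution $x\mapsto x^t$ on $A$ reversing the order of multiplication with $x_{-\lambda}=x_\lambda^t$. Here $\mathrm{tr}=\frac1N\mathrm{Tr}$. **Permutations.** $[n]=\{1,\ldots,n\}$. For a finite set $I$ of nonzero integers, $-I=\{-k:k\in I\}$, $\pm I=I\cup(-I)$, $S(I)$ is the group of permutations of $I$, products act from right to left, a permutation acts trivially outside its domain, and $\#(\pi)$ is the number of cycles of $\pi$ (on its domain, fixed points included). $\delta:k\mapsto-k$. A premap on $\pm I$ is $\pi\in S(\pm I)$ such that $\pi(k)=-\pi^{-1}(-k)$ for all $k$ and no cycle of $\pi$ contains both $k$ and $-k$; the set of premaps is $PM(\pm I)$. If $I$ does not contain both $k$ and $-k$ for any $k$, and $\gamma\in S(I)$, then $\gamma_+\in S(\pm I)$ is $\gamma$ extended by the identity on $-I$, $\gamma_-:=\delta\gamma_+\delta$, and for $\pi\in PM(\pm I)$ $$\chi(\gamma,\pi):=\#(\gamma_+\gamma_-^{-1})/2+\#(\pi)/2+\#(\gamma_+^{-1}\pi^{-1}\gamma_-)/2-|I|$$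 (in all three counts the domain is $\pm I$). A cycle is particular if its element of smallest absolute value is positive; for a premap $\pi$, $\pi/2$ is the permutation formed by the particular cycles of $\pi$, on the set of elements of those cycles. Given $\varepsilon:I\to\{1,-1\}$ with $I$ a set of positive integers, put $\varepsilon(-k)=\varepsilon(k)$ and $\delta_\varepsilon:k\mapsto\varepsilon(k)k$. For $\pi\in S(I)$ and $J\subseteq I$ the induced permutation $\pi|_J\in S(J)$ is $\pi|_J(k)=\pi^s(k)$ with $s$ the smallest positive integer such that $\pi^s(k)\in J$. **Disc-noncrossing.** Let $\gamma\in S(I)$ have a single cycle. $\pi\in S(I)$ is in $S_{\mathrm{disc-nc}}(\gamma)$ if there are no distinct $a,b,c\in I$ with $\gamma|_{\{a,b,c\}}=(a,b,c)$ and $\pi|_{\{a,b,c\}}=(a,b,c)$, and no distinct $a,b,c,d\in I$ with $\gamma|_{\{a,b,c,d\}}=(a,b,c,d)$ and $\pi|_{\{a,b,c,d\}}=(a,c)(b,d)$. **Annular-noncrossing.** Let $\gamma\in S(I)$ have exactly two cycles $\gamma_{\mathrm{ext}},\gamma_{\mathrm{int}}$. For $x\in\gamma_{\mathrm{ext}}$, $y\in\gamma_{\mathrm{int}}$, let $\lambda_{x,y}$ be the permutation of $I\setminus\{x,y\}$ with $\lambda_{x,y}(\gamma^{-1}(x))=\gamma(y)$, $\lambda_{x,y}(\gamma^{-1}(y))=\gamma(x)$ and $\lambda_{x,y}(a)=\gamma(a)$ otherwise, i.e. the single cycle $(\gamma(x),\gamma^2(x),\ldots,\gamma^{-1}(x),\gamma(y),\ldots,\gamma^{-1}(y))$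 (if a cycle of $\gamma$ is a singleton, its segment is empty). $S_{\mathrm{ann-nc}}(\gamma)$ is the set of $\pi\in S(I)$ such that $\langle\gamma,\pi\rangle$ is transitive on $I$ and none of the following occurs, for distinct elements of $I$ with $x\in\gamma_{\mathrm{ext}}$, $y\in\gamma_{\mathrm{int}}$: (s1) $\gamma|_{\{a,b,c\}}=(a,b,c)$ and $\pi|_{\{a,b,c\}}=(a,b,c)$; (s2) $\gamma|_{\{a,b,c,d\}}=(a,b)(c,d)$ and $\pi|_{\{a,b,c,d\}}=(a,c,b,d)$; (n1) $\gamma|_{\{a,b,c,d\}}=(a,b,c,d)$ and $\pi|_{\{a,b,c,d\}}=(a,c)(b,d)$; (n2) $\lambda_{x,y}|_{\{a,b,c\}}=(a,b,c)$ and $\pi|_{\{a,b,c,x,y\}}=(a,b,c)(x,y)$; (n3) $\lambda_{x,y}|_{\{a,b,c,d\}}=(a,b,c,d)$ and $\pi|_{\{a,b,c,d,x,y\}}=(a,c)(b,d)(x,y)$. **Trace along a permutation.** For matrices $X_k$ put $X^{(k)}=X_k$ and $X^{(-k)}=X_k^T$. For a permutation $\sigma$ of a finite set of nonzero integers, $\mathrm{tr}_\sigma(\ldots)$ is the product over the cycles $(c_1,\ldots,c_s)$ of $\sigma$ of $\mathrm{tr}(X^{(c_1)}\cdots X^{(c_s)})$. **Condition (G).** A family $\{X_\lambda\}_{\lambda\in\Lambda}$ of $N\times N$ random matrices, given for every $N$ (with $X_\lambda^{(1)}=X_\lambda$, $X_\lambda^{(-1)}=X_\lambda^T$), satisfies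 (G) with data $(PM_c,f_c)$ if: (i) for each finite set $I$ of positive integers, $PM_c(\pm I)\subseteq PM(\pm I)$ is a subset such that, for every $J\subseteq I$, the $\pi\in PM_c(\pm I)$ which do not connect $\pm J$ and $\pm(I\setminus J)$ (no cycle meets both) are exactly the products $\pi_1\pi_2$ with $\pi_1\in PM_c(\pm J)$, $\pi_2\in PM_c(\pm(I\setminus J))$; (ii) $f_c$ is a complex-valued function on $\bigcup_I PM_c(\pm I)$ (its value on $\pi\in PM_c(\pm I)$ may depend on $N$ and on the indices $\lambda_k$, $k\in I$) such that $\lim_{N\to\infty}f_c(\pi)$ exists for every $\pi$; (iii) for every finite set $I=\{i_1<\cdots<i_s\}$ of positive integers, $\gamma\in S(I)$, $\varepsilon:I\to\{1,-1\}$, $\lambda_k\in\Lambda$ ($k\in I$), and $N\times N$ random matrices $Y_k$ ($k\in I$) independent from the family $\{X_\lambda\}$ (all expectations existing), $$\mathbb{E}\left(\mathrm{tr}_\gamma(X_{\lambda_{i_1}}^{(\varepsilon(i_1))}Y_{i_1},\ldots,X_{\lambda_{i_s}}^{(\varepsilon(i_s))}Y_{i_s})\right)=\sum_{\pi\in PM_c(\pm I)}N^{\chi(\gamma,\delta_\varepsilon\pi\delta_\varepsilon)-2\#(\gamma)}f_c(\pi)\,\mathbb{E}\left(\mathrm{tr}_{\gamma_-^{-1}\delta_\varepsilon\pi\delta_\varepsilon\gamma_+/2}(Y_{i_1},\ldots,Y_{i_s})\right);$$ (iv) (multiplicativity) if $\pi\in PM_c(\pm I)$ does not connect $\pm J$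 and $\pm(I\setminus J)$, then $f_c(\pi)=f_c(\pi|_{\pm J})f_c(\pi|_{\pm(I\setminus J)})$. For $I=\emptyset$, $PM_c$ consists of the empty permutation, with $f_c=1$. *)

(* Defs.v *)
From HB Require Import structures.
From mathcomp Require Import all_boot all_order all_fingroup all_algebra finmap.
From mathcomp Require Import all_classical all_reals all_analysis.
From mathcomp Require Import complex.
(* The notations of monalg are incompatible with those of MathComp-Analysis. *)
From mathcomp Require Import -(notations) monalg.
Set Implicit Arguments.
Unset Strict Implicit.
Unset Printing Implicit Defensive.
Import Order.TTheory GRing.Theory Num.Theory.
Import numFieldNormedType.Exports.
Local Open Scope ring_scope.

(* MathComp composes permutations from left to right: (s * t) x = t (s x).
   [s ∘ t] is the right-to-left product, (s ∘ t) x = s (t x). *)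
Definition pcomp (T : finType) (s t : {perm T}) : {perm T} := (t * s)%g.
Notation "s ∘ t" := (pcomp s t) (at level 40, left associativity).

Section Cycles.
Variable T : finType.
Implicit Types (D : {set T}) (g p : {perm T}).

(* Throughout, an element of S(D) is a permutation p of the ambient type T
   with [perm_on D p], i.e. acting trivially outside D. *)

Definition ncycles D p : nat := #|[set porbit p k | k in D]|.

Lemma next_undup_inj (s : seq T) : injective (next (undup s)).
Proof. exact: can_inj (prev_next (undup_uniq s)). Qed.

(* The cycle (s_1, ..., s_n); [undup] is the identity on lists of distinct
   elements. *)
Definition cyc (s : seq T) : {perm T} := perm (@next_undup_inj s).

(* f^s(k) with s the smallest positive integer such that f^s(k) is in A, i.e.
   the permutation induced on A.  If f is injective and k is in A then s is at
   most #|T|. *)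
Definition first_return (A : pred T) (f : T -> T) (k : T) : T :=
  iter (find (fun s => A (iter s.+1 f k)) (iota 0 #|T|)).+1 f k.

(* The elements listed in ss are distinct, and the permutation that f induces
   on the set of these elements is the product of the cycles listed in ss. *)
Definition restricts_to (f : T -> T) (ss : seq (seq T)) : bool :=
  uniq (flatten ss) &&
  all (fun c => all (fun k =>
    first_return (mem (flatten ss)) f k == next c k) c) ss.

(* [fingraph.orbit g x] is the list x, g x, g^2 x, ..., g^-1 x. *)
Definition lambda g (x y : T) : T -> T :=
  next (behead (fingraph.orbit g x) ++ behead (fingraph.orbit g y)).

Definition disc_nc D g p : bool :=
  [&& perm_on D p,
      [forall a in D, forall b in D, forall c in D,
        ~~ (restricts_to g [:: [:: a; b; c]] &&
            restricts_to p [:: [:: a; b; c]])] &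
      [forall a in D, forall b in D, forall c in D, forall d in D,
        ~~ (restricts_to g [:: [:: a; b; c; d]] &&
            restricts_to p [:: [:: a; c]; [:: b; d]])]].

Definition ann_s1 D g p : bool :=
  [exists a in D, exists b in D, exists c in D,
    restricts_to g [:: [:: a; b; c]] && restricts_to p [:: [:: a; b; c]]].

Definition ann_s2 D g p : bool :=
  [exists a in D, exists b in D, exists c in D, exists d in D,
    restricts_to g [:: [:: a; b]; [:: c; d]] &&
    restricts_to p [:: [:: a; c; b; d]]].

Definition ann_n1 D g p : bool :=
  [exists a in D, exists b in D, exists c in D, exists d in D,
    restricts_to g [:: [:: a; b; c; d]] &&
    restricts_to p [:: [:: a; c]; [:: b; d]]].

(* Here and in [ann_n3] x and y range over the two different cycles of g in D,
   in either order: [lambda g x y] and [lambda g y x] are the same cyclic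
   permutation, and the conditions are symmetric in x and y. *)
Definition ann_n2 D g p : bool :=
  [exists x in D, exists y in D, (y \notin porbit g x) &&
    [exists a in D, exists b in D, exists c in D,
      restricts_to (lambda g x y) [:: [:: a; b; c]] &&
      restricts_to p [:: [:: a; b; c]; [:: x; y]]]].

Definition ann_n3 D g p : bool :=
  [exists x in D, exists y in D, (y \notin porbit g x) &&
    [exists a in D, exists b in D, exists c in D, exists d in D,
      restricts_to (lambda g x y) [:: [:: a; b; c; d]] &&
      restricts_to p [:: [:: a; c]; [:: b; d]; [:: x; y]]]].

Definition ann_nc D g p : bool :=
  [&& perm_on D p, [transitive <<[set g; p]>>%g, on D | 'P],
      ~~ ann_s1 D g p, ~~ ann_s2 D g p, ~~ ann_n1 D g p,
      ~~ ann_n2 D g p & ~~ ann_n3 D g p].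

Lemma first_returnP (A : pred T) p k : A k ->
  exists s, [/\ first_return A p k = iter s.+1 p k, A (iter s.+1 p k) &
    forall r, (r < s)%N -> ~~ A (iter r.+1 p k)].
Proof.
move=> Ak; set a := fun s => A (iter s.+1 p k).
have ha : has a (iota 0 #|T|).
  apply/hasP; exists (fingraph.order p k).-1.
    rewrite mem_iota add0n prednK ?order_gt0 //; exact: max_card.
  by rewrite /a prednK ?order_gt0 // (iter_order (@perm_inj _ p)).
exists (find a (iota 0 #|T|)); split=> //.
  move: (nth_find 0%N ha); rewrite nth_iota ?add0n //.
  by rewrite -[ltnRHS](size_iota 0) -has_find.
move=> r rs; have := before_find 0%N rs; rewrite nth_iota ?add0n => [/negbT//|].
by rewrite (leq_trans rs) // -[leqRHS](size_iota 0) find_size.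
Qed.

Lemma first_return_inj (A : pred T) p k k' : A k -> A k' ->
  first_return A p k = first_return A p k' -> k = k'.
Proof.
move=> Ak Ak'; have [s [-> _ ms]] := first_returnP p Ak.
have [s' [-> _ ms']] := first_returnP p Ak'.
wlog ss' : k k' s s' Ak Ak' ms ms' / (s <= s')%N => [hw|].
  have [ss'|/ltnW s's] := leqP s s'; first exact: hw.
  by move=> /esym h; apply/esym; apply: (hw k' k s' s).
rewrite -(subnKC ss') -addSn iterD => h.
have {}h : k = iter (s' - s) p k'.
  elim: s.+1 h => //= m IH h; apply: IH; exact: perm_inj h.
have := ms' (s' - s).-1; case: (s' - s)%N (leq_subr s s') h => [//|r] rs' h.
by move=> /(_ rs') /=; rewrite /= in h; rewrite -h Ak.
Qed.

End Cycles.

(* A finite set I of positive integers is an fset of nat without 0.  The set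
   ±I is represented by the type I * bool: (k, true) is k and (k, false) is
   -k.  Likewise a map to {1, -1} is a map to bool. *)
Definition posset (I : {fset nat}) : bool := 0%N \notin I.

Section Signed.
Variable I : {fset nat}.
Implicit Types (k : I * bool) (g p : {perm (I * bool)}).

Definition neg k : I * bool := (k.1, ~~ k.2).
Lemma neg_inj : injective neg.
Proof. by apply: (can_inj (g := neg)) => -[k b]; rewrite /neg negbK. Qed.
Definition delta : {perm (I * bool)} := perm neg_inj.

Definition sgn_mul (e : I -> bool) k : I * bool := (k.1, k.2 == e k.1).
Lemma sgn_mul_inj e : injective (sgn_mul e).
Proof.
by apply: (can_inj (g := sgn_mul e)) => -[k []]; rewrite /sgn_mul /=; case: (e k).
Qed.
Definition delta_eps (e : I -> bool) : {perm (I * bool)} := perm (@sgn_mul_inj e).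

Definition posI : {set I * bool} := [set k | k.2].

Definition premap p : bool :=
  [forall k, (p k == neg ((p^-1)%g (neg k))) && (neg k \notin porbit p k)].

(* For g in S(D), where D does not contain both k and -k for any k, the
   permutation g_+ is g itself (extended by the identity). *)
Definition minus g : {perm (I * bool)} := delta ∘ g ∘ delta.

(* For g in S(D) as above and p a premap, the three cycle counts are even, so
   that halving them in nat is exact. *)
Definition chi g p : int :=
  ((#|porbits (g ∘ (minus g)^-1%g)|)./2 + #|porbits p|./2 +
   #|porbits (g^-1%g ∘ p^-1%g ∘ minus g)|./2)%N%:Z - (#|` I|)%:Z.

(* The domain of p/2: the union of the particular cycles of p.  On this set
   p/2 coincides with p. *)
Definition particular p : {set I * bool} :=
  [set k | [exists j in porbit p k, j.2 &&
    [forall i in porbit p k, (val j.1 <= val i.1)%N]]].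

(* Some cycle of p meets both ±J and ±(I \ J). *)
Definition connects (J : {fset nat}) p : bool :=
  [exists k, exists l, [&& l \in porbit p k, val k.1 \in J & val l.1 \notin J]].

(* p acting on all signed integers, trivially outside of ±I *)
Definition act_signed p (x : nat * bool) : nat * bool :=
  if insub x.1 is Some k then (val (p (k, x.2)).1, (p (k, x.2)).2) else x.

End Signed.

Section Induced.
Variables (J I : {fset nat}) (JI : (J `<=` I)%fset).

Definition sincl (k : J * bool) : I * bool := (fincl JI k.1, k.2).

Lemma sincl_inj : injective sincl.
Proof.
by move=> [k b] [k' b'] [h ->]; congr (_, _); apply/val_inj.
Qed.

Definition induced_fun (p : {perm (I * bool)}) (k : J * bool) : J * bool :=
  odflt k [pick k' | sincl k' == first_return (mem (codom sincl)) p (sincl k)].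

Lemma sincl_induced p k :
  sincl (induced_fun p k) = first_return (mem (codom sincl)) p (sincl k).
Proof.
rewrite /induced_fun; case: pickP => [k' /eqP //|no].
have Ak : mem (codom sincl) (sincl k) by rewrite inE codom_f.
have [s [e As _]] := first_returnP p Ak.
have /codomP[k' k'E] : first_return (mem (codom sincl)) p (sincl k) \in codom sincl.
  by rewrite e.
by have := no k'; rewrite k'E eqxx.
Qed.

Lemma induced_inj p : injective (induced_fun p).
Proof.
move=> k k' /(congr1 sincl); rewrite !sincl_induced => h.
by apply/sincl_inj/(first_return_inj _ _ h); rewrite inE codom_f.
Qed.

Definition induced (p : {perm (I * bool)}) : {perm (J * bool)} :=
  perm (@induced_inj p).

End Induced.

Local Open Scope classical_set_scope.
Local Open Scope ring_scope.

Section Probability.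
Context (R : realType) (d : measure_display) (T : measurableType d)
  (P : probability T R).
Local Notation C := R[i].

Definition cmeasurable (f : T -> C) : Prop :=
  measurable_fun setT (fun w => complex.Re (f w)) /\
  measurable_fun setT (fun w => complex.Im (f w)).

Definition cintegrable (f : T -> C) : Prop :=
  P.-integrable setT (fun w => (complex.Re (f w))%:E) /\
  P.-integrable setT (fun w => (complex.Im (f w))%:E).

Definition cE (f : T -> C) : C :=
  (fine ('E_P[fun w => complex.Re (f w)]) +i*
   fine ('E_P[fun w => complex.Im (f w)]))%C.

(* The moment-cumulant formula solved for the term of the one-block partition,
   for the subfamily of Z indexed by S; the recursion depth #|S| suffices. *)
Fixpoint cumulant_rec (I : finType) (Z : I -> T -> C) (m : nat) (S : {set I}) : C :=
  if m is m'.+1 then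
    cE (fun w => \prod_(i in S) Z i w) -
    \sum_(Q : {set {set I}} | finset.partition Q S && (Q != [set S]%SET))
      \prod_(B in Q) cumulant_rec Z m' B
  else 0.

Definition cumulant_on (I : finType) (Z : I -> T -> C) (S : {set I}) : C :=
  cumulant_rec Z #|S| S.

Definition cumulant (r : nat) (Z : 'I_r -> T -> C) : C := cumulant_on Z [set: 'I_r]%SET.

Lemma partition_block_lt (I : finType) (Q : {set {set I}}) (S B : {set I}) :
  finset.partition Q S -> Q != [set S]%SET -> B \in Q -> (#|B| < #|S|)%N.
Proof.
move=> pQ nQ BQ; apply: proper_card; rewrite finset.properEneq.
have [/eqP cQ tQ n0] := and3P pQ.
have BS : B \subset S by rewrite -cQ (finset.bigcup_max B).
rewrite BS andbT; apply: contra nQ => /eqP BE; rewrite finset.eqEsubset.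
apply/andP; split; last by rewrite finset.sub1set -BE.
apply/fintype.subsetP => B' B'Q; rewrite inE; apply/negPn/negP => nB'.
have /finset.trivIsetP/(_ B' B B'Q BQ) := tQ; rewrite BE => /(_ nB').
rewrite -finset.setI_eq0 => /eqP h.
have B'S : B' \subset S by rewrite -cQ (finset.bigcup_max B').
by move: n0; rewrite -h (finset.setIidPl B'S) B'Q.
Qed.

Lemma partition_block_gt0 (I : finType) (Q : {set {set I}}) (S B : {set I}) :
  finset.partition Q S -> B \in Q -> (0 < #|B|)%N.
Proof.
by case/and3P=> _ _ n0 BQ; rewrite card_gt0; apply: contraNneq n0 => <-.
Qed.

Lemma cumulant_rec_depth (I : finType) (Z : I -> T -> C) m m' (S : {set I}) :
  (0 < #|S|)%N -> (#|S| <= m)%N -> (#|S| <= m')%N ->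
  cumulant_rec Z m S = cumulant_rec Z m' S.
Proof.
elim: m m' S => [|m IH] m' S S0; first by rewrite leqNgt S0.
case: m' => [|m'] Sm Sm'; first by rewrite leqNgt S0 in Sm'.
rewrite /=; congr (_ - _); apply: eq_bigr => Q /andP[pQ nQ].
apply: eq_bigr => B BQ; have lt := partition_block_lt pQ nQ BQ.
apply: IH; first exact: partition_block_gt0 pQ BQ.
  exact: leq_trans lt Sm.
exact: leq_trans lt Sm'.
Qed.

Lemma moment_cumulant (I : finType) (Z : I -> T -> C) (S : {set I}) :
  (0 < #|S|)%N ->
  cE (fun w => \prod_(i in S) Z i w) =
  \sum_(Q : {set {set I}} | finset.partition Q S) \prod_(B in Q) cumulant_on Z B.
Proof.
move=> S0.
have pS : finset.partition [set S]%SET S.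
  rewrite /finset.partition /finset.cover big_set1 eqxx /=; apply/andP; split.
    by apply/finset.trivIsetP => A B; rewrite !inE => /eqP -> /eqP ->; rewrite eqxx.
  by rewrite inE eq_sym -card_gt0.
rewrite (bigD1 [set S]%SET) //= big_set1 {1}/cumulant_on.
case E : #|S| S0 => [//|m] _ /=.
rewrite -addrA [X in _ = _ + X]addrC -sumrB big1 ?addr0 // => Q /andP[pQ nQ].
apply/eqP; rewrite subr_eq0; apply/eqP/eq_bigr => B BQ.
apply: cumulant_rec_depth => //; first exact: partition_block_gt0 pQ BQ.
by rewrite -ltnS -E (partition_block_lt pQ nQ BQ).
Qed.

Definition sigma_entries (K : Type) (n : nat) (Z : K -> T -> 'M[C]_n) :
    set (set T) :=
  <<s [set A | exists k i j, exists2 B : set R, measurable B &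
        A = (fun w => complex.Re (Z k w i j)) @^-1` B \/
        A = (fun w => complex.Im (Z k w i j)) @^-1` B] >>.

Definition independent_families (K L : Type) (n : nat)
    (X : K -> T -> 'M[C]_n) (Y : L -> T -> 'M[C]_n) : Prop :=
  forall A B, sigma_entries X A -> sigma_entries Y B ->
    (P (A `&` B) = P A * P B)%E.

End Probability.

Section Traces.
Context {R : realType}.
Local Notation C := R[i].

(* A^(1) = A and A^(-1) = A^T *)
Definition mxsgn (n : nat) (b : bool) (A : 'M[C]_n) : 'M[C]_n :=
  if b then A else A^T.

Definition ntr (n : nat) (A : 'M[C]_n.+1) : C := \tr A / n.+1%:R.

(* tr_p for p regarded as a permutation of its invariant subset D: the product
   over the cycles of p in D, each listed from a chosen root. *)
Definition tr_perm (I : {fset nat}) (n : nat) (D : {set I * bool})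
    (p : {perm (I * bool)}) (Z : I -> 'M[C]_n.+1) : C :=
  \prod_(k | (k \in D) && froots p k)
    ntr (\prod_(c <- fingraph.orbit p k) mxsgn c.2 (Z c.1)).

End Traces.

Section ConditionG.
Context (R : realType) (L : choiceType) (d : nat -> measure_display)
  (T : forall n, measurableType (d n)) (P : forall n, probability (T n) R).
Local Notation C := R[i].

(* The index n stands for the matrix size N = n + 1. *)
Variable X : forall n, L -> T n -> 'M[C]_n.+1.
Arguments X : clear implicits.

Variable PMc : forall I : {fset nat}, {set {perm (I * bool)}}.

(* fc n I l p is the value of f_c at p for N = n + 1 and indices lambda_k = l k *)
Variable fc : nat -> forall I : {fset nat}, (I -> L) -> {perm (I * bool)} -> C.
Arguments fc : clear implicits.

Record condition_G : Prop := {
  G_measurable : forall n l i j, cmeasurable (fun w => X n l w i j);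
  (* the expectations of products of traces exist *)
  G_moments : forall (n : nat) (I : {fset nat}) (g : {perm (I * bool)})
      (e : I -> bool) (l : I -> L), posset I -> perm_on (posI I) g ->
    cintegrable (P n)
      (fun w => tr_perm (posI I) g (fun k => mxsgn (e k) (X n (l k) w)));
  G_premap : forall I, posset I -> {in PMc I, forall p, premap p};
  G_factor : forall (I J : {fset nat}) (p : {perm (I * bool)}),
    posset I -> (J `<=` I)%fset ->
    (p \in PMc I /\ ~~ connects J p) <->
    exists (p1 : {perm (J * bool)}) (p2 : {perm ((I `\` J)%fset * bool)}),
      [/\ p1 \in PMc J, p2 \in PMc (I `\` J)%fset &
          act_signed p =1 act_signed p1 \o act_signed p2];
  G_limit : forall (I : {fset nat}) (l : I -> L) p, posset I -> p \in PMc I ->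
    cvg ((fun n => fc n I l p : C^o) @ \oo);
  (* the identity of expectations, whenever all of them exist *)
  G_expectation : forall (n : nat) (I : {fset nat}) (g : {perm (I * bool)})
      (e : I -> bool) (l : I -> L) (Y : I -> T n -> 'M[C]_n.+1),
    let lhs := fun w => tr_perm (posI I) g
                 (fun k => mxsgn (e k) (X n (l k) w) *m Y k w) in
    let pe := fun p => delta_eps e ∘ p ∘ delta_eps e in
    let sigma := fun p => (minus g)^-1%g ∘ pe p ∘ g in
    let rhs := fun p w =>
                 tr_perm (particular (sigma p)) (sigma p) (fun k => Y k w) in
    posset I -> perm_on (posI I) g ->
    (forall k i j, cmeasurable (fun w => Y k w i j)) ->
    independent_families (P n) (X n) Y ->
    cintegrable (P n) lhs ->
    {in PMc I, forall p, cintegrable (P n) (rhs p)} ->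
    cE (P n) lhs =
    \sum_(p in PMc I)
      n.+1%:R ^ (chi g (pe p) - (2 * ncycles (posI I) g)%N%:Z) *
      fc n I l p * cE (P n) (rhs p);
  G_multiplicative : forall (n : nat) (I J : {fset nat}) (JI : (J `<=` I)%fset)
      (l : I -> L) (p : {perm (I * bool)}),
    posset I -> p \in PMc I -> ~~ connects J p ->
    fc n I l p =
    fc n J (l \o fincl JI) (induced JI p) *
    fc n (I `\` J)%fset (l \o fincl (fsubsetDl I J)) (induced (fsubsetDl I J) p);
  G_empty : PMc fset0 = [set 1%g]%SET /\
    forall n (l : (fset0 : {fset nat}) -> L), fc n fset0 l 1%g = 1 }.

End ConditionG.

(* The free algebra over C on indeterminates indexed by K, as the monoid algebra
   of the free monoid.  It needs a name of its own because monalg declares an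
   algType structure on malg for commutative monoids only. *)
Definition ncpoly (C : comNzRingType) (K : choiceType) : Type := malg (fmonom K) C.

HB.instance Definition _ (C : comNzRingType) (K : choiceType) :=
  GRing.Lalgebra.on (ncpoly C K).

Lemma ncpoly_scalerAr (C : comNzRingType) (K : choiceType) (c : C)
    (p q : ncpoly C K) : c *: (p * q) = p * (c *: q).
Proof.
apply/malgP => k; rewrite mcoeffZ mcoeffMl.
rewrite (mcoeffMlw k (fsubset_refl (msupp p)) (msuppZ_le c q)) mulr_sumr.
apply: eq_bigr => u _; rewrite mulr_sumr; apply: eq_bigr => v _.
by rewrite mcoeffZ mulrnAr mulrCA.
Qed.

HB.instance Definition _ (C : comNzRingType) (K : choiceType) :=
  GRing.Lalgebra_isAlgebra.Build C (ncpoly C K) (@ncpoly_scalerAr C K).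

Definition ncvar (C : comNzRingType) (K : choiceType) (k : K) : ncpoly C K :=
  mkmalgU (fmu k) 1.

Definition nceval (C : comNzRingType) (K : choiceType) (A : algType C) (a : K -> A)
    (p : ncpoly C K) : A :=
  \sum_(w <- msupp p) mcoeff w p *: \prod_(k <- (w : seq K)) a k.

Section SecondOrder.
Context (R : realType).
Local Notation C := R[i].

Record second_order_space (A : algType C) (phi1 : A -> C) (phi2 : A -> A -> C) :
    Prop := {
  phi1_linear : forall c a b, phi1 (c *: a + b) = c * phi1 a + phi1 b;
  phi1_unit : phi1 1 = 1;
  phi1_tracial : forall a b, phi1 (a * b) = phi1 (b * a);
  phi2_linearl : forall x c a b, phi2 (c *: a + b) x = c * phi2 a x + phi2 b x;
  phi2_linearr : forall x c a b, phi2 x (c *: a + b) = c * phi2 x a + phi2 x b;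
  phi2_traciall : forall x a b, phi2 (a * b) x = phi2 (b * a) x;
  phi2_tracialr : forall x a b, phi2 x (a * b) = phi2 x (b * a);
  phi2_unitl : forall a, phi2 1 a = 0;
  phi2_unitr : forall a, phi2 a 1 = 0 }.

Context (L : choiceType) (d : nat -> measure_display)
  (T : forall n, measurableType (d n)) (P : forall n, probability (T n) R).
Variable X : forall n, L -> T n -> 'M[C]_n.+1.
Arguments X : clear implicits.

(* The index set ±Lambda is L * bool, with -(l, b) = (l, ~~ b). *)
Definition Tr_poly (n k : nat) (p : ncpoly C 'I_k) (s : 'I_k -> L * bool)
    (w : T n) : C :=
  \tr (nceval (fun j => mxsgn (s j).2 (X n (s j).1 w)) p).

Definition tr_poly (n k : nat) (p : ncpoly C 'I_k) (s : 'I_k -> L * bool)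
    (w : T n) : C :=
  ntr (nceval (fun j => mxsgn (s j).2 (X n (s j).1 w)) p).

Definition pair2 (S : Type) (a b : S) : 'I_2 -> S :=
  fun i => if i == ord0 then a else b.

Record second_order_limit (A : algType C) (phi1 : A -> C) (phi2 : A -> A -> C)
    (x : L * bool -> A) : Prop := {
  lim_space : second_order_space phi1 phi2;
  (* the moments by which the cumulants are defined exist *)
  lim_moments : forall n r (k : 'I_r -> nat) (p : forall i, ncpoly C 'I_(k i))
      (s : forall i, 'I_(k i) -> L * bool),
    cintegrable (P n) (fun w => \prod_i Tr_poly (p i) (s i) w);
  lim_k1 : forall k (p : ncpoly C 'I_k) (s : 'I_k -> L * bool),
    (fun n => cumulant (P n) (fun _ : 'I_1 => tr_poly (n := n) p s) : C^o) @ \oo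
      --> (phi1 (nceval (x \o s) p) : C^o);
  lim_k2 : forall k1 k2 (p1 : ncpoly C 'I_k1) (p2 : ncpoly C 'I_k2)
      (s1 : 'I_k1 -> L * bool) (s2 : 'I_k2 -> L * bool),
    (fun n => cumulant (P n)
       (pair2 (Tr_poly (n := n) p1 s1) (Tr_poly (n := n) p2 s2)) : C^o) @ \oo
      --> (phi2 (nceval (x \o s1) p1) (nceval (x \o s2) p2) : C^o);
  lim_kr : forall r (k : 'I_r -> nat) (p : forall i, ncpoly C 'I_(k i))
      (s : forall i, 'I_(k i) -> L * bool), (3 <= r)%N ->
    (fun n => cumulant (P n) (fun i => Tr_poly (n := n) (p i) (s i)) : C^o) @ \oo
      --> (0 : C^o);
  lim_transpose : exists t : A -> A,
    [/\ forall c a b, t (c *: a + b) = c *: t a + t b,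
        involutive t, forall a b, t (a * b) = t b * t a &
        forall l b, x (l, ~~ b) = t (x (l, b))] }.

End SecondOrder.

Definition seg (n : nat) : {fset nat} := [fset k in iota 1 n]%fset.

Lemma seg_pred_lt n (k : seg n) : ((val k).-1 < n)%N.
Proof.
have := valP k; rewrite !inE mem_iota add1n ltnS => /andP[k0 kn].
by rewrite prednK.
Qed.

(* [insub] turns a number that belongs to I into an element of the type I. *)
Definition pts (I : {fset nat}) (a m : nat) : seq I := pmap insub (iota a m).

Definition signed_pts (I : {fset nat}) (b : bool) (s : seq I) : seq (I * bool) :=
  [seq (k, b) | k <- s].

Definition gamma1 (n : nat) : {perm (seg n * bool)} :=
  cyc (signed_pts true (pts (seg n) 1 n)).

(* (1, ..., m)(m + 1, ..., N) *)
Definition gamma2 (N m : nat) : {perm (seg N * bool)} :=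
  cyc (signed_pts true (pts _ 1 m)) ∘ cyc (signed_pts true (pts _ m.+1 (N - m))).

(* (1, ..., m)(-N, ..., -m - 1) *)
Definition gamma_op (N m : nat) : {perm (seg N * bool)} :=
  cyc (signed_pts true (pts _ 1 m)) ∘
  cyc (signed_pts false (rev (pts _ m.+1 (N - m)))).

(* the domain {1, ..., m, -m-1, ..., -N} of gamma_op *)
Definition dom_op (N m : nat) : {set seg N * bool} :=
  [set k : seg N * bool | k.2 == (val k.1 <= m)%N]%SET.

Section Functionals.
Context (R : realType) (L : choiceType).
Local Notation C := R[i].
Variable PMc : forall I : {fset nat}, {set {perm (I * bool)}}.
Variable fc : nat -> forall I : {fset nat}, (I -> L) -> {perm (I * bool)} -> C.
Arguments fc : clear implicits.

(* The monomial x_{l_1}^(e_1) ... x_{l_n}^(e_n) is the list w of the pairs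
   (l_k, e_k). *)
Definition letter (w : seq (L * bool)) (k : seg (size w)) : L * bool :=
  tnth (in_tuple w) (Ordinal (seg_pred_lt k)).

Definition summand (w : seq (L * bool)) (p : {perm (seg (size w) * bool)}) :
    {perm (seg (size w) * bool)} :=
  let de := delta_eps (fun k => (letter k).2) in
  de ∘ p ∘ (minus p)^-1%g ∘ de.

Definition lim_fc (w : seq (L * bool)) (p : {perm (seg (size w) * bool)}) : C :=
  lim ((fun n => fc n (seg (size w)) (fun k => (letter k).1) p : C^o) @ \oo).

Definition sum_nc (w : seq (L * bool)) (nc : pred {perm (seg (size w) * bool)}) : C :=
  \sum_(p | nc p && (summand p \in PMc (seg (size w)))) lim_fc (summand p).

Definition phi1_word (w : seq (L * bool)) : C :=
  if w is [::] then 1 else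
  sum_nc (disc_nc (posI (seg (size w))) (gamma1 (size w))).

Definition phi2_word (u v : seq (L * bool)) : C :=
  if (u == [::]) || (v == [::]) then 0 else
  let w := u ++ v in let N := size w in let m := size u in
  sum_nc (w := w) (ann_nc (posI (seg N)) (gamma2 N m)) +
  sum_nc (w := w) (ann_nc (dom_op N m) (gamma_op N m)).

Definition phi1 (a : ncpoly C (L * bool)%type) : C :=
  \sum_(w <- msupp a) mcoeff w a * phi1_word w.

Definition phi2 (a b : ncpoly C (L * bool)%type) : C :=
  \sum_(u <- msupp a) \sum_(v <- msupp b)
    mcoeff u a * mcoeff v b * phi2_word u v.

End Functionals.

(* Main.v *)
Require Import Defs.
From HB Require Import structures.
From mathcomp Require Import all_boot all_order all_fingroup all_algebra finmap.
From mathcomp Require Import all_classical all_reals all_analysis.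
From mathcomp Require Import complex.
From mathcomp Require Import -(notations) monalg.
From mathcomp Require Import zify.
Set Implicit Arguments.
Unset Strict Implicit.
Unset Printing Implicit Defensive.

(** The cumulants of traces are computed from condition (G) with all matrices
    [Y] equal to the identity: the joint moment of the normalised traces of
    finitely many words is a sum of [N ^ (chi - 2 #gamma) * f_c] over the
    premaps of [PM_c].  Say that a premap links two words when one of its cycles
    meets the letters of both.  The factorization of [PM_c] and the
    multiplicativity of [f_c] allow one to split off the component of a given
    word, with [chi] adding up.  This is the recursion that determines cumulants
    from moments, so the joint cumulant of [r] unnormalised traces is
    [N ^ (chi - r) * f_c] summed over the premaps that link all the words
    ([cumulant_words]).

    The permutations [gamma_+ gamma_-^-1] and [p] on the signed letters describe
    a hypermap on the orientation double cover of a surface, and [chi] is the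
    Euler characteristic of that surface.  The genus inequality
    #(g) + #(p) + #(gp) <= n + 2 (number of orbits) ([genus_ge0]) gives
    [chi <= 2] when all words are linked, as the cover then has at most two
    components ([chi_le2]).  Hence [N ^ (r - 2)] times the [r]-th cumulant
    converges to the sum of the limits of [f_c] over the linked premaps with
    [chi = 2] ([cvg_cumulant]): for [r >= 3] the cumulant tends to 0, and what
    remains is to identify the limit for one and two words.

    If [chi = 2] the cover is disconnected ([chi2_sheet]): the signed letters
    split into two sheets exchanged by the sign, each a sphere.  The premap is
    recovered from its restriction [q] to a sheet as [q_+ q_-^-1] ([sum_sheet]).
    A sheet contains each word entirely with one sign.  Up to exchange, one word
    admits only the sheet of positive letters, and two words admit this one and
    the one with the second word negated, on which [gamma_+ gamma_-^-1] restricts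
    to [gamma_op]; these are the two sums of [phi_2].

    It remains to see that on a sheet genus 0 is the same as noncrossing.
    Deleting a point from one of the permutations, that is, restricting it to the
    remaining points, amounts to splitting off a fixed point by a transposition,
    and such splittings preserve genus 0 ([defect_split], [planar_split_r]); the
    forbidden patterns have positive genus, so they do not occur in a planar
    pair.  Conversely, a noncrossing permutation of one cycle has a fixed point
    or sends a point to its neighbour, which can be deleted by induction
    ([disc_nc_planar]).  For two cycles, choose [x] such that [p x = y] lies on
    the other cycle; multiplying by the transposition of [x] and [y] glues the
    two cycles into one without changing the genus, and the annular conditions
    become the disc conditions after gluing ([ann_nc_planar]).

    Finally, multilinearity of cumulants passes from words to polynomials
    ([cumulant_sum]), the traciality of the limits is inherited from that of the
    matrix trace by uniqueness of limits, and the involution reverses words and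
    negates their letters. *)

(** * Cycle counts and the genus inequality *)

Section Planarity.
Variable T : finType.
Implicit Types (g p f : {perm T}) (x y z : T).

Lemma pcompE g p x : (g ∘ p) x = g (p x).
Proof. exact: permM. Qed.

Definition ncyc f := #|porbits f|.

(** The graph whose components are the orbits of the group generated by [g]
    and [p]. *)
Definition step g p : rel T := [rel x y | (g x == y) || (p x == y)].

Definition norb g p := n_comp (step g p) T.

(** Euler's relation for genus 0, summed over the orbits, each of which
    contributes 2: cycles of [g], [p] and [g p] are the vertices, edges and faces
    of a hypermap with darts [T]. *)
Definition planar g p := ncyc g + ncyc p + ncyc (g ∘ p) == #|T| + (norb g p).*2.

Lemma mem_porbit1 f x : f x \in porbit f x.
Proof. exact: (mem_porbit f 1). Qed.

Lemma porbit_step f x : porbit f (f x) = porbit f x.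
Proof. exact: (porbit_perm f 1). Qed.

Lemma porbit_closed f (A : pred T) x y :
  (forall z, A z -> A (f z)) -> y \in porbit f x -> A x -> A y.
Proof.
move=> h /porbitP[i ->] Ax; rewrite permX; elim: i => //= i; exact: h.
Qed.

Lemma connect_porbit_l g p x y : y \in porbit g x -> connect (step g p) x y.
Proof.
move=> h; apply: (porbit_closed (A := connect (step g p) x) _ h) => // z xz.
by apply: connect_trans xz _; apply: connect1; rewrite /step /= eqxx.
Qed.

Lemma connect_porbit_r g p x y : y \in porbit p x -> connect (step g p) x y.
Proof.
move=> h; apply: (porbit_closed (A := connect (step g p) x) _ h) => // z xz.
by apply: connect_trans xz _; apply: connect1; rewrite /step /= eqxx orbT.
Qed.

Lemma step_sym g p : connect_sym (step g p).
Proof.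
have hs x y : connect (step g p) x y -> connect (step g p) y x.
  move=> /connectP[s]; elim: s x => [|z s IH] x /= => [_ -> //|].
  move=> /andP[xz ps] /(IH _ ps) yz; apply: connect_trans yz _.
  case/orP: xz => /eqP <-.
    by apply: connect_porbit_l; rewrite porbit_sym mem_porbit1.
  by apply: connect_porbit_r; rewrite porbit_sym mem_porbit1.
by move=> x y; apply/idP/idP; exact: hs.
Qed.

Lemma connect_closed_step g p (A : pred T) x y :
  (forall z, A z -> A (g z)) -> (forall z, A z -> A (p z)) ->
  connect (step g p) x y -> A x -> A y.
Proof.
move=> hg hp /connectP[s]; elim: s x => [|z s IH] x /= => [_ -> //|].
move=> /andP[/orP[]/eqP xz ps] ey Ax; apply: IH ps ey _; rewrite -xz; auto.
Qed.

(** A relation that loses only connections between the components of [x] and of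
    [y] has at most one component more. *)
Lemma norb_le_merge g p g' p' x y :
  (forall z w, connect (step g p) z w -> connect (step g' p') z w \/
     (connect (step g' p') z x \/ connect (step g' p') z y) /\
     (connect (step g' p') w x \/ connect (step g' p') w y)) ->
  norb g' p' <= (norb g p).+1.
Proof.
move=> h; rewrite /norb /n_comp_mem.
have s' := step_sym g' p'; have s := step_sym g p.
set A := predI _ _; set B := predI _ _.
rewrite (cardD1 (fingraph.root (step g' p') y)).
suff : #|[predD1 A & fingraph.root (step g' p') y]| <= #|B|.
  by case: (_ \in A) => /= le; [rewrite add1n ltnS | rewrite add0n ltnW].
have /card_in_imset <- : {in [predD1 A & fingraph.root (step g' p') y] &, injective (fingraph.root (step g p))}.
  move=> z w; rewrite !inE !andbT => /andP[nz rz] /andP[nw rw] /eqP.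
  rewrite (root_connect s) => /h.
  have e u : roots (step g' p') u -> u != fingraph.root (step g' p') y ->
      ~ connect (step g' p') u y.
    by move=> /eqP ru /eqP nu c; apply: nu; rewrite -ru; apply/(fingraph.rootP s').
  have ez := e z rz nz; have ew := e w rw nw.
  case=> [c|[[c1|//] [c2|//]]].
    by rewrite -(eqP rz) -(eqP rw); apply/(fingraph.rootP s').
  rewrite -(eqP rz) -(eqP rw); apply/(fingraph.rootP s').
  by apply: connect_trans c1 _; rewrite s'.
apply: subset_leq_card; apply/fintype.subsetP => u /imsetP[z _ ->].
by rewrite !inE andbT; apply: roots_root.
Qed.

Lemma norb_le_sub g p g' p' :
  (forall z w, connect (step g p) z w -> connect (step g' p') z w) ->
  norb g' p' <= norb g p.
Proof.
move=> h; rewrite /norb /n_comp_mem.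
have s' := step_sym g' p'; have s := step_sym g p.
set A := predI _ _; set B := predI _ _.
have /card_in_imset <- : {in A &, injective (fingraph.root (step g p))}.
  move=> z w; rewrite !inE !andbT => /eqP rz /eqP rw /eqP.
  by rewrite (root_connect s) => /h c; rewrite -rz -rw; apply/(fingraph.rootP s').
apply: subset_leq_card; apply/fintype.subsetP => u /imsetP[z _ ->].
by rewrite !inE andbT; apply: roots_root.
Qed.

Lemma norb_sym g p : norb g p = norb p g.
Proof.
by apply: eq_n_comp; apply: eq_connect => x y; rewrite /step /= orbC.
Qed.

Lemma ncyc_tperm f x y :
  ncyc (f ∘ tperm x y) + (x \notin porbit f y).*2 = ncyc f + (x != y).
Proof. exact: porbits_mul_tperm. Qed.

Lemma ncyc_split f x y : x != y -> y \in porbit f x ->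
  ncyc (f ∘ tperm x y) = (ncyc f).+1.
Proof. by move=> xy yx; have := ncyc_tperm f x y; rewrite porbit_sym yx xy /=; lia. Qed.

Lemma ncyc_merge f x y : y \notin porbit f x ->
  (ncyc (f ∘ tperm x y)).+1 = ncyc f.
Proof.
move=> yx; have := ncyc_tperm f x y; rewrite porbit_sym yx /=.
suff -> : x != y by lia.
by apply: contraNneq yx => <-; rewrite porbit_id.
Qed.

Lemma porbit_conj f h x : porbit (h ∘ f ∘ h^-1%g) (h x) = h @: porbit f x.
Proof.
have it i z : ((h ∘ f ∘ h^-1%g) ^+ i)%g (h z) = h ((f ^+ i)%g z).
  by rewrite !permX; elim: i => //= i ->; rewrite !pcompE permK.
apply/setP => y; apply/porbitP/imsetP => [[i ->]|[z /porbitP[i ->] ->]].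
  by exists ((f ^+ i)%g x); rewrite ?mem_porbit // it.
by exists i; rewrite it.
Qed.

Lemma ncyc_conj f (h : {perm T}) : ncyc (h ∘ f ∘ h^-1%g) = ncyc f.
Proof.
rewrite /ncyc -[RHS](card_imset _ (imset_inj (@perm_inj _ h))).
apply: eq_card => A; apply/imsetP/imsetP => [[x _ ->]|[B /imsetP[x _ ->] ->]].
  by exists (porbit f (h^-1%g x)); rewrite ?imset_f // -porbit_conj permKV.
by exists (h x); rewrite ?porbit_conj.
Qed.

Lemma ncycC g p : ncyc (g ∘ p) = ncyc (p ∘ g).
Proof.
rewrite -(ncyc_conj (g ∘ p) p); congr ncyc; apply/permP => x.
by rewrite !permM permKV.
Qed.

Lemma ncycV f : ncyc f^-1%g = ncyc f.
Proof. by rewrite /ncyc porbitsV. Qed.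

Lemma tpermKc p x y : p ∘ tperm x y ∘ tperm x y = p.
Proof. by apply/permP => z; rewrite !pcompE tpermK. Qed.

Lemma pcompA g p f : g ∘ (p ∘ f) = g ∘ p ∘ f.
Proof. by apply/permP => z; rewrite !pcompE. Qed.

Lemma planar_sym g p : planar g p = planar p g.
Proof. by rewrite /planar ncycC norb_sym [ncyc g + _]addnC. Qed.

(** Only the steps from [x] and [y] change, so a connection that is broken has
    both its ends connected to one of these points. *)
Lemma connect_unsplit g p x y z w :
  connect (step g p) z w -> connect (step g (p ∘ tperm x y)) z w \/
     (connect (step g (p ∘ tperm x y)) z x \/ connect (step g (p ∘ tperm x y)) z y) /\
     (connect (step g (p ∘ tperm x y)) w x \/ connect (step g (p ∘ tperm x y)) w y).
Proof.
set c := connect (step g (p ∘ tperm x y)); move=> h.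
have sc := step_sym g (p ∘ tperm x y).
pose A w := c z w \/ (c z x \/ c z y) /\ (c w x \/ c w y).
have mv u v : A u -> c u v -> A v.
  rewrite /A => -[zu|[h1 h2]] uv; first by left; apply: connect_trans zu uv.
  right; split=> //; case: h2 => h2; [left|right];
    by rewrite /c sc; apply: connect_trans uv; rewrite sc.
suff hA : `[< A w >] by apply/asboolP.
apply: (connect_closed_step (A := fun w => `[< A w >]) _ _ h).
- move=> u /asboolP Au; apply/asboolP; apply: (mv u) => //.
  by apply: connect1; rewrite /step /= eqxx.
- move=> u /asboolP Au; apply/asboolP.
  have st v : c v ((p ∘ tperm x y) v) by apply: connect1; rewrite /step /= eqxx orbT.
  have := st x; have := st y; have := st u; rewrite !pcompE tpermL tpermR.
  case: tpermP => [ux|uy|_ _] cu cy cx; last by apply: mv Au _; exact: cu.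
    rewrite ux in Au *.
    by right; split; [case: Au => [?|[? _]]; [left|] | right; rewrite /c sc].
  rewrite uy in Au *.
  by right; split; [case: Au => [?|[? _]]; [right|] | left; rewrite /c sc].
by apply/asboolP; left; exact: connect0.
Qed.

Lemma norb_split g p x y : norb g (p ∘ tperm x y) <= (norb g p).+1.
Proof. by apply: norb_le_merge => z w; apply: connect_unsplit. Qed.

Lemma norb_split_connected g p x y : connect (step g (p ∘ tperm x y)) x y ->
  norb g (p ∘ tperm x y) <= norb g p.
Proof.
move=> cxy; apply: norb_le_sub => z w /(@connect_unsplit _ _ x y).
have sc := step_sym g (p ∘ tperm x y).
case=> // -[h1 h2].
have {h1} zx : connect (step g (p ∘ tperm x y)) z x.
  by case: h1 => // zy; apply: connect_trans zy _; rewrite sc.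
apply: connect_trans zx _; rewrite sc; case: h2 => // wy.
by apply: connect_trans wy _; rewrite sc.
Qed.

(** Splitting a cycle of [p] gains one cycle of [p].  If [x] and [y] remain
    connected, nothing is lost on the side of orbits and at most one cycle of
    the product disappears; otherwise they lie in different cycles of the new
    product, so that its cycle count has grown as well. *)
Lemma defect_split g p x y : x != y -> y \in porbit p x ->
  ncyc g + ncyc p + ncyc (g ∘ p) + (norb g (p ∘ tperm x y)).*2 <=
  ncyc g + ncyc (p ∘ tperm x y) + ncyc (g ∘ (p ∘ tperm x y)) + (norb g p).*2.
Proof.
move=> xy yx; rewrite (ncyc_split xy yx) pcompA.
have [cxy|ncxy] := boolP (connect (step g (p ∘ tperm x y)) x y).
  have := norb_split_connected cxy; have := ncyc_tperm (g ∘ p) x y; rewrite xy.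
  by case: (_ \in _) => /=; lia.
have : y \notin porbit (g ∘ p ∘ tperm x y) x.
  apply: contra ncxy => /(porbit_closed (A := connect (step g (p ∘ tperm x y)) x)).
  apply=> // z xz; apply: connect_trans xz _.
  rewrite -pcompA pcompE; apply: (@connect_trans _ _ ((p ∘ tperm x y) z)).
    by apply: connect1; rewrite /step /= eqxx orbT.
  by apply: connect1; rewrite /step /= eqxx.
move=> /ncyc_merge; rewrite tpermKc; have := norb_split g p x y; lia.
Qed.

Lemma ncyc1 : ncyc 1%g = #|T|.
Proof.
rewrite /ncyc /porbits -[RHS]cardsT card_in_imset; first by rewrite cardsT; apply: eq_card.
move=> x y _ _ /eqP; rewrite eq_porbit_mem => /porbitP[i ->].
by rewrite expg1n perm1.
Qed.

Lemma norb1 g : norb g 1%g = ncyc g.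
Proof.
rewrite /norb /n_comp_mem /ncyc.
have s := step_sym g 1%g.
have cE x y : connect (step g 1%g) x y = (y \in porbit g x).
  apply/idP/idP => [h|]; last exact: connect_porbit_l.
  apply: (connect_closed_step (A := mem (porbit g x)) _ _ h); last exact: porbit_id.
    by move=> z; rewrite /= -!eq_porbit_mem porbit_step.
  by move=> z; rewrite /= perm1.
have /card_in_imset <- : {in predI (roots (step g 1%g)) T &, injective (porbit g)}.
  move=> x y; rewrite !inE !andbT => /eqP rx /eqP ry /eqP.
  by rewrite eq_sym eq_porbit_mem -cE => c; rewrite -rx -ry; apply/(fingraph.rootP s).
apply: eq_card => A; apply/imsetP/imsetP => -[x xA ->]; first by exists x.
exists (fingraph.root (step g 1%g) x); first by rewrite !inE andbT roots_root.
by apply/eqP; rewrite eq_sym eq_porbit_mem -cE connect_root.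
Qed.

Lemma ncyc_le f : ncyc f <= #|T|.
Proof. exact: leq_imset_card. Qed.

Lemma ncyc_lt f : f != 1%g -> exists2 x, x != f x & ncyc (f ∘ tperm x (f x)) = (ncyc f).+1.
Proof.
move=> f1; have [x fx] : exists x, f x != x.
  apply/existsP; apply: contraNT f1; rewrite negb_exists => /forallP h.
  by apply/eqP/permP => x; rewrite perm1; apply/eqP; have := h x; rewrite negbK.
rewrite eq_sym in fx; exists x => //; apply: ncyc_split => //; exact: mem_porbit1.
Qed.

(** Splitting [p] down to the identity never decreases the difference of the left
    and the right-hand side ([defect_split]), which is 0 for the identity. *)
Lemma genus_ge0 g p : ncyc g + ncyc p + ncyc (g ∘ p) <= #|T| + (norb g p).*2.
Proof.
have [m] := ubnP (#|T| - ncyc p); elim: m p => // m IH p.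
have [-> _|p1] := eqVneq p 1%g.
  have -> : g ∘ 1%g = g by apply/permP => x; rewrite pcompE perm1.
  by rewrite ncyc1 norb1; lia.
have [x xpx e] := ncyc_lt p1 => pm.
have le := ncyc_le (p ∘ tperm x (p x)).
have := IH (p ∘ tperm x (p x)); have := defect_split g xpx (mem_porbit1 p x).
rewrite e; lia.
Qed.

(** Splitting does not decrease the difference of the two sides, and by
    [genus_ge0] this difference cannot become positive. *)
Lemma planar_split_r g p x y : planar g p -> y \in porbit p x ->
  planar g (p ∘ tperm x y).
Proof.
have [<- //|xy] := eqVneq x y.
  by move=> pl _; congr (planar _ _): pl; apply/permP => z; rewrite pcompE tperm1 perm1.
move=> /eqP pl yx; rewrite /planar eqn_leq genus_ge0 /=.
have := defect_split g xy yx; rewrite pl addnAC leq_add2r.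
by [].
Qed.

(** In genus 0, cutting a cycle of [p] between two points that stay connected
    must also merge two cycles of the product. *)
Lemma planar_cut g p x y : planar g p -> x != y -> y \in porbit p x ->
  y \in porbit (g ∘ p) x -> connect (step g (p ∘ tperm x y)) x y -> False.
Proof.
move=> /eqP pl xy yx ygx c; have := genus_ge0 g (p ∘ tperm x y).
have := norb_split_connected c.
rewrite (ncyc_split xy yx) pcompA (ncyc_split xy ygx); lia.
Qed.

End Planarity.

(** * Restricting a permutation to a subset *)

Section Restriction.
Variable T : finType.
Implicit Types (g p f h : {perm T}) (x y z k : T) (A B : pred T).

Lemma first_return_eq A f k s : A k -> A (iter s.+1 f k) ->
  (forall r, r < s -> ~~ A (iter r.+1 f k)) -> first_return A f k = iter s.+1 f k.
Proof.
move=> Ak As ms; have [s' [-> As' ms']] := first_returnP f Ak.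
have [/ms|/ms'|->//] := ltngtP s' s; last by rewrite As.
by rewrite As'.
Qed.

Lemma first_return_in A f k : A k -> A (first_return A f k).
Proof. by move=> /(first_returnP f)[s [-> As _]]. Qed.

Lemma first_return1 A f k : A k -> A (f k) -> first_return A f k = f k.
Proof. by move=> Ak Afk; apply: (@first_return_eq A f k 0). Qed.

Lemma eq_first_return A B (u v : T -> T) : A =1 B -> u =1 v ->
  first_return A u =1 first_return B v.
Proof.
move=> AB uv k; rewrite /first_return.
have -> : find (fun s => A (iter s.+1 u k)) (iota 0 #|T|) =
   find (fun s => B (iter s.+1 v k)) (iota 0 #|T|).
  by apply: eq_find => i; rewrite AB (eq_iter uv).
exact: eq_iter.
Qed.

Definition rp_fun A f k := if A k then first_return A f k else k.

Lemma rp_inj A f : injective (rp_fun A f).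
Proof.
move=> k l; rewrite /rp_fun; case: ifP => Ak; case: ifP => Al //.
- exact: first_return_inj.
- by move=> e; have := first_return_in f Ak; rewrite e Al.
by move=> e; have := first_return_in f Al; rewrite -e Ak.
Qed.

(** The restriction of [f] to [A], continued by the identity, so that
    restrictions to different sets live on the same type. *)
Definition rp A f : {perm T} := perm (@rp_inj A f).

Lemma rpE A f k : rp A f k = if A k then first_return A f k else k.
Proof. by rewrite permE. Qed.

Lemma rp_mem A f k : A (rp A f k) = A k.
Proof. by rewrite rpE; case: ifP => // /(first_return_in f). Qed.

Lemma rp1 A f k : A k -> A (f k) -> rp A f k = f k.
Proof. by move=> Ak Afk; rewrite rpE Ak first_return1. Qed.

Lemma eq_rp A B f : A =1 B -> rp A f = rp B f.
Proof.
move=> AB; apply/permP => k; rewrite !rpE AB.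
by rewrite (eq_first_return AB (frefl f)).
Qed.

Lemma rpT f : rp predT f = f.
Proof. by apply/permP => k; rewrite rp1. Qed.

(** Removing [x] from the domain makes [f] skip over it: the point sent to [x]
    is now sent to the image of [x], which is multiplication by a transposition. *)
Lemma rp_rem A f x :
  rp [pred z | A z & z != x] f = rp A f ∘ tperm x ((rp A f)^-1%g x).
Proof.
set h := rp A f; set y := (h^-1)%g x.
have hy : h y = x by rewrite permKV.
have hE z : A z -> h z = first_return A f z by move=> Az; rewrite /h rpE Az.
apply/permP => z; rewrite pcompE rpE /=; case: tpermP => [->|->|/eqP zx /eqP zy].
- by rewrite eqxx andbF hy.
- have [xy|xy] := eqVneq y x; first by rewrite andbF -{1}xy hy xy.
  have Ay : A y by apply: contraNT xy => Ay; rewrite -hy /h rpE (negbTE Ay).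
  have Ax : A x by rewrite -hy /h rp_mem.
  rewrite Ay /= hE //; move: (hy); rewrite hE //.
  have [s [e As ms]] := first_returnP f Ay; rewrite e => ex.
  have [s' [e' As' ms']] := first_returnP f Ax.
  have it r : iter (r.+1 + s.+1) f y = iter r.+1 f x by rewrite iterD ex.
  rewrite e' -it addSn; apply: first_return_eq; first by rewrite /= Ay.
    rewrite -addSn it /= -iterS As' /=.
    rewrite -iterS -e' -hE //; apply: contraNneq xy => ehx.
    by apply/eqP; apply: (@perm_inj _ h); rewrite hy ehx.
  move=> r rs; rewrite negb_and negbK.
  have [rs'|sr|->] := ltngtP r s; first by rewrite ms.
    have -> : r.+1 = (r - s.+1).+1 + s.+1 by lia.
    by rewrite it ms' //; lia.
  by rewrite ex eqxx orbT.
rewrite zx andbT -/h; case: ifP => Az; last by rewrite /h rpE Az.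
rewrite hE //; have [s [e As ms]] := first_returnP f Az; rewrite e.
apply: first_return_eq => /=; first by rewrite Az.
  rewrite -iterS As /= -iterS -e -hE //.
  by apply: contraNneq zy => ehz; apply/eqP/(@perm_inj _ h); rewrite hy.
by move=> r /ms; rewrite -iterS => /negbTE ->.
Qed.

(** Restriction is iterated deletion of points, so it preserves every property
    stable under splitting off one fixed point. *)
Lemma rp_ind (P : {perm T} -> Prop) f :
  P f -> (forall h x, P h -> P (h ∘ tperm x (h^-1%g x))) -> forall A, P (rp A f).
Proof.
move=> Pf step A.
have -> : rp A f = rp [pred z | z \notin enum (predC A)] f.
  by apply: eq_rp => z; rewrite /= mem_enum inE negbK.
elim: (enum _) => [|x s IH]; first by rewrite (_ : rp _ f = f) // -[RHS]rpT; apply: eq_rp.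
have -> : rp [pred z | z \notin x :: s] f = rp [pred z | [pred z | z \notin s] z & z != x] f.
  by apply: eq_rp => z; rewrite /= inE negb_or andbC.
by rewrite rp_rem; apply: step.
Qed.

Lemma rp_trans A B f : subpred B A -> rp B (rp A f) = rp B f.
Proof.
move=> BA; pose C (s : seq T) := [pred z | A z & z \notin s].
have e : B =1 C (enum (predC B)).
  by move=> z; rewrite /= mem_enum inE negbK; case: (boolP (B z)) => [/BA ->|]; rewrite ?andbF.
rewrite !(eq_rp _ e); elim: (enum _) => [|x s IH].
  have e0 : C [::] =1 A by move=> z; rewrite /= andbT.
  rewrite !(eq_rp _ e0); apply/permP => k; rewrite rpE; case: ifP => Ak; last by rewrite rpE Ak.
  by rewrite first_return1 // rp_mem.
have es : C (x :: s) =1 [pred z | C s z & z != x].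
  by move=> z; rewrite /= inE negb_or andbA andbAC.
by rewrite !(eq_rp _ es) !rp_rem IH.
Qed.

Lemma planar_rp_r A g p : planar g p -> planar g (rp A p).
Proof.
move=> pl; apply: (@rp_ind (planar g)) => // h x plh; apply: planar_split_r => //.
by rewrite porbit_sym -{1}(permKV h x) mem_porbit1.
Qed.

Lemma planar_rp_l A g p : planar g p -> planar (rp A g) p.
Proof. by rewrite !(planar_sym _ p); apply: planar_rp_r. Qed.

Lemma rp_porbit A f k : rp A f k \in porbit f k.
Proof.
rewrite rpE; case: ifP => [Ak|_]; last exact: porbit_id.
by have [s [-> _ _]] := first_returnP f Ak; rewrite -permX mem_porbit.
Qed.

Lemma restricts_toP (u : {perm T}) (ss : seq (seq T)) :
  reflect (uniq (flatten ss) /\ forall c, c \in ss ->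
     forall k, k \in c -> rp (mem (flatten ss)) u k = next c k) (restricts_to u ss).
Proof.
apply: (iffP andP) => -[us h]; split=> //.
  move=> c cs k kc; have := allP (allP h c cs) k kc => /eqP <-; rewrite rpE ifT //.
  by apply/flattenP; exists c.
apply/allP => c cs; apply/allP => k kc; rewrite -(h c cs k kc) rpE ifT //.
by apply/flattenP; exists c.
Qed.

Lemma restricts_to_rp (u v : {perm T}) (ss : seq (seq T)) :
  rp (mem (flatten ss)) u = rp (mem (flatten ss)) v -> restricts_to u ss = restricts_to v ss.
Proof.
by move=> e; apply/restricts_toP/restricts_toP => -[h1 h2]; split=> // c cs k /h2; rewrite e => <-.
Qed.

Lemma eq_restricts_to (u v : T -> T) ss : u =1 v -> restricts_to u ss = restricts_to v ss.
Proof.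
move=> uv; congr (_ && _); apply: eq_all => c; apply: eq_all => k.
by rewrite (eq_first_return (frefl _) uv).
Qed.

(** ** Crossing patterns have positive genus *)

(** Restricted to [a, b, c] both permutations send [a] to [b], [b] to [c] and [c]
    to [a], so [g p] sends [a] to [c] and [c] to [b].  Thus [a] and [b] share a
    cycle of [p] and one of [g p], and [g] keeps them connected, which
    [planar_cut] excludes.  The patterns below are excluded in the same way. *)
Lemma planar_no_s1 g p a b c : planar g p ->
  restricts_to g [:: [:: a; b; c]] -> restricts_to p [:: [:: a; b; c]] -> False.
Proof.
move=> pl /restricts_toP[u hg] /restricts_toP[_ hp].
move: (u); rewrite /= !inE !negb_or !andbT => /andP[/andP[ab ac] bc].
set A : pred T := mem _ in hg hp.
have {}pl := planar_rp_r A (planar_rp_l A pl).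
have g' := hg _ (mem_head _ _); have p' := hp _ (mem_head _ _).
have ga : rp A g a = b by rewrite g' ?inE ?eqxx //= eqxx.
have gb : rp A g b = c by rewrite g' ?inE ?eqxx ?orbT //= eq_sym (negbTE ab) eqxx.
have gc : rp A g c = a.
  by rewrite g' ?inE ?eqxx ?orbT //= eq_sym (negbTE ac) eq_sym (negbTE bc) eqxx.
have pa : rp A p a = b by rewrite p' ?inE ?eqxx //= eqxx.
have pb : rp A p b = c by rewrite p' ?inE ?eqxx ?orbT //= eq_sym (negbTE ab) eqxx.
have pc : rp A p c = a.
  by rewrite p' ?inE ?eqxx ?orbT //= eq_sym (negbTE ac) eq_sym (negbTE bc) eqxx.
apply: (planar_cut pl ab); first by rewrite -pa mem_porbit1.
  by apply/porbitP; exists 2; rewrite permX /= !pcompE pa gb pc ga.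
by apply: connect_porbit_l; rewrite -ga mem_porbit1.
Qed.

Lemma next4 (a b c d : T) : uniq [:: a; b; c; d] ->
  [/\ next [:: a; b; c; d] a = b, next [:: a; b; c; d] b = c,
      next [:: a; b; c; d] c = d & next [:: a; b; c; d] d = a].
Proof.
rewrite /= !inE !negb_or !andbT => /andP[/and3P[ab ac ad] /andP[/andP[bc bd] cd]].
by rewrite !eqxx !(eq_sym _ a) (negbTE ab) (negbTE ac) (negbTE ad) !(eq_sym _ b)
  (negbTE bc) (negbTE bd) (eq_sym _ c) (negbTE cd).
Qed.

Lemma next2 (a b : T) : uniq [:: a; b] -> next [:: a; b] a = b /\ next [:: a; b] b = a.
Proof.
by rewrite /= inE andbT => ab; rewrite eqxx eq_sym (negbTE ab) eqxx.
Qed.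

Lemma planar_no_n1 g p a b c d : planar g p ->
  restricts_to g [:: [:: a; b; c; d]] -> restricts_to p [:: [:: a; c]; [:: b; d]] -> False.
Proof.
move=> pl /restricts_toP[/= u hg] /restricts_toP[/= up hp].
set A : pred T := mem _ in hg.
rewrite (_ : rp _ p = rp A p) in hp; last first.
  by apply: eq_rp => z; rewrite /A /= !inE; do !case: (_ == _).
have {}pl := planar_rp_r A (planar_rp_l A pl).
have [ga gb gc gd] := next4 u.
have g' := hg _ (mem_head _ _).
have ac : a != c by move: u; rewrite /= !inE !negb_or => /andP[/and3P[]].
have bd : b != d by move: u; rewrite /= !inE !negb_or => /andP[_ /andP[/andP[]]].
have [pa pc] : next [:: a; c] a = c /\ next [:: a; c] c = a by apply: next2; rewrite /= inE ac.
have [pb pd] : next [:: b; d] b = d /\ next [:: b; d] d = b by apply: next2; rewrite /= inE bd.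
have p'1 := hp _ (mem_head _ _).
have p'2 : forall k, k \in [:: b; d] -> rp A p k = next [:: b; d] k.
  by apply: hp; rewrite !inE eqxx orbT.
move: ga gb gc gd pa pc pb pd.
rewrite -!g' -?p'1 -?p'2 ?inE ?eqxx ?orbT // => ga gb gc gd pa pc pb pd.
apply: (planar_cut pl ac); first by rewrite -pa mem_porbit1.
  by apply/porbitP; exists 2; rewrite permX /= !pcompE pa gc pd gb.
by apply: connect_porbit_l; apply/porbitP; exists 2; rewrite permX /= ga gb.
Qed.

Lemma planar_no_s2 g p a b c d : planar g p ->
  restricts_to g [:: [:: a; b]; [:: c; d]] -> restricts_to p [:: [:: a; c; b; d]] -> False.
Proof.
move=> pl /restricts_toP[/= u hg] /restricts_toP[/= up hp].
set A : pred T := mem _ in hg.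
rewrite (_ : rp _ p = rp A p) in hp; last first.
  by apply: eq_rp => z; rewrite /A /= !inE; do !case: (_ == _).
have {}pl := planar_rp_r A (planar_rp_l A pl).
have [pa pc pb pd] := next4 up.
have p' := hp _ (mem_head _ _).
move: (u); rewrite /= !inE !negb_or => /andP[/and3P[ab ac ad] /and3P[/andP[bc bd] cd _]].
have [ga gb] : next [:: a; b] a = b /\ next [:: a; b] b = a by apply: next2; rewrite /= inE ab.
have [gc gd] : next [:: c; d] c = d /\ next [:: c; d] d = c by apply: next2; rewrite /= inE cd.
have g'1 := hg _ (mem_head _ _).
have g'2 : forall k, k \in [:: c; d] -> rp A g k = next [:: c; d] k.
  by apply: hg; rewrite !inE eqxx orbT.
move: ga gb gc gd pa pc pb pd.
rewrite -!p' -?g'1 -?g'2 ?inE ?eqxx ?orbT // => ga gb gc gd pa pc pb pd.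
apply: (planar_cut pl ac); first by rewrite -pa mem_porbit1.
  by apply/porbitP; exists 3; rewrite permX /= !pcompE pa gc pd ga pb gd.
apply: (@connect_trans _ _ b); first by apply: connect1; rewrite /step /= ga eqxx.
apply: (@connect_trans _ _ d).
  by apply: connect1; rewrite /step /= pcompE tpermD 1?eq_sym // 1?eq_sym // pb eqxx orbT.
by apply: connect1; rewrite /step /= gd eqxx.
Qed.

(** ** Cycles given by lists *)

Lemma fcycle_rot (f : T -> T) (s : seq T) a : uniq s -> a \in s ->
  exists t, [/\ exists i, rot i s = a :: t, uniq (a :: t), s =i a :: t &
    fcycle f s = fcycle f (a :: t)].
Proof.
move=> us /rot_to[i t e]; exists t; split; first by exists i.
- by rewrite -e rot_uniq.
- by move=> z; rewrite -e mem_rot.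
by rewrite -e rot_cycle.
Qed.

Lemma first_return_path A f k l t : A l -> fpath f k (rcons t l) ->
  exists r, [/\ iter r.+1 f k = head l (seq.filter A t) &
     forall r', r' < r -> ~~ A (iter r'.+1 f k)].
Proof.
move=> Al; elim: t k => [|w t IH] k /=; first by rewrite andbT => /eqP fk; exists 0.
case/andP=> /eqP fk pw; case: ifPn => Aw; first by exists 0.
have [r [e ms]] := IH _ pw; exists r.+1; split; first by rewrite iterSr fk.
by case=> [|r'] rr; [rewrite /= fk | rewrite iterSr fk ms].
Qed.

Lemma next_head (k : T) t : next (k :: t) k = head k t.
Proof. by case: t => [|z t] /=; rewrite eqxx. Qed.

Lemma first_return_filter A f (s : seq T) k : uniq s -> fcycle f s -> k \in s -> A k ->
  first_return A f k = next (seq.filter A s) k.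
Proof.
move=> us cs ks Ak; have [t [[i e] ut _ ct]] := fcycle_rot f us ks.
have e1 : rot (size (seq.filter A (take i s))) (seq.filter A s) = seq.filter A (k :: t).
  by rewrite -{2}(cat_take_drop i s) filter_cat rot_size_cat -filter_cat -e.
rewrite -(next_rot (size (seq.filter A (take i s)))) ?filter_uniq // e1 /= Ak next_head.
move: cs; rewrite ct /= => /(first_return_path Ak)[r [er ms]]; rewrite -er.
apply: first_return_eq => //; rewrite er.
by have := filter_all A t; case: (seq.filter A t) => //= z u /andP[].
Qed.

(** On a cycle given as a list, restriction is deletion from the list. *)
Lemma rp_filter A f (s : seq T) k : uniq s -> fcycle f s -> k \in s ->
  rp A f k = next (seq.filter A s) k.
Proof.
move=> us cs ks; rewrite rpE; case: ifP => Ak; first exact: first_return_filter.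
by rewrite next_nth mem_filter Ak.
Qed.

Lemma restricts_to1 f (s c : seq T) : uniq s -> fcycle f s -> subseq c s ->
  restricts_to f [:: c].
Proof.
move=> us cs sub; have uc := subseq_uniq sub us.
apply/restricts_toP; rewrite /= cats0; split=> // _ /[1!inE] /eqP -> k kc.
rewrite (rp_filter _ us cs) ?(mem_subseq sub) //.
by have /subseq_uniqP <- := sub.
Qed.

Lemma restricts_to2 f (s1 s2 c1 c2 : seq T) : uniq (s1 ++ s2) ->
  fcycle f s1 -> fcycle f s2 -> subseq c1 s1 -> subseq c2 s2 ->
  restricts_to f [:: c1; c2].
Proof.
move=> us cs1 cs2 sub1 sub2.
have := us; rewrite cat_uniq => /and3P[us1 /hasPn dis us2].
have ucs := subseq_uniq (cat_subseq sub1 sub2) us.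
have f1 : seq.filter (mem (c1 ++ c2)) s1 = c1.
  rewrite [RHS](subseq_uniqP us1 sub1); apply: eq_in_filter => z zs /=.
  rewrite mem_cat orbC; case: (boolP (z \in c2)) => // /(mem_subseq sub2) /dis.
  by rewrite zs.
have f2 : seq.filter (mem (c1 ++ c2)) s2 = c2.
  rewrite [RHS](subseq_uniqP us2 sub2); apply: eq_in_filter => z zs /=.
  rewrite mem_cat; case: (boolP (z \in c1)) => // /(mem_subseq sub1) zs1.
  by have := dis _ zs; rewrite zs1.
apply/restricts_toP; rewrite /= cats0; split=> // c /[!inE] /orP[]/eqP -> k kc.
  by rewrite (rp_filter _ us1 cs1) ?(mem_subseq sub1) // f1.
by rewrite (rp_filter _ us2 cs2) ?(mem_subseq sub2) // f2.
Qed.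

Lemma fcycle_next f (s : seq T) : uniq s -> {in s, f =1 next s} -> fcycle f s.
Proof.
move=> us fs; apply: (sub_in_cycle (P := mem s) (e := frel (next s))) (cycle_next us).
  by move=> x y xs _ /= /eqP <-; rewrite fs.
exact/allP.
Qed.

Lemma fcycle_nextE f (s : seq T) : uniq s -> fcycle f s -> {in s, f =1 next s}.
Proof. by move=> us cs k ks; apply/eqP; exact: (next_cycle cs ks). Qed.

(** A cycle of [f] lists the points of a cyclic pattern in the order of the
    pattern, up to rotation. *)
Lemma restricts_to1_rot f (s c : seq T) a : uniq s -> fcycle f s -> a \in s ->
  restricts_to f [:: a :: c] ->
  rot (index a [seq z <- s | z \in a :: c]) [seq z <- s | z \in a :: c] = a :: c.
Proof.
move=> us cs as_ /restricts_toP[]; rewrite /= cats0 => uc hc.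
set A : pred T := mem _ in hc; set t := seq.filter _ s.
have {}hc k : k \in a :: c -> rp A f k = next (a :: c) k by apply: hc; rewrite inE.
have ut : uniq t by rewrite filter_uniq.
have at_ : a \in t by rewrite mem_filter mem_head.
have ct : fcycle (rp A f) t.
  apply: fcycle_next => // k; rewrite mem_filter => /andP[_ ks].
  by rewrite (rp_filter _ us cs).
have cc : fcycle (rp A f) (a :: c) by apply: fcycle_next.
rewrite -(fingraph.orbitE ct ut at_) (fingraph.orbitE cc uc (mem_head _ _)).
by rewrite /= eqxx rot0.
Qed.

Lemma cycE (s : seq T) k : uniq s -> cyc s k = next s k.
Proof. by move=> us; rewrite permE undup_id. Qed.

Lemma cyc_fcycle (s : seq T) : uniq s -> fcycle (cyc s) s.
Proof. by move=> us; apply: fcycle_next => // k _; rewrite cycE. Qed.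

Lemma cyc_out (s : seq T) k : uniq s -> k \notin s -> cyc s k = k.
Proof. by move=> us ks; rewrite cycE // next_nth (negbTE ks). Qed.

Lemma cyc_eq f (s : seq T) : uniq s -> fcycle f s -> (forall k, k \notin s -> f k = k) ->
  f = cyc s.
Proof.
move=> us cs fs; apply/permP => k; have [ks|ks] := boolP (k \in s).
  by rewrite cycE //; apply: fcycle_nextE.
by rewrite cyc_out // fs.
Qed.

Lemma rp_out A f k : f k = k -> rp A f k = k.
Proof.
by move=> fk; rewrite rpE; case: ifP => // Ak; rewrite first_return1 // fk.
Qed.

Lemma rp_cyc A (s : seq T) : uniq s -> rp A (cyc s) = cyc (seq.filter A s).
Proof.
move=> us; apply: cyc_eq; first by rewrite filter_uniq.
  apply: fcycle_next => [|k]; first by rewrite filter_uniq.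
  by rewrite mem_filter => /andP[_ ks]; rewrite (rp_filter _ us) ?cyc_fcycle.
move=> k; rewrite mem_filter negb_and; have [ks|ks _] := boolP (k \in s).
  by rewrite orbF rpE => /negbTE ->.
by rewrite rp_out // cyc_out.
Qed.

Lemma porbit_fconnect f x y : fconnect f x y = (y \in porbit f x).
Proof.
apply/idP/porbitP => [/iter_findex <-|[i ->]]; last by rewrite permX fconnect_iter.
by exists (findex f x y); rewrite permX.
Qed.

Lemma porbit_fcycle f (s : seq T) x y : fcycle f s -> x \in s ->
  (y \in porbit f x) = (y \in s).
Proof. by move=> cs xs; rewrite -porbit_fconnect (fconnect_cycle cs xs). Qed.

Lemma cyc_rot i (s : seq T) : uniq s -> cyc (rot i s) = cyc s.
Proof. by move=> us; apply/permP => k; rewrite !cycE ?rot_uniq // next_rot. Qed.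

(** If [p] preserves the cycles of [g], it adds no connection to them. *)
Lemma norb_ncyc g p : (forall z, p z \in porbit g z) -> norb g p = ncyc g.
Proof.
move=> h; rewrite -norb1; apply: eq_n_comp => x y.
have cE (q : {perm T}) u v : (forall z, q z \in porbit g z) -> connect (step g q) u v = (v \in porbit g u).
  move=> hq; apply/idP/idP => [c|]; last exact: connect_porbit_l.
  apply: (connect_closed_step (A := mem (porbit g u)) _ _ c); last exact: porbit_id.
    by move=> z; rewrite /= -!eq_porbit_mem porbit_step.
  by move=> z; rewrite /= -!eq_porbit_mem => /eqP <-; rewrite eq_porbit_mem.
by rewrite !cE // => z; rewrite perm1 porbit_id.
Qed.

(** For a single cycle, [norb] and [ncyc] of the cycle agree, so that the
    relation of genus 0 involves cycle counts only. *)
Lemma planar_cyc (s : seq T) p : uniq s -> perm_on [set z in s] p ->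
  planar (cyc s) p = (ncyc p + ncyc (cyc s ∘ p) == #|T| + ncyc (cyc s)).
Proof.
move=> us ps; rewrite /planar norb_ncyc; first by apply/eqP/eqP; lia.
move=> z; have [zs|zs] := boolP (z \in s).
  rewrite (porbit_fcycle _ (cyc_fcycle us) zs).
  by have := perm_closed z ps; rewrite !inE => ->.
by rewrite (out_perm ps) ?porbit_id // inE.
Qed.

(** ** Patterns and the cycles that contain them *)

Lemma restricts_to_perm_on (D : {set T}) f ss : perm_on D f -> restricts_to f ss ->
  all (fun c => 1 < size c) ss -> {subset flatten ss <= D}.
Proof.
move=> fD /restricts_toP[u h] /allP sz z /flattenP[c cs zc]; apply: contraT => zD.
have uc : uniq c.
  by move: u; elim: (ss) cs => //= e ss' IH; rewrite inE cat_uniq => /orP[/eqP ->|/IH{}IH] /and3P[].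
have := h c cs z zc; rewrite rp_out; last exact: out_perm zD.
move=> e; have := sz c cs; have [t [[i ei] ut mt _]] := fcycle_rot f uc zc.
rewrite -(size_rot i) ei; move: e; rewrite -(next_rot i uc) ei next_head.
by case: t {ei mt} ut => //= w t /andP[/[!inE] /norP[/eqP]].
Qed.

Lemma restricts_to1_of_rot f (s c : seq T) i : uniq s -> fcycle f s ->
  rot i [seq z <- s | z \in c] = c -> restricts_to f [:: c].
Proof.
move=> us cys e; have uc : uniq c by rewrite -e rot_uniq filter_uniq.
apply/restricts_toP; rewrite /= cats0; split=> // _ /[1!inE] /eqP -> k kc.
have ks : k \in s by move: kc; rewrite -e mem_rot mem_filter => /andP[].
by rewrite (rp_filter _ us cys) // -[in RHS]e next_rot // filter_uniq.
Qed.

Lemma restricts_to_rot f (c : seq T) i : restricts_to f [:: rot i c] = restricts_to f [:: c].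
Proof.
apply/restricts_toP/restricts_toP; rewrite /= !cats0 rot_uniq => -[u h]; split=> // _ /[1!inE] /eqP -> k kc.
  rewrite -(next_rot i u) -(h (rot i c)) ?inE ?mem_rot //.
  by congr (fun_of_perm _ k); apply: eq_rp => z /=; rewrite mem_rot.
rewrite next_rot // -(h c) ?inE //; last by rewrite -(mem_rot i).
by congr (fun_of_perm _ k); apply: eq_rp => z /=; rewrite mem_rot.
Qed.

Lemma restricts_to_of_rp A f ss : all (fun c => 1 < size c) ss ->
  restricts_to (rp A f) ss -> restricts_to f ss.
Proof.
move=> sz h; rewrite -(restricts_to_rp (u := rp A f)) // rp_trans //.
have fD : perm_on [set z | A z] (rp A f).
  apply/fintype.subsetP => z; rewrite !inE; apply: contraNT => nAz.
  by rewrite rpE (negbTE nAz).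
by move=> z zs; have := restricts_to_perm_on fD h sz zs; rewrite inE.
Qed.

Lemma porbit_cycle f x : exists t, [/\ uniq (x :: t), fcycle f (x :: t) &
  forall z, (z \in porbit f x) = (z \in x :: t)].
Proof.
have e : fingraph.orbit f x = x :: behead (fingraph.orbit f x).
  by have := fingraph.order_gt0 f x; rewrite /fingraph.orbit; case: (fingraph.order f x).
exists (behead (fingraph.orbit f x)); rewrite -e fingraph.orbit_uniq; split=> //.
  exact: (cycle_orbit (@perm_inj _ f)).
by move=> z; rewrite -fconnect_orbit porbit_fconnect.
Qed.

(** The restriction of a cycle of [f] to the points of the pattern is a single
    cycle. *)
Lemma restricts_to_porbit f ss c a b : restricts_to f ss -> c \in ss -> a \in c ->
  b \in flatten ss -> (b \in porbit f a) = (b \in c).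
Proof.
move=> /restricts_toP[u h] cs ac bs.
have uc : uniq c.
  by move: u; elim: (ss) cs => //= e ss' IH; rewrite inE cat_uniq => /orP[/eqP ->|/IH{}IH] /and3P[].
have as_ : a \in flatten ss by apply/flattenP; exists c.
set A : pred T := mem (flatten ss).
have cc : fcycle (rp A f) c by apply: fcycle_next => // k kc; apply: h.
rewrite -(porbit_fcycle _ cc ac); apply/idP/idP => [|/porbitP[i ->]].
  have [t [ut ct mt]] := porbit_cycle f a; rewrite mt => bt.
  have ct' : fcycle (rp A f) (seq.filter A (a :: t)).
    apply: fcycle_next => [|k]; first by rewrite filter_uniq.
    by rewrite mem_filter => /andP[_ ks]; rewrite (rp_filter _ ut).
  by rewrite (porbit_fcycle _ ct') ?mem_filter ?bt ?mem_head ?andbT.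
apply: (porbit_closed (f := rp A f) (A := mem (porbit f a))) (mem_porbit _ i a) _; last exact: porbit_id.
move=> z /=; rewrite -!eq_porbit_mem => /eqP <-; by rewrite eq_porbit_mem rp_porbit.
Qed.

Lemma subseq_catP (t s1 s2 : seq T) : subseq t (s1 ++ s2) ->
  exists t1 t2, [/\ t = t1 ++ t2, subseq t1 s1 & subseq t2 s2].
Proof.
case/subseqP => m sm ->; rewrite -(cat_take_drop (size s1) m) mask_cat; last first.
  by rewrite size_takel // sm size_cat leq_addr.
exists (mask (take (size s1) m) s1), (mask (drop (size s1) m) s2).
by split=> //; apply: mask_subseq.
Qed.

(** First returns are decided within the cycle of the starting point. *)
Lemma rp_local A B f k : {in porbit f k, A =1 B} -> rp A f k = rp B f k.
Proof.
have [t [ut ct mt]] := porbit_cycle f k => h; rewrite !(rp_filter _ ut ct) ?mem_head //.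
by congr (next _ k); apply: eq_in_filter => z; rewrite -mt; apply: h.
Qed.

(** The points of the other cycles do not affect the first returns within the
    cycle of [a] ([rp_local]). *)
Lemma restricts_to_cons f a c ss : restricts_to f [:: a :: c] -> restricts_to f ss ->
  (forall z, z \in flatten ss -> z \notin porbit f a) -> restricts_to f ((a :: c) :: ss).
Proof.
move=> h1 h2 dis; have ca z : z \in a :: c -> z \in porbit f a.
  by move=> zc; rewrite (restricts_to_porbit h1 (mem_head _ _) (mem_head _ _)) //= cats0.
have po z : z \in porbit f a -> porbit f z = porbit f a by rewrite -eq_porbit_mem => /eqP.
have /restricts_toP[u1 r1] := h1; have /restricts_toP[u2 r2] := h2.
have fl : flatten ((a :: c) :: ss) = (a :: c) ++ flatten ss by [].
apply/restricts_toP; split.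
  rewrite [flatten _]/= cats0 in u1; rewrite fl cat_uniq u1 u2 andbT /=.
  by apply/hasPn => z /dis; apply: contra (ca z).
move=> e; rewrite inE => /orP[/eqP ->|es] k ke.
  rewrite -(r1 (a :: c)) ?mem_head //; apply: rp_local => z; rewrite (po k (ca k ke)) => za.
  change ((z \in (a :: c) ++ flatten ss) = (z \in (a :: c) ++ [::])); rewrite cats0 mem_cat orbC.
  by case: (boolP (z \in flatten ss)) => // /dis; rewrite za.
have ks : k \in flatten ss by apply/flattenP; exists e.
rewrite -(r2 e) //; apply: rp_local => z zk.
change ((z \in (a :: c) ++ flatten ss) = (z \in flatten ss)); rewrite mem_cat.
case: (boolP (z \in a :: c)) => // /ca za; have := dis k ks.
by rewrite -(po z za) porbit_sym zk.
Qed.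

Lemma restricts_to_pair f u v : u != v -> v \in porbit f u -> restricts_to f [:: [:: u; v]].
Proof.
move=> uv; have [t [ut ct mt]] := porbit_cycle f u; rewrite mt inE eq_sym (negbTE uv) => vt.
by apply: (restricts_to1 ut ct); rewrite /= eqxx sub1seq.
Qed.

Lemma restricts_to22 p u v b d : u != v -> b != d -> v \in porbit p u ->
  d \in porbit p b -> b \notin porbit p u -> restricts_to p [:: [:: u; v]; [:: b; d]].
Proof.
move=> uv bd vu db bu; apply: restricts_to_cons; try exact: restricts_to_pair.
move=> z; rewrite !inE => /orP[]/eqP -> //; apply: contra bu.
by move: db; rewrite -!eq_porbit_mem => /eqP ->.
Qed.

Lemma porbit_cycle2 f x : f x != x -> exists t, [/\ uniq (x :: f x :: t),
  fcycle f (x :: f x :: t) & forall z, (z \in porbit f x) = (z \in x :: f x :: t)].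
Proof.
move=> fx; have [[|y t] [ut ct mt]] := porbit_cycle f x.
  by move: ct; rewrite /= andbT (negbTE fx).
have /eqP e : f x == y by move: ct => /= /andP[].
by exists t; rewrite e.
Qed.

(** * Disc-noncrossing permutations *)

(** The points range over the whole type because a pattern with cycles of length
    at least 2 lies in the support of the permutation ([restricts_to_perm_on]). *)
Definition noncrossing (u v : T -> T) :=
  (forall a b c, restricts_to u [:: [:: a; b; c]] ->
     restricts_to v [:: [:: a; b; c]] -> False) /\
  (forall a b c d, restricts_to u [:: [:: a; b; c; d]] ->
     restricts_to v [:: [:: a; c]; [:: b; d]] -> False).

Lemma disc_ncP (D : {set T}) g p : perm_on D g ->
  reflect (perm_on D p /\ noncrossing g p) (disc_nc D g p).
Proof.
move=> gD; apply: (iffP and3P) => -[pD].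
  move=> /forall_inP h1 /forall_inP h2; split=> //; split=> [a b c|a b c d] rg rp_;
    have sD := restricts_to_perm_on gD rg isT.
    have [aD bD cD] : [/\ a \in D, b \in D & c \in D] by split; apply: sD; rewrite !inE eqxx ?orbT.
    by have := forall_inP (forall_inP (h1 a aD) b bD) c cD; rewrite rg rp_.
  have [aD bD cD dD] : [/\ a \in D, b \in D, c \in D & d \in D].
    by split; apply: sD; rewrite !inE eqxx ?orbT.
  by have := forall_inP (forall_inP (forall_inP (h2 a aD) b bD) c cD) d dD; rewrite rg rp_.
move=> [h1 h2]; split=> //.
  apply/forall_inP => a _; apply/forall_inP => b _; apply/forall_inP => c _.
  by apply/negP => /andP[]; exact: h1.
apply/forall_inP => a _; apply/forall_inP => b _; apply/forall_inP => c _.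
by apply/forall_inP => d _; apply/negP => /andP[]; exact: h2.
Qed.

Lemma planar_noncrossing g p : planar g p -> noncrossing g p.
Proof.
by move=> pl; split=> *; [apply: planar_no_s1 pl _ _ | apply: planar_no_n1 pl _ _]; eassumption.
Qed.

Lemma noncrossing_rp A g p : noncrossing g p -> noncrossing (rp A g) (rp A p).
Proof.
move=> [h1 h2]; split=> [a b c|a b c d] rg rp_; [apply: (h1 a b c) | apply: (h2 a b c d)];
  exact: (restricts_to_of_rp (A := A)).
Qed.

Lemma last_in x (s : seq T) : s != [::] -> last x s \in s.
Proof. by case: s => // z s _ /=; apply: mem_last. Qed.

(** A nearest pair [p x], [x] along the cycle of [g] is adjacent: otherwise a
    point strictly between the two is sent by [p] out of the gap, which is a
    crossing, or the gap is invariant and contains a nearer pair. *)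
Lemma noncrossing_adjacent (s : seq T) p x0 : uniq s -> x0 \in s ->
  perm_on [set z in s] p -> noncrossing (cyc s) p ->
  exists2 x, x \in s & (p x == x) || (cyc s (p x) == x).
Proof.
move=> us x0s ps [h1 h2]; set g := cyc s in h1 h2 *.
have cg : fcycle g s by apply: cyc_fcycle.
have pin z : (p z \in s) = (z \in s) by have := perm_closed z ps; rewrite !inE.
(* The distance from [p x] to [x] along the cycle is the quantity to minimise. *)
case: (@arg_minnP _ x0 (mem s) (fun x => findex g (p x) x) x0s) => x /= xs min.
exists x => //; have pxs : p x \in s by rewrite pin.
have [t [[i ei] ut mt ct]] := fcycle_rot g us pxs.
rewrite cg in ct; have {}ct : fcycle g (p x :: t) by rewrite -ct.
have [//|npx] := eqVneq (p x) x.
have xt : x \in t by move: xs; rewrite mt inE eq_sym (negbTE npx).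
case/splitPr: xt ut mt ct {ei} => Z' W ut mt ct.
have [Z0|Zn] := eqVneq Z' [::]; first by move: ct; rewrite Z0 => /= /andP[].
have og z : z \in s -> fingraph.orbit g z = rot (index z (p x :: Z' ++ x :: W)) (p x :: Z' ++ x :: W).
  by move=> zs; apply: fingraph.orbitE => //; rewrite -mt.
have og0 : fingraph.orbit g (p x) = p x :: Z' ++ x :: W.
  by rewrite og //= eqxx rot0.
have xZ : x \notin Z'.
  by move: ut; rewrite cons_uniq cat_uniq => /andP[_ /and3P[_ /hasPn h _]]; rewrite h // mem_head.
have pxZ : p x \notin Z'.
  by move: ut; rewrite cons_uniq mem_cat negb_or => /andP[/andP[]].
have dx : findex g (p x) x = (size Z').+1.
  by rewrite /findex og0 /= (negbTE npx) index_cat (negbTE xZ) /= eqxx addn0.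
have Zs z : z \in Z' -> z \in s by move=> zZ; rewrite mt inE mem_cat zZ orbT.
(* [Z'] is the gap strictly between [p x] and [x]. *)
have [inv|] := boolP (all (fun z => p z \in Z') Z').
  have [z zl zZ] : exists2 z, z = last x Z' & z \in Z' by exists (last x Z'); rewrite ?last_in.
  have := allP inv z zZ => pzZ; have := min z (Zs z zZ); rewrite /= dx.
  suff : findex g (p z) z < (size Z').+1 by rewrite ltnNge => /negbTE ->.
  have [Z1 [Z2 EZ]] : exists Z1 Z2, Z' = Z1 ++ p z :: Z2 by case/splitPr: pzZ => Z1 Z2; exists Z1, Z2.
  have ez : z = last (p z) Z2 by rewrite {1}zl EZ last_cat.
  have pf : fpath g (p z) Z2.
    by move: ct; rewrite /= EZ -catA /= rcons_cat cat_path /= rcons_cat cat_path => /and4P[].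
  have [j ej] := fpathP pf.
  have zj : z = iter (size Z2) g (p z).
    by rewrite {1}ez; case/fpathP: pf => n ->; rewrite last_traject size_traject.
  have lt : size Z2 < size Z' by rewrite EZ size_cat /= leq_addl.
  rewrite {2}zj findex_iter; first by rewrite ltnS ltnW.
  by rewrite -size_orbit og ?Zs // size_rot /= size_cat ltnS (leq_trans (ltnW lt)) ?leq_addr.
move=> /allPn[z zZ npz].
have [Z1 [Z2 EZ]] : exists Z1 Z2, Z' = Z1 ++ z :: Z2 by case/splitPr: zZ => Z1 Z2; exists Z1, Z2.
have zs := Zs z zZ.
have zx : z != x by apply: contraNneq xZ => <-.
have zpx : z != p x by apply: contraNneq pxZ => <-.
have rg3 : restricts_to g [:: [:: p x; z; x]].
  apply: (@restricts_to1 _ (p x :: Z' ++ x :: W)) => //=.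
  rewrite eqxx EZ -catA; apply: (@cat_subseq _ [::] [:: z; x]); first exact: sub0seq.
  rewrite /= eqxx; apply: (@cat_subseq _ [::] [:: x]); first exact: sub0seq.
  by rewrite sub1seq mem_head.
have [Q [uQ cQ mQ]] := porbit_cycle2 npx.
have [zp|zp] := boolP (z \in porbit p x).
  have zQ : z \in Q by move: zp; rewrite mQ !inE (negbTE zx) (negbTE zpx).
  exfalso; apply: (h1 (p x) z x) => //.
  rewrite -[[:: p x; z; x]]/(rot 1 [:: x; p x; z]) restricts_to_rot.
  by apply: (restricts_to1 uQ cQ); rewrite /= !eqxx sub1seq.
have wW : p z \in W.
  have := pin z; rewrite zs !mt !inE !mem_cat inE (negbTE npz) (inj_eq (@perm_inj _ p)) (negbTE zx).
  by case/predU1P => // e; move: zp; rewrite porbit_sym -e mem_porbit1.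
have [W1 [W2 EW]] : exists W1 W2, W = W1 ++ p z :: W2 by case/splitPr: wW => W1 W2; exists W1, W2.
have rg4 : restricts_to g [:: [:: p x; z; x; p z]].
  apply: (@restricts_to1 _ (p x :: Z' ++ x :: W)) => //=.
  rewrite eqxx EZ -catA; apply: (@cat_subseq _ [::] [:: z; x; p z]); first exact: sub0seq.
  rewrite /= eqxx; apply: (@cat_subseq _ [::] [:: x; p z]); first exact: sub0seq.
  rewrite /= eqxx EW; apply: (@cat_subseq _ [::] [:: p z]); first exact: sub0seq.
  by rewrite sub1seq mem_head.
exfalso; apply: (h2 (p x) z x (p z)) => //; apply: restricts_to22 => //.
- by apply: contraNneq npz => <-.
- by rewrite porbit_sym mem_porbit1.
- exact: mem_porbit1.
by rewrite porbit_step.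
Qed.

Lemma perm_on_small (D : {set T}) f : #|D| <= 1 -> perm_on D f -> f = 1%g.
Proof.
move=> D1 fD; apply/permP => x; rewrite perm1; have [xD|/(out_perm fD)//] := boolP (x \in D).
have /card_le1_eqP := D1; apply=> //; by rewrite perm_closed.
Qed.

Lemma rpC1 f x : rp (predC1 x) f = f ∘ tperm x (f^-1%g x).
Proof.
rewrite -{2 3}(rpT f) -rp_rem; exact: eq_rp.
Qed.

(** Induction on the length of the cycle, removing the point [x] given by
    [noncrossing_adjacent].  If [x] is fixed by [p], removing it from the cycle
    removes it from the product; if the cycle sends [p x] to [x], removing [x] from
    both permutations leaves the product unchanged.  Either way both sides
    grow by one. *)
Lemma noncrossing_count (s : seq T) p : uniq s -> perm_on [set z in s] p ->
  noncrossing (cyc s) p -> ncyc p + ncyc (cyc s ∘ p) = #|T| + ncyc (cyc s).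
Proof.
have [n] := ubnP (size s); elim: n s p => // n IH s p sn us ps nc.
have gs : perm_on [set z in s] (cyc s).
  apply/fintype.subsetP => z; rewrite !inE; apply: contraNT => zs.
  by rewrite cyc_out.
have [s1|s2] := leqP (size s) 1.
  have c1 : #|[set z in s]| <= 1 by rewrite cardsE (card_uniqP us).
  rewrite (perm_on_small c1 ps) (perm_on_small c1 gs) ncyc1; congr (_ + _).
  by rewrite -ncyc1; congr ncyc; apply/permP => z; rewrite pcompE !perm1.
have [x0 x0s] : exists x0, x0 \in s by case: (s) s2 => // x0 ?; exists x0; rewrite mem_head.
have [x xs adj] := noncrossing_adjacent us x0s ps nc.
set s' := seq.filter (predC1 x) s.
have us' : uniq s' by rewrite filter_uniq.
have gx : cyc s x != x.
  have [t [[i ei] ut mt _]] := fcycle_rot (cyc s) us xs.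
  rewrite -(cyc_rot i us) ei cycE // next_head.
  case: t ut {mt} ei => [|w t] ut ei /=; first by move: s2; rewrite -(size_rot i) ei.
  by move: ut => /andP[]; rewrite inE negb_or eq_sym => /andP[].
have ps' : perm_on [set z in s'] (rp (predC1 x) p).
  apply/fintype.subsetP => z; rewrite !inE mem_filter; apply: contraR.
  rewrite negb_and negbK => /orP[/eqP ->|zs]; first by rewrite rpE /= eqxx.
  by rewrite rp_out // (out_perm ps) // inE.
have sz' : size s' < n.
  apply: (@leq_trans (size s)) => //; rewrite size_filter -(count_predC (predC1 x) s).
  by rewrite -[X in X < _]addn0 ltn_add2l -has_count; apply/hasP; exists x => //=; rewrite eqxx.
have := IH s' (rp (predC1 x) p) sz' us' ps'; rewrite -rp_cyc // => /(_ (noncrossing_rp _ nc)).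
have e1 : ncyc (rp (predC1 x) (cyc s)) = (ncyc (cyc s)).+1.
  rewrite rpC1 ncyc_split //; last by rewrite porbit_sym -{1}(permKV (cyc s) x) mem_porbit1.
  by apply: contraNneq gx => e; rewrite {1}e permKV.
have [px|npx] := eqVneq (p x) x.
  have -> : rp (predC1 x) p = p.
    by rewrite rpC1 -{2}px permK tperm1; apply/permP => z; rewrite pcompE perm1.
  have -> : rp (predC1 x) (cyc s) ∘ p = rp (predC1 x) (cyc s ∘ p).
    apply/permP => z; rewrite pcompE !rpC1 !pcompE; congr (cyc s _).
    have e : ((cyc s ∘ p)^-1)%g x = (p^-1)%g ((cyc s)^-1%g x).
      by apply: (@perm_inj _ (cyc s ∘ p)); rewrite permKV pcompE !permKV.
    by rewrite e inj_tperm ?permKV ?px //; exact: perm_inj.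
  have e2 : ncyc (rp (predC1 x) (cyc s ∘ p)) = (ncyc (cyc s ∘ p)).+1.
    rewrite rpC1 ncyc_split //; last by rewrite porbit_sym -{1}(permKV (cyc s ∘ p) x) mem_porbit1.
    by apply: contraNneq gx => e; rewrite -{1}px -pcompE {1}e permKV.
  by rewrite e1 e2 !addnS => -[].
move: adj; rewrite (negbTE npx) => /= /eqP gpx.
have e2 : ncyc (rp (predC1 x) p) = (ncyc p).+1.
  rewrite rpC1 ncyc_split //; last by rewrite porbit_sym -{1}(permKV p x) mem_porbit1.
  by apply: contraNneq npx => e; rewrite {1}e permKV.
have -> : rp (predC1 x) (cyc s) ∘ rp (predC1 x) p = cyc s ∘ p.
  apply/permP => z; rewrite !rpC1 !pcompE.
  have gx' : (cyc s)^-1%g x = p x by rewrite -{1}gpx permK.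
  rewrite gx'; case: (tpermP x (p^-1%g x) z) => [->|->|/eqP zx /eqP zp].
  - by rewrite permKV tpermL.
  - by rewrite tpermR permKV.
  have pzx : p z != x by apply: contraNneq zp => <-; rewrite permK.
  rewrite tpermD // 1?eq_sym //; by apply: contraNneq zx => /perm_inj ->.
by rewrite e1 e2 addSn addnS => -[].
Qed.

(** Planar pairs contain no crossing pattern, and noncrossing permutations have
    the number of cycles that genus 0 requires ([noncrossing_count]). *)
Lemma disc_nc_planar (s : seq T) p : uniq s ->
  disc_nc [set z in s] (cyc s) p = perm_on [set z in s] p && planar (cyc s) p.
Proof.
move=> us; have gs : perm_on [set z in s] (cyc s).
  apply/fintype.subsetP => z; rewrite !inE; apply: contraNT => zs.
  by rewrite cyc_out.
apply/(disc_ncP _ gs)/andP => -[ps h]; split=> //; last exact: planar_noncrossing.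
by rewrite planar_cyc //; apply/eqP; apply: noncrossing_count.
Qed.

End Restriction.

(** * Annular-noncrossing permutations *)

Section Annular.
Variable T : finType.
Implicit Types (g p f h : {perm T}) (x y z k : T) (A B : pred T).

(** ** Permutations with two cycles *)

Lemma orbit_cut f x s1 b s2 : uniq (x :: s1 ++ b :: s2) -> fcycle f (x :: s1 ++ b :: s2) ->
  fingraph.orbit f b = b :: s2 ++ x :: s1.
Proof.
have e : rot (size (x :: s1)) (x :: s1 ++ b :: s2) = b :: s2 ++ x :: s1 by rewrite -cat_cons rot_size_cat.
rewrite -(rot_uniq (size (x :: s1))) -(rot_cycle (size (x :: s1))) e => u c.
by rewrite (fingraph.orbitE c u) ?mem_head //= eqxx rot0.
Qed.

Section TwoCycles.
Variables (x y : T) (E F : seq T).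
Hypothesis uxy : uniq ((x :: E) ++ (y :: F)).
Let g := cyc (x :: E) ∘ cyc (y :: F).
Let D : {set T} := [set z in (x :: E) ++ (y :: F)].

Lemma two_uniq1 : uniq (x :: E). Proof. by move: uxy; rewrite cat_uniq => /and3P[]. Qed.
Lemma two_uniq2 : uniq (y :: F). Proof. by move: uxy; rewrite cat_uniq => /and3P[]. Qed.
Lemma two_disj z : z \in x :: E -> z \notin y :: F.
Proof.
move: uxy; rewrite cat_uniq => /and3P[_ /hasPn h _] zE; apply/negP => /h; by rewrite zE.
Qed.

Lemma two_in2 z : z \in y :: F -> g z = next (y :: F) z.
Proof.
move=> zF; rewrite pcompE (cycE _ two_uniq2) cyc_out ?two_uniq1 //.
by apply/negP => /two_disj; rewrite mem_next zF.
Qed.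

Lemma two_in1 z : z \in x :: E -> g z = next (x :: E) z.
Proof. by move=> zE; rewrite pcompE (cyc_out two_uniq2) ?two_disj // cycE ?two_uniq1. Qed.

Lemma two_out z : z \notin (x :: E) ++ (y :: F) -> g z = z.
Proof.
by rewrite mem_cat negb_or => /andP[zE zF]; rewrite pcompE !cyc_out // ?two_uniq1 ?two_uniq2.
Qed.

Lemma two_fcycle1 : fcycle g (x :: E).
Proof. by apply: fcycle_next; [exact: two_uniq1 | exact: two_in1]. Qed.
Lemma two_fcycle2 : fcycle g (y :: F).
Proof. by apply: fcycle_next; [exact: two_uniq2 | exact: two_in2]. Qed.

Lemma two_perm_on : perm_on D g.
Proof. by apply/fintype.subsetP => z; rewrite !inE; apply: contraR => /two_out ->. Qed.

Lemma two_porbit_ne z w : z \in x :: E -> w \in y :: F -> w \notin porbit g z.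
Proof.
by move=> zE wF; rewrite (porbit_fcycle _ two_fcycle1 zE); apply/negP => /two_disj; rewrite wF.
Qed.

Lemma merge_mem z : (z \in y :: E ++ x :: F) = (z \in (x :: E) ++ (y :: F)).
Proof. by rewrite !inE !mem_cat !inE; do !case: (_ == _); rewrite ?orbT //= ?orbT. Qed.

Lemma merge_uniq : uniq (y :: E ++ x :: F).
Proof.
rewrite -(@eq_uniq _ ((x :: E) ++ y :: F)) //.
  by rewrite /= !size_cat /= !addnS.
by move=> z; rewrite merge_mem.
Qed.

(** This is the boundary of the annulus cut open along an arc from [x] to [y]. *)
Lemma merge_cycle : g ∘ tperm x y = cyc (y :: E ++ x :: F).
Proof.
have u := merge_uniq.
have xF : x \notin y :: F by rewrite two_disj ?mem_head.
have xE : x \notin E by case/andP: two_uniq1.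
have yF : y \notin F by case/andP: two_uniq2.
have yE : y \notin E.
  by apply/negP => yE; have := @two_disj y; rewrite mem_head inE yE orbT => /(_ isT).
have notin z : z \in E ++ F -> x != z /\ y != z.
  move=> zEF; split; apply: contraTneq zEF => <-; rewrite mem_cat negb_or ?xE ?yE //.
  by move: xF; rewrite inE negb_or => /andP[].
have walk a b c G : {subset G <= E ++ F} -> (g ∘ tperm x y) a = g b -> fpath g b (rcons G c) ->
    fpath (g ∘ tperm x y) a (rcons G c).
  move=> GEF ab; case: G GEF => [|w G] GEF /=; rewrite ab => /andP[-> pw] //=.
  elim: G w GEF pw => [|v G IH] w GEF /=; rewrite pcompE tpermD;
    try (by case: (notin w); rewrite ?GEF ?mem_head).
  by case/andP=> -> /IH -> // z zG; apply: GEF; rewrite inE zG orbT.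
apply: cyc_eq => //.
  have c1 : fpath g x (rcons E x) := two_fcycle1.
  have c2 : fpath g y (rcons F y) := two_fcycle2.
  rewrite /= rcons_cat cat_path [path _ _ (rcons _ _)]/= andbA -rcons_path.
  rewrite (walk y x x E) ?(walk x y y F) // ?pcompE ?tpermL ?tpermR // => z zG.
    by rewrite mem_cat zG orbT.
  by rewrite mem_cat zG.
move=> z; rewrite merge_mem => zn; rewrite pcompE tpermD ?two_out //.
  by apply: contraNneq zn => <-; rewrite mem_cat mem_head.
by apply: contraNneq zn => <-; rewrite mem_cat mem_head orbT.
Qed.

Lemma merge_perm_on : perm_on D (g ∘ tperm x y).
Proof.
rewrite merge_cycle; apply/fintype.subsetP => z; rewrite !inE -/(cat _ _) -[_ || _]/(z \in (x :: E) ++ (y :: F)).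
by rewrite -merge_mem; apply: contraR => /(cyc_out merge_uniq) ->.
Qed.

(** Both pairs have [S] as one orbit and fixed points elsewhere. *)
Lemma norb_full g1 p1 g2 p2 (S : {set T}) : perm_on S g1 -> perm_on S p1 ->
  perm_on S g2 -> perm_on S p2 ->
  {in S &, forall a b, connect (step g1 p1) a b} ->
  {in S &, forall a b, connect (step g2 p2) a b} -> norb g1 p1 = norb g2 p2.
Proof.
move=> h1 k1 h2 k2 c1 c2; apply: eq_n_comp => a b.
have out u v : perm_on S u -> perm_on S v -> a \notin S -> connect (step u v) a b = (a == b).
  move=> uS vS aS; apply/idP/eqP => [c|->]; last exact: connect0.
  by apply/eqP; apply: (connect_closed_step (A := fun z => a == z) _ _ c) => //= z /eqP <-; rewrite (out_perm _ aS).
have inn u v : perm_on S u -> perm_on S v -> {in S &, forall a b, connect (step u v) a b} ->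
    a \in S -> connect (step u v) a b = (b \in S).
  move=> uS vS cc aS; apply/idP/idP => [c|bS]; last exact: cc.
  by apply: (connect_closed_step (A := mem S) _ _ c) => // z /= zS; rewrite perm_closed.
by have [aS|aS] := boolP (a \in S); [rewrite (inn g1 p1) ?(inn g2 p2) | rewrite (out g1 p1) ?(out g2 p2)].
Qed.

Lemma two_connect p : y \in porbit p x -> {in D &, forall a b, connect (step g p) a b}.
Proof.
move=> yx; have toy a : a \in D -> connect (step g p) y a.
  rewrite inE mem_cat => /orP[aE|aF].
    apply: (@connect_trans _ _ x).
      by apply: connect_porbit_r; rewrite porbit_sym.
    by apply: connect_porbit_l; rewrite (porbit_fcycle _ two_fcycle1) ?mem_head.
  by apply: connect_porbit_l; rewrite (porbit_fcycle _ two_fcycle2) ?mem_head.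
move=> a b aD bD; apply: connect_trans (toy _ bD); rewrite step_sym; exact: toy.
Qed.

(** Gluing two cycles of [g] and splitting the cycle of [p] through [x] and [y]
    by the same transposition leaves the product and the orbits unchanged, and
    shifts one cycle from [g] to [p]. *)
Lemma planar_merge p : perm_on D p -> y \in porbit p x ->
  planar g p = planar (g ∘ tperm x y) (tperm x y ∘ p).
Proof.
move=> pD yx; have xD : x \in D by rewrite inE mem_cat mem_head.
have yD : y \in D by rewrite inE mem_cat mem_head orbT.
have xy : x != y.
  by apply/eqP => xy; have := two_disj (mem_head x E); rewrite xy mem_head.
have tD : perm_on D (tperm x y).
  apply/fintype.subsetP => z; rewrite -topredE /=; case: tpermP => [->|->|_ _] //; by rewrite eqxx.
have tpD : perm_on D (tperm x y ∘ p) by exact: perm_onM.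
have e : (g ∘ tperm x y) ∘ (tperm x y ∘ p) = g ∘ p.
  by apply/permP => z; rewrite !pcompE tpermK.
have c1 : (ncyc (g ∘ tperm x y)).+1 = ncyc g.
  by apply: ncyc_merge; apply: two_porbit_ne; rewrite mem_head.
have c2 : ncyc (tperm x y ∘ p) = (ncyc p).+1 by rewrite ncycC ncyc_split.
rewrite /planar e c2 -c1 -(@norb_full g p (g ∘ tperm x y) (tperm x y ∘ p) D) ?two_perm_on ?merge_perm_on //.
- by rewrite addSnnS.
- exact: two_connect.
move=> a b aD bD; apply: connect_porbit_l; rewrite merge_cycle.
move: aD bD; rewrite !finset.in_set -!merge_mem => aD bD.
by rewrite (porbit_fcycle _ (cyc_fcycle merge_uniq)).
Qed.

Lemma two_orbit_cut b E1 E2 : E = E1 ++ b :: E2 -> fingraph.orbit g b = b :: E2 ++ x :: E1.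
Proof.
by move=> eE; apply: orbit_cut; rewrite -eE; [exact: two_uniq1|exact: two_fcycle1].
Qed.

Lemma two_orbit_cut2 b F1 F2 : F = F1 ++ b :: F2 -> fingraph.orbit g b = b :: F2 ++ y :: F1.
Proof.
by move=> eF; apply: orbit_cut; rewrite -eF; [exact: two_uniq2|exact: two_fcycle2].
Qed.

Lemma two_orbit1 : fingraph.orbit g x = x :: E.
Proof. by rewrite (fingraph.orbitE two_fcycle1 two_uniq1) ?mem_head //= eqxx rot0. Qed.

Lemma two_orbit2 : fingraph.orbit g y = y :: F.
Proof. by rewrite (fingraph.orbitE two_fcycle2 two_uniq2) ?mem_head //= eqxx rot0. Qed.

(** Deleting [x] and [y] from the glued cycle gives the cycle [lambda]. *)
Lemma lambdaE : lambda g x y =1 cyc (E ++ F).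
Proof.
move=> z; rewrite /lambda two_orbit1 two_orbit2 cycE //.
by move: merge_uniq; rewrite cons_uniq !cat_uniq cons_uniq => /andP[_ /and3P[-> /= ]]; rewrite negb_or => /andP[_ ->] /andP[_ ->].
Qed.

Lemma lambda_merge ss : all (fun c => 1 < size c) ss ->
  restricts_to (lambda g x y) ss -> restricts_to (g ∘ tperm x y) ss.
Proof.
move=> sz; rewrite (eq_restricts_to _ lambdaE) merge_cycle => h.
apply: (@restricts_to_of_rp _ [pred z | (z != x) && (z != y)]) => //.
rewrite rp_cyc ?merge_uniq // (_ : seq.filter _ _ = E ++ F) //.
have u := merge_uniq.
rewrite /= eqxx andbF filter_cat /= eqxx /=; congr cat; apply/all_filterP/allP => z zE /=.
  move: u; rewrite cons_uniq mem_cat negb_or => /andP[/andP[yE _]]; rewrite cat_uniq => /and3P[_ /hasPn h' _].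
  have xE := h' x (mem_head _ _).
  by apply/andP; split; [apply: contraNneq xE => <-|apply: contraNneq yE => <-].
move: u; rewrite cons_uniq mem_cat negb_or inE negb_or => /andP[/and3P[_ _ yF]]; rewrite cat_uniq => /and3P[_ _ /= /andP[xF _]].
by apply/andP; split; [apply: contraNneq xF => <-|apply: contraNneq yF => <-].
Qed.

(** A pattern cut at [x], [y] becomes a disc pattern of the glued cycle, and
    gluing preserves genus 0. *)
Lemma planar_cut_noncrossing p : perm_on D p -> planar g p ->
  (forall a b c, restricts_to (lambda g x y) [:: [:: a; b; c]] ->
     restricts_to p [:: [:: a; b; c]; [:: x; y]] -> False) /\
  (forall a b c d, restricts_to (lambda g x y) [:: [:: a; b; c; d]] ->
     restricts_to p [:: [:: a; c]; [:: b; d]; [:: x; y]] -> False).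
Proof.
move=> pD pl.
have key (ss : seq (seq T)) : restricts_to p (rcons ss [:: x; y]) ->
  exists q, [/\ planar (g ∘ tperm x y) q & restricts_to q ss].
  move=> /restricts_toP[u h]; set A : pred T := mem _ in h.
  have fl : flatten (rcons ss [:: x; y]) = flatten ss ++ [:: x; y].
    by rewrite -cats1 flatten_cat /= .
  have qx : rp A p x = y by rewrite (h [:: x; y]) ?mem_rcons ?mem_head //= eqxx.
  exists (tperm x y ∘ rp A p); split.
    rewrite -planar_merge ?planar_rp_r // -?qx ?mem_porbit1 //.
    apply/fintype.subsetP => z; rewrite -topredE /= rpE; case: ifP => Az; last by rewrite eqxx.
    apply: contraR => zD; rewrite first_return1 ?(out_perm pD) //.
  move: u; rewrite fl cat_uniq => /and3P[u1 /hasPn dis _].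
  have xn : x \notin flatten ss by apply: dis; rewrite mem_head.
  have yn : y \notin flatten ss by apply: dis; rewrite !inE eqxx orbT.
  apply/restricts_toP; split=> // c cs k kc.
  have kn : next c k \in flatten ss by apply/flattenP; exists c; rewrite ?mem_next.
  have qk : (tperm x y ∘ rp A p) k = next c k.
    rewrite pcompE (h c) ?mem_rcons ?inE ?cs ?orbT // tpermD //.
      by apply: contraNneq xn => ->.
    by apply: contraNneq yn => ->.
  by rewrite rp1 ?qk //; apply/flattenP; exists c.
split=> [a b c hl hp|a b c d hl hp].
  have [q [plq hq]] := key [:: [:: a; b; c]] hp.
  exact: planar_no_s1 plq (lambda_merge (ss := [:: [:: a; b; c]]) isT hl) hq.
have [q [plq hq]] := key [:: [:: a; c]; [:: b; d]] hp.
exact: planar_no_n1 plq (lambda_merge (ss := [:: [:: a; b; c; d]]) isT hl) hq.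
Qed.

End TwoCycles.

Lemma cyc_disjC (c1 c2 : seq T) : uniq (c1 ++ c2) -> cyc c1 ∘ cyc c2 = cyc c2 ∘ cyc c1.
Proof.
rewrite cat_uniq => /and3P[u1 /hasPn dis u2]; apply/permP => z; rewrite !pcompE.
have in2 w : w \in c2 -> cyc c2 w \in c2 by move=> wc; rewrite cycE // mem_next.
have in1 w : w \in c1 -> cyc c1 w \in c1 by move=> wc; rewrite cycE // mem_next.
have [z2|z2] := boolP (z \in c2).
  by rewrite (cyc_out u1 (dis _ z2)) cyc_out ?dis ?in2.
rewrite (cyc_out u2 z2); have [z1|z1] := boolP (z \in c1); last by rewrite cyc_out ?(cyc_out u2).
by rewrite (cyc_out u2) //; apply/negP => /dis; rewrite in1.
Qed.

(** ** The annular conditions and the genus *)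

(** The conditions on the annulus cut at [x] and [y] are kept together because
    they are used for one choice of the cut at a time. *)
Definition ann_noncrossing (D : {set T}) g p :=
  [/\ noncrossing g p,
     forall a b c d, restricts_to g [:: [:: a; b]; [:: c; d]] ->
       restricts_to p [:: [:: a; c; b; d]] -> False &
     forall x y, x \in D -> y \in D -> y \notin porbit g x ->
      (forall a b c, restricts_to (lambda g x y) [:: [:: a; b; c]] ->
        restricts_to p [:: [:: a; b; c]; [:: x; y]] -> False) /\
      (forall a b c d, restricts_to (lambda g x y) [:: [:: a; b; c; d]] ->
        restricts_to p [:: [:: a; c]; [:: b; d]; [:: x; y]] -> False)].

Local Ltac in_pattern sD z :=
  apply/exists_inP; exists z; first by apply: sD; rewrite !inE eqxx ?orbT.

Lemma ann_ncP (D : {set T}) g p : perm_on D g ->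
  reflect [/\ perm_on D p, [transitive <<[set g; p]>>%g, on D | 'P] & ann_noncrossing D g p]
    (ann_nc D g p).
Proof.
move=> gD; apply: (iffP idP) => [|[pD tr [[h1 h2] h3 h4]]].
  case/and5P=> pD tr s1 s2 /and3P[n1 n2 n3]; split=> //.
  have pin ss : restricts_to p ss -> all (fun c => 1 < size c) ss -> {subset flatten ss <= D}.
    exact: restricts_to_perm_on.
  split; first split.
  - move=> a b c rg rp_; have sD := pin _ rp_ isT; case/negP: s1.
    by in_pattern sD a; in_pattern sD b; in_pattern sD c; rewrite rg rp_.
  - move=> a b c d rg rp_; have sD := pin _ rp_ isT; case/negP: n1.
    by in_pattern sD a; in_pattern sD b; in_pattern sD c; in_pattern sD d; rewrite rg rp_.
  - move=> a b c d rg rp_; have sD := pin _ rp_ isT; case/negP: s2.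
    by in_pattern sD a; in_pattern sD b; in_pattern sD c; in_pattern sD d; rewrite rg rp_.
  move=> x y xD yD xy; split=> [a b c rg rp_|a b c d rg rp_]; have sD := pin _ rp_ isT.
    case/negP: n2; in_pattern sD x; in_pattern sD y; rewrite xy /=.
    by in_pattern sD a; in_pattern sD b; in_pattern sD c; rewrite rg rp_.
  case/negP: n3; in_pattern sD x; in_pattern sD y; rewrite xy /=.
  by in_pattern sD a; in_pattern sD b; in_pattern sD c; in_pattern sD d; rewrite rg rp_.
rewrite /ann_nc pD tr /=; apply/and5P; split; apply/negP.
- by move=> /exists_inP[a _ /exists_inP[b _ /exists_inP[c _ /andP[]]]]; exact: h1.
- by move=> /exists_inP[a _ /exists_inP[b _ /exists_inP[c _ /exists_inP[e _ /andP[]]]]]; exact: h3.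
- by move=> /exists_inP[a _ /exists_inP[b _ /exists_inP[c _ /exists_inP[e _ /andP[]]]]]; exact: h2.
- move=> /exists_inP[x xD /exists_inP[y yD /andP[xy]]].
  by move=> /exists_inP[a _ /exists_inP[b _ /exists_inP[c _ /andP[]]]]; case: (h4 x y xD yD xy) => h _; exact: h.
move=> /exists_inP[x xD /exists_inP[y yD /andP[xy]]].
move=> /exists_inP[a _ /exists_inP[b _ /exists_inP[c _ /exists_inP[e _ /andP[]]]]].
by case: (h4 x y xD yD xy) => _ h; exact: h.
Qed.

Lemma planar_ann_noncrossing (c1 c2 : seq T) p : uniq (c1 ++ c2) ->
  perm_on [set z in c1 ++ c2] p -> planar (cyc c1 ∘ cyc c2) p ->
  ann_noncrossing [set z in c1 ++ c2] (cyc c1 ∘ cyc c2) p.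
Proof.
move=> u pD pl; split; first exact: planar_noncrossing.
  by move=> a b c d; exact: planar_no_s2.
have main (d1 d2 : seq T) x y : uniq (d1 ++ d2) -> perm_on [set z in d1 ++ d2] p ->
    planar (cyc d1 ∘ cyc d2) p -> x \in d1 -> y \in d2 ->
      (forall a b c, restricts_to (lambda (cyc d1 ∘ cyc d2) x y) [:: [:: a; b; c]] ->
        restricts_to p [:: [:: a; b; c]; [:: x; y]] -> False) /\
      (forall a b c d, restricts_to (lambda (cyc d1 ∘ cyc d2) x y) [:: [:: a; b; c; d]] ->
        restricts_to p [:: [:: a; c]; [:: b; d]; [:: x; y]] -> False).
  move=> ud pd pld xd yd; move: (ud); rewrite cat_uniq => /and3P[u1 /hasPn dis u2].
  have [i1 E e1] := rot_to xd; have [i2 F e2] := rot_to yd.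
  rewrite -(cyc_rot i1 u1) -(cyc_rot i2 u2) e1 e2 in pld *.
  apply: planar_cut_noncrossing => //.
    rewrite -e1 -e2 cat_uniq !rot_uniq u1 u2 andbT; apply/hasPn => z.
    by rewrite mem_rot => /dis; rewrite /= mem_rot.
  by rewrite (_ : [set z in _] = [set z in d1 ++ d2]) //; apply/setP => z; rewrite !finset.in_set !mem_cat -e1 -e2 !mem_rot.
move=> x y; rewrite !inE !mem_cat => xD yD xy.
move: (u); rewrite cat_uniq => /and3P[u1 /hasPn dis u2].
have in1 z w : z \in c1 -> w \in c1 -> w \in porbit (cyc c1 ∘ cyc c2) z.
  move=> zc wc; have c1c : fcycle (cyc c1 ∘ cyc c2) c1.
    apply: fcycle_next => // v vc; rewrite pcompE (cyc_out u2) ?cycE //.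
    by apply/negP => /dis; rewrite vc.
  by rewrite (porbit_fcycle _ c1c).
have in2 z w : z \in c2 -> w \in c2 -> w \in porbit (cyc c1 ∘ cyc c2) z.
  move=> zc wc; have c2c : fcycle (cyc c1 ∘ cyc c2) c2.
    by apply: fcycle_next => // v vc; rewrite pcompE cyc_out ?cycE // dis // mem_next.
  by rewrite (porbit_fcycle _ c2c).
case/orP: xD => xc; case/orP: yD => yc; first by rewrite in1 in xy.
- exact: main.
- have uc : uniq (c2 ++ c1) by rewrite uniq_catC.
  rewrite cyc_disjC //; apply: main => //.
    by rewrite (_ : [set z in _] = [set z in c1 ++ c2]) //; apply/setP => z; rewrite !inE !mem_cat orbC.
  by rewrite -cyc_disjC.
by rewrite in2 in xy.
Qed.

Lemma rotS3 (a b c : T) s i : rot i s = [:: a; b; c] ->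
  [\/ s = [:: a; b; c], s = [:: b; c; a] | s = [:: c; a; b]].
Proof.
move=> e; have sz : size s = 3 by rewrite -(size_rot i) e.
have [i3|i3] := ltnP i 3; last first.
  by move: e; rewrite rot_oversize ?sz // => ->; constructor 1.
case: s sz e => [|u [|v [|w [|? ?]]]] // _.
by case: i i3 => [|[|[|i]]] // _; rewrite /rot /= => -[-> -> ->]; [constructor 1|constructor 3|constructor 2].
Qed.

Lemma rotS4 (a b c d : T) s i : rot i s = [:: a; b; c; d] ->
  [\/ s = [:: a; b; c; d], s = [:: b; c; d; a], s = [:: c; d; a; b] | s = [:: d; a; b; c]].
Proof.
move=> e; have sz : size s = 4 by rewrite -(size_rot i) e.
have [i3|i3] := ltnP i 4; last first.
  by move: e; rewrite rot_oversize ?sz // => ->; constructor 1.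
case: s sz e => [|u [|v [|w [|t [|? ?]]]]] // _.
by case: i i3 => [|[|[|[|i]]]] // _; rewrite /rot /= => -[-> -> -> ->];
  [constructor 1|constructor 4|constructor 3|constructor 2].
Qed.

Lemma subseq_split (b : T) s1 : b \in s1 -> exists E1 E2, s1 = E1 ++ b :: E2.
Proof. by case/splitPr => E1 E2; exists E1, E2. Qed.

Section Reduction.
Variables (x y : T) (E F : seq T) (p : {perm T}).
Hypothesis uxy : uniq ((x :: E) ++ (y :: F)).
Let g := cyc (x :: E) ∘ cyc (y :: F).
Let D : {set T} := [set z in (x :: E) ++ y :: F].
Hypothesis pD : perm_on D p.
Hypothesis pxy : p x = y.
Hypothesis nc : ann_noncrossing D g p.
Let gh := g ∘ tperm x y.
Let sh := y :: E ++ x :: F.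

Let ush : uniq sh. Proof. exact: merge_uniq. Qed.
Let csh : fcycle gh sh. Proof. by rewrite /gh merge_cycle //; apply: cyc_fcycle. Qed.
Let xy : x != y.
Proof. by apply/eqP => xy; have := two_disj uxy (mem_head x E); rewrite xy mem_head. Qed.

Let pcyc : exists Q, [/\ uniq (x :: y :: Q), fcycle p (x :: y :: Q) &
  forall z, (z \in porbit p x) = (z \in x :: y :: Q)].
Proof. by have := @porbit_cycle2 T p x; rewrite pxy eq_sym xy; apply. Qed.

Let cut_x_y : (forall a b c, restricts_to (lambda g x y) [:: [:: a; b; c]] ->
     restricts_to p [:: [:: a; b; c]; [:: x; y]] -> False) /\
  (forall a b c d, restricts_to (lambda g x y) [:: [:: a; b; c; d]] ->
     restricts_to p [:: [:: a; c]; [:: b; d]; [:: x; y]] -> False).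
Proof.
case: nc => _ _; apply; try by rewrite finset.in_set mem_cat mem_head ?orbT.
by apply: (two_porbit_ne uxy); rewrite mem_head.
Qed.

(** Patterns of the glued cycle that avoid [x] and [y] are patterns of the
    annulus cut at these points. *)
Lemma lambda_of_merge c a : a \in sh -> x \notin a :: c -> y \notin a :: c ->
  restricts_to gh [:: a :: c] -> restricts_to (lambda g x y) [:: a :: c].
Proof.
move=> ash xc yc h; have := restricts_to1_rot ush csh ash h.
rewrite (eq_restricts_to _ (lambdaE uxy)).
have -> : [seq z <- sh | z \in a :: c] = [seq z <- E ++ F | z \in a :: c].
  by rewrite /sh [LHS]/= (negbTE yc) !filter_cat [in LHS]/= (negbTE xc).
apply: restricts_to1_of_rot.
  move: ush; rewrite cons_uniq !cat_uniq cons_uniq => /andP[_ /and3P[-> /= ]].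
  by rewrite negb_or => /andP[_ ->] /andP[_ ->].
apply: cyc_fcycle.
move: ush; rewrite cons_uniq !cat_uniq cons_uniq => /andP[_ /and3P[-> /= ]].
by rewrite negb_or => /andP[_ ->] /andP[_ ->].
Qed.

(** According to how many of [b], [c] lie on each cycle, these two points form
    with [x], with [y] or with both one of the first two forbidden patterns of
    the annulus; [x] is at hand because it precedes [y] on the cycle of [p]. *)
Lemma no_s1_through b c : subseq [:: b; c] (E ++ x :: F) -> b != x -> c != x ->
  restricts_to p [:: [:: y; b; c]] -> False.
Proof.
move=> sub bx cx rp_; have [Q [uQ cQ mQ]] := pcyc.
have ybc : x \notin [:: y; b; c] by rewrite !inE !negb_or xy eq_sym bx eq_sym cx.
have subQ : subseq [:: b; c] Q.
  have := restricts_to1_rot uQ cQ (a := y) _ rp_; rewrite !inE eqxx orbT => /(_ isT).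
  have -> : [seq z <- x :: y :: Q | z \in [:: y; b; c]] = y :: [seq z <- Q | z \in [:: y; b; c]].
    by rewrite /= (negbTE ybc) mem_head.
  by rewrite [index _ _]/= eqxx rot0 => -[<-]; exact: filter_subseq.
have [[s1 _] s2 _] := nc.
have pxybc : restricts_to p [:: [:: x; y; b; c]].
  by apply: (restricts_to1 uQ cQ); rewrite /= !eqxx.
have [t1 [t2 [e sub1 sub2]]] := subseq_catP sub.
case: t1 t2 e sub1 sub2 => [|b' [|c' [|? ?]]] [|u [|v [|? ?]]] //= [] eb ec sub1 sub2; subst b c.
- have {}sub2 : subseq [:: u; v] F by move: sub2; rewrite (negbTE bx).
  apply: (s1 y u v) => //.
  by apply: (restricts_to1 (two_uniq2 uxy) (two_fcycle2 uxy)); rewrite /= eqxx.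
- have {}sub2 : u \in F by move: sub2; rewrite (negbTE cx) sub1seq.
  apply: (s2 x b' y u) => //.
  apply: (restricts_to2 uxy (two_fcycle1 uxy) (two_fcycle2 uxy)); rewrite /= eqxx //.
  by rewrite sub1seq.
apply: (s1 x b' c').
  by apply: (restricts_to1 (two_uniq1 uxy) (two_fcycle1 uxy)); rewrite /= eqxx.
by apply: (restricts_to1 uQ cQ); rewrite /= eqxx; apply: subseq_trans subQ (subseq_cons _ _).
Qed.

(** A crossing in the glued cycle of two chords, one of which starts at [y].
    If [b], [c], [d] lie on one cycle, it is a crossing there with [x] or [y];
    otherwise [b] and [d] lie on different cycles, and the annulus cut at [b]
    and [d] contains the three-point pattern [x], [y], [c]. *)
Lemma no_n1_through b c d : subseq [:: b; c; d] (E ++ x :: F) ->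
  x \notin [:: b; c; d] -> c \in porbit p x -> d \in porbit p b ->
  b \notin porbit p x -> False.
Proof.
move=> sub; rewrite !inE !negb_or => /and3P[xb xc xd] cx db bx.
have [Q [uQ cQ mQ]] := pcyc; have [[_ n1] _ n23] := nc.
have ubcd : uniq [:: b; c; d].
  apply: (subseq_uniq sub); by move: ush => /andP[].
move: (ubcd); rewrite /= !inE !negb_or andbT => /andP[/andP[bc bd] cd].
have yx : y \in porbit p x by rewrite -pxy mem_porbit1.
have yc : y != c.
  have cEF : c \in E ++ x :: F by rewrite (mem_subseq sub) // !inE eqxx orbT.
  by move: ush => /andP[yn _]; apply: contraNneq yn => ->.
have po z : z \in porbit p x -> porbit p z = porbit p x by rewrite -eq_porbit_mem => /eqP.
have pxc : restricts_to p [:: [:: x; c]; [:: b; d]] by apply: restricts_to22.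
have pyc : restricts_to p [:: [:: y; c]; [:: b; d]] by apply: restricts_to22; rewrite // po.
have cQ' : c \in Q by move: cx; rewrite mQ !inE eq_sym (negbTE xc) eq_sym (negbTE yc).
have pxyc : restricts_to p [:: [:: x; y; c]; [:: b; d]].
  have dx : d \notin porbit p x.
    apply: contra bx => dx; rewrite -(po _ dx) porbit_sym //.
  apply: restricts_to_cons; last by move=> z; rewrite !inE => /orP[]/eqP ->.
    by apply: (restricts_to1 uQ cQ); rewrite /= !eqxx sub1seq.
  exact: restricts_to_pair.
have cutbd : b \in E -> d \in F -> restricts_to (lambda g b d) [:: [:: x; y; c]] -> False.
  move=> bE dF rl; have bD : b \in D by rewrite finset.in_set mem_cat inE bE orbT.
  have dD : d \in D by rewrite finset.in_set mem_cat !inE dF !orbT.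
  have bd' : d \notin porbit g b by apply: (two_porbit_ne uxy); rewrite inE ?bE ?dF orbT.
  by have [h _] := n23 b d bD dD bd'; exact: h rl pxyc.
have lam E1 E2 F1 F2 : E = E1 ++ b :: E2 -> F = F1 ++ d :: F2 ->
    let s := (E2 ++ x :: E1) ++ (F2 ++ y :: F1) in
    uniq s /\ lambda g b d =1 cyc s.
  move=> eE eF s; rewrite /lambda (two_orbit_cut uxy eE) (two_orbit_cut2 uxy eF) /=.
  suff us : uniq s by split=> // z; rewrite cycE.
  apply: (@subseq_uniq _ _ (rot (size (x :: E1)) (x :: E) ++ rot (size (y :: F1)) (y :: F))).
    have -> : rot (size (x :: E1)) (x :: E) = b :: (E2 ++ x :: E1).
      by rewrite eE -cat_cons rot_size_cat.
    have -> : rot (size (y :: F1)) (y :: F) = d :: (F2 ++ y :: F1).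
      by rewrite eF -cat_cons rot_size_cat.
    by apply: cat_subseq; exact: subseq_cons.
  by rewrite (@perm_uniq _ _ ((x :: E) ++ y :: F)) //; apply: perm_cat; rewrite perm_rot.
have [t1 [t2 [e sub1 sub2]]] := subseq_catP sub.
case: t1 t2 e sub1 sub2 => [|b' [|c' [|d' [|? ?]]]] [|u [|v [|w [|? ?]]]] //= [] eb ec ed sub1 sub2; subst b c d.
- have {}sub2 : subseq [:: u; v; w] F by move: sub2; rewrite eq_sym (negbTE xb).
  apply: (n1 y u v w) => //.
  by apply: (restricts_to1 (two_uniq2 uxy) (two_fcycle2 uxy)); rewrite /= eqxx.
- have {}sub2 : subseq [:: u; v] F by move: sub2; rewrite eq_sym (negbTE xc).
  have bE : b' \in E by rewrite -sub1seq.
  have dF : v \in F by rewrite (mem_subseq sub2) // !inE eqxx orbT.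
  have [E1 [E2 eE]] := subseq_split bE.
  have uF : uniq F by have /andP[] := two_uniq2 uxy.
  have [F1 [F2 [eF uF1]]] : exists F1 F2, F = F1 ++ v :: F2 /\ u \in F1.
    have [F1 [F2 eF]] := subseq_split dF; exists F1, F2; split=> //.
    have [s1 [s2 [es subs1 subs2]]] := subseq_catP (t := [:: u; v]) (s1 := F1) (s2 := v :: F2) ltac:(by rewrite -eF).
    case: s1 es subs1 => [|u' s1] es subs1; last first.
      by move: es => [-> _]; rewrite (mem_subseq subs1) ?mem_head.
    move: es subs2 => /= <-; rewrite (negbTE cd) => /mem_subseq/(_ v).
    rewrite !inE eqxx orbT => /(_ isT) vF2.
    by move: uF; rewrite eF cat_uniq /= vF2 !andbF.
  have [us el] := lam _ _ _ _ eE eF.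
  apply: cutbd => //; rewrite (eq_restricts_to _ el).
  apply: (restricts_to1 us (cyc_fcycle us)).
  rewrite -catA; apply: (@cat_subseq _ [::] [:: x; y; u]); first exact: sub0seq.
  rewrite cat_cons /= eqxx catA; apply: (@cat_subseq _ [::] [:: y; u]); first exact: sub0seq.
  by rewrite /= eqxx sub1seq.
- have dF : u \in F by move: sub2; rewrite eq_sym (negbTE xd) sub1seq.
  have bE : b' \in E by rewrite (mem_subseq sub1) // mem_head.
  have [F1 [F2 eF]] := subseq_split dF.
  have uE : uniq E by have /andP[] := two_uniq1 uxy.
  have [E1 [E2 [eE cE2]]] : exists E1 E2, E = E1 ++ b' :: E2 /\ c' \in E2.
    have [E1 [E2 eE]] := subseq_split bE; exists E1, E2; split=> //.
    have [s1 [s2 [es subs1 subs2]]] := subseq_catP (t := [:: b'; c']) (s1 := E1) (s2 := b' :: E2) ltac:(by rewrite -eE).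
    case: s1 es subs1 => [|u' s1] es subs1.
      move: es subs2 => /= <-; rewrite eqxx => /mem_subseq/(_ c'); apply; exact: mem_head.
    move: es => [eb _]; have : b' \in E1 by rewrite (mem_subseq subs1) // eb mem_head.
    by move=> b1; move: uE; rewrite eE cat_uniq /= b1 /= andbF.
  have [us el] := lam _ _ _ _ eE eF.
  apply: cutbd => //; rewrite (eq_restricts_to _ el) -(restricts_to_rot _ _ 2).
  apply: (restricts_to1 us (cyc_fcycle us)); rewrite /rot /=.
  rewrite -catA; apply: (@cat_subseq _ [:: c'] [:: x; y]); first by rewrite sub1seq.
  rewrite cat_cons /= eqxx catA; apply: (@cat_subseq _ [::] [:: y]); first exact: sub0seq.
  by rewrite sub1seq mem_head.
apply: (n1 x b' c' d') => //.
by apply: (restricts_to1 (two_uniq1 uxy) (two_fcycle1 uxy)); rewrite /= eqxx.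
Qed.

Lemma glued_pattern a c : a \in sh -> y \notin a :: c -> restricts_to gh [:: a :: c] ->
  exists i, rot i [seq z <- E ++ x :: F | z \in a :: c] = a :: c.
Proof.
move=> ash yc h; have := restricts_to1_rot ush csh ash h.
have -> : [seq z <- sh | z \in a :: c] = [seq z <- E ++ x :: F | z \in a :: c].
  by rewrite /sh [LHS]/= (negbTE yc).
by move=> e; eexists; exact: e.
Qed.

Lemma glued_pattern_y c : restricts_to gh [:: y :: c] -> subseq c (E ++ x :: F).
Proof.
move=> h; have := restricts_to1_rot ush csh (mem_head _ _) h.
have -> : [seq z <- sh | z \in y :: c] = y :: [seq z <- E ++ x :: F | z \in y :: c].
  by rewrite /sh [LHS]/= mem_head.
by rewrite [index _ _]/= eqxx rot0 => -[e]; rewrite -[X in subseq X]e; exact: filter_subseq.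
Qed.

Let q := tperm x y ∘ p.
Let qE : q = rp (predC1 x) p.
Proof.
rewrite rpC1 /q; apply/permP => z; rewrite !pcompE inj_tperm ?permKV ?pxy; last exact: perm_inj.
by rewrite tpermC.
Qed.

Let gh_in c : restricts_to gh [:: c] -> all (fun c => 1 < size c) [:: c] -> {subset c <= sh}.
Proof.
move=> h sz z zc; have ghD : perm_on [set z in sh] gh.
  rewrite /gh merge_cycle //; apply/fintype.subsetP => v; rewrite finset.in_set; apply: contraR.
  by move/(cyc_out ush) => ->.
have := restricts_to_perm_on ghD h sz; rewrite /= cats0 => /(_ z zc).
by rewrite finset.in_set.
Qed.

Let q_out ss : restricts_to q ss -> all (fun c => 1 < size c) ss -> x \notin flatten ss.
Proof.
move=> h sz; have qD : perm_on [set~ x] q.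
  apply/fintype.subsetP => v; rewrite !inE; apply: contraNneq => ->.
  by rewrite /q pcompE pxy tpermR.
by apply/negP => /(restricts_to_perm_on qD h sz); rewrite !inE eqxx.
Qed.

Let po z : z \in porbit p x -> porbit p z = porbit p x.
Proof. by rewrite -eq_porbit_mem => /eqP. Qed.

Let yx : y \in porbit p x. Proof. by rewrite -pxy mem_porbit1. Qed.

(** A three-point pattern of the glued pair either avoids the cycle of [p] through
    [x] and [y], and then is forbidden in the annulus cut at [x] and [y], or it
    lies on that cycle.  In the second case two of its points, in the order of
    both cycles, form with [y] a pattern treated by [no_s1_through]. *)
Lemma glued_no_s1 a b c : restricts_to gh [:: [:: a; b; c]] ->
  restricts_to q [:: [:: a; b; c]] -> False.
Proof.
move=> hg hq; have xabc := q_out hq isT; rewrite [flatten _]/= in xabc.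
have hp : restricts_to p [:: [:: a; b; c]].
  by apply: (@restricts_to_of_rp _ (predC1 x)) => //; rewrite -qE.
have [Q [uQ cQ mQ]] := pcyc.
have ina z : z \in [:: a; b; c] -> (z \in porbit p a).
  by move=> zc; rewrite (restricts_to_porbit hp (mem_head _ _) (mem_head _ _)).
have ash : a \in sh by apply: (gh_in hg isT); rewrite mem_head.
have [ax|ax] := boolP (a \in porbit p x); last first.
  have xa : x \notin porbit p a by rewrite porbit_sym.
  have ya : y \notin porbit p a by rewrite porbit_sym po.
  have yabc : y \notin [:: a; b; c] by apply: contra ya; exact: ina.
  case: cut_x_y => h _; apply: (h a b c); first exact: lambda_of_merge.
  apply: (restricts_to_cons hp (restricts_to_pair xy yx)).
  by move=> z; rewrite !inE => /orP[]/eqP ->.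
(* Two points of the pattern that follow [y] in both cycles. *)
have through b' c' : subseq [:: b'; c'] (E ++ x :: F) -> b' \in [:: a; b; c] ->
    c' \in [:: a; b; c] -> restricts_to p [:: [:: y; b'; c']] -> False.
  move=> sub b'i c'i; apply: no_s1_through => //; [apply: contraNneq xabc => <- //|].
  by apply: contraNneq xabc => <-.
(* If [y] is not in the pattern, start the cycle of [p] at [y]: the first two or
   the last two of its points there have the same order on the glued cycle. *)
have [yabc|yabc] := boolP (y \in [:: a; b; c]).
  have [i [|b' [|c' [|? ?]]] e] := rot_to yabc; try by have := congr1 size e; rewrite size_rot.
  have mi z : z \in [:: y; b'; c'] -> z \in [:: a; b; c] by rewrite -e mem_rot.
  apply: (through b' c'); rewrite ?mi ?inE ?eqxx ?orbT //.
    by apply: glued_pattern_y; rewrite -e restricts_to_rot.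
  by rewrite -e restricts_to_rot.
have [Q' [uQ' cQ' yQ']] : exists Q', [/\ uniq (y :: Q'), fcycle p (y :: Q') &
    forall z, (z \in porbit p x) = (z \in y :: Q')].
  exists (rcons Q x); have e : rot 1 (x :: y :: Q) = y :: rcons Q x by rewrite rot1_cons.
  by rewrite -e rot_uniq rot_cycle uQ cQ; split=> // z; rewrite mem_rot mQ.
have := restricts_to1_rot uQ' cQ' (a := a) _ hp; rewrite -yQ' => /(_ ax).
have -> : [seq z <- y :: Q' | z \in [:: a; b; c]] = [seq z <- Q' | z \in [:: a; b; c]].
  by rewrite [LHS]/= (negbTE yabc).
move: (index _ _) => k; set s3 := seq.filter _ _ => es3.
have sub3 : subseq s3 Q' by exact: filter_subseq.
have hg3 : restricts_to gh [:: s3] by rewrite -(restricts_to_rot _ _ k) es3.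
have mi z : z \in s3 -> z \in [:: a; b; c] by rewrite -es3 mem_rot.
have sz3 : size s3 = 3 by rewrite -(size_rot k) es3.
case: {es3}s3 sub3 hg3 mi sz3 => [|a' [|b' [|c' [|? ?]]]] // sub3 hg3 mi _.
have y3 : y \notin [:: a'; b'; c'] by apply: contra yabc; exact: mi.
have a'sh : a' \in sh by apply: (gh_in hg3 isT); rewrite mem_head.
have [i ei] := glued_pattern a'sh y3 hg3.
have through' b0 c0 : subseq [:: b0; c0] [:: a'; b'; c'] ->
    subseq [:: b0; c0] [seq z <- E ++ x :: F | z \in [:: a'; b'; c']] -> False.
  move=> s0 s1; have m0 : {subset [:: b0; c0] <= [:: a; b; c]}.
    by move=> z /(mem_subseq s0) /mi.
  apply: (through b0 c0); rewrite ?m0 ?inE ?eqxx ?orbT //.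
    by apply: subseq_trans s1 (filter_subseq _ _).
  by apply: (restricts_to1 uQ' cQ'); rewrite /= eqxx; apply: subseq_trans sub3.
have sc (u v w : T) : subseq [:: u; v] [:: u; v; w] by rewrite /= !eqxx.
have cs (u v w : T) : subseq [:: v; w] [:: u; v; w] by exact: subseq_cons.
by case: (rotS3 ei) => ef; [apply: (through' a' b') | apply: (through' b' c') |
  apply: (through' a' b')]; rewrite ?ef.
Qed.

(** When the chord [a], [c] lies on the cycle of [p] through [y], it can be replaced
    by a chord from [y] to [a] or to [c] that still crosses the other one. *)
Lemma glued_no_n1_x a b c d : restricts_to gh [:: [:: a; b; c; d]] ->
  x \notin [:: a; b; c; d] -> a \in porbit p x -> c \in porbit p x ->
  d \in porbit p b -> b \notin porbit p x -> False.
Proof.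
move=> hg xn ax cx db bx.
have dx : d \notin porbit p x by apply: contra bx => dx; rewrite -(po dx) porbit_sym.
have bd : b \in porbit p d by rewrite porbit_sym.
have yb : y != b by apply: contraNneq bx => <-.
have yd : y != d by apply: contraNneq dx => <-.
have ash : a \in sh by apply: (gh_in hg isT); rewrite mem_head.
have sub3 (s : seq T) : {subset s <= [:: a; b; c; d]} -> x \notin s.
  by move=> h; apply: contra xn; exact: h.
have T1 : subseq [:: b; c; d] (E ++ x :: F) -> False.
  move=> sub; apply: (no_n1_through sub) => //; apply: sub3 => z; rewrite !inE => /or3P[]/eqP ->;
  by rewrite eqxx ?orbT.
have T2 : subseq [:: d; a; b] (E ++ x :: F) -> False.
  move=> sub; apply: (no_n1_through sub) => //; apply: sub3 => z; rewrite !inE => /or3P[]/eqP ->;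
  by rewrite eqxx ?orbT.
have [ya|ya] := eqVneq y a; first by apply: T1; apply: glued_pattern_y; rewrite ya.
have [yc|yc] := eqVneq y c.
  by apply: T2; apply: glued_pattern_y; rewrite yc -(restricts_to_rot _ _ 2).
have yn : y \notin [:: a; b; c; d] by rewrite !inE !negb_or ya yb yc yd.
have [i ei] := glued_pattern ash yn hg; have fs := filter_subseq (mem [:: a; b; c; d]) (E ++ x :: F).
have s1 (u v w t : T) : subseq [:: v; w; t] [:: u; v; w; t] by exact: subseq_cons.
have s2 (u v w t : T) : subseq [:: v; w; t] [:: v; w; t; u] by rewrite /= !eqxx.
by case: (rotS4 ei) => ef; [apply: T1 | apply: T1 | apply: T2 | apply: T2];
  apply: subseq_trans fs; rewrite ?ef.
Qed.

(** The crossing pattern, with the same division into cases as for three points. *)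
Lemma glued_no_n1 a b c d : restricts_to gh [:: [:: a; b; c; d]] ->
  restricts_to q [:: [:: a; c]; [:: b; d]] -> False.
Proof.
move=> hg hq; have xn := q_out hq isT; rewrite [flatten _]/= in xn.
have hp : restricts_to p [:: [:: a; c]; [:: b; d]].
  by apply: (@restricts_to_of_rp _ (predC1 x)) => //; rewrite -qE.
have xn' : x \notin [:: a; b; c; d].
  by apply: contra xn; rewrite !inE => /or4P[]/eqP ->; rewrite eqxx ?orbT.
have up : uniq [:: a; c; b; d] by case/restricts_toP: hp.
have ac : c \in porbit p a.
  by rewrite (restricts_to_porbit hp (mem_head _ _) (mem_head _ _)) // !inE eqxx orbT.
have bd : d \in porbit p b.
  by rewrite (@restricts_to_porbit _ _ _ [:: b; d] b d hp) // !inE eqxx ?orbT.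
have ab : b \notin porbit p a.
  rewrite (restricts_to_porbit hp (mem_head _ _) (mem_head _ _)) ?inE ?eqxx ?orbT //.
  by move: up; rewrite /= !inE !negb_or => /and3P[/and3P[_ ab _] /andP[cb _] _]; rewrite ![b == _]eq_sym (negbTE ab) (negbTE cb).
have [ax|ax] := boolP (a \in porbit p x).
  by apply: (glued_no_n1_x hg) => //; rewrite -?(po ax).
have [bx|bx] := boolP (b \in porbit p x).
  have hg' : restricts_to gh [:: [:: b; c; d; a]] by rewrite -(restricts_to_rot _ [:: a; b; c; d] 1) in hg.
  apply: (glued_no_n1_x hg') => //.
  - by apply: contra xn'; rewrite !inE => /or4P[]/eqP ->; rewrite eqxx ?orbT.
  - by rewrite -(po bx).
  - by rewrite porbit_sym.
  by apply: contra ax => cx; rewrite -(po cx) porbit_sym.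
have ash : a \in sh by apply: (gh_in hg isT); rewrite mem_head.
have xa : x \notin porbit p a by rewrite porbit_sym.
have xb : x \notin porbit p b by rewrite porbit_sym.
have ya : y \notin porbit p a by rewrite porbit_sym po.
have yb : y \notin porbit p b by rewrite porbit_sym po.
have yn : y \notin [:: a; b; c; d].
  apply/negP; rewrite !inE => /or4P[]/eqP e.
  - by move: ya; rewrite e porbit_id.
  - by move: yb; rewrite e porbit_id.
  - by move: ya; rewrite e ac.
  by move: yb; rewrite e bd.
have yn' : y \notin [:: a; c; b; d].
  by apply: contra yn; rewrite !inE => /or4P[]/eqP ->; rewrite eqxx ?orbT.
case: cut_x_y => _ h; apply: (h a b c d); first exact: lambda_of_merge.
have aC : a != c by move: up; rewrite /= !inE !negb_or => /andP[/and3P[]].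
have bD : b != d by move: up; rewrite /= !inE !negb_or => /and3P[_ _ /andP[]].
have da : d \notin porbit p a.
  by apply: contra ab; move: bd; rewrite porbit_sym -!eq_porbit_mem => /eqP ->.
apply: restricts_to_cons; [exact: restricts_to_pair|exact: restricts_to22|].
by move=> z; rewrite !inE => /or4P[]/eqP ->.
Qed.

(** Gluing reduces the annulus to the disc: the glued pair is noncrossing, hence
    planar, and gluing preserves the genus. *)
Lemma ann_noncrossing_planar_xy : planar g p.
Proof.
rewrite planar_merge // -/q -/gh.
have qD : perm_on [set z in sh] q.
  apply/fintype.subsetP => z; rewrite finset.in_set merge_mem => /eqP qz.
  apply: contraT => zn; case: qz; rewrite /q pcompE (out_perm pD) ?finset.in_set // tpermD //.
    by apply: contraNneq zn => <-; rewrite mem_cat mem_head.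
  by apply: contraNneq zn => <-; rewrite mem_cat mem_head orbT.
have gE : gh = cyc sh by rewrite /gh merge_cycle.
rewrite gE planar_cyc //; apply/eqP; apply: noncrossing_count => //; rewrite -gE.
by split; [exact: glued_no_s1 | exact: glued_no_n1].
Qed.

End Reduction.

Lemma trans_connect (D : {set T}) g p a0 : perm_on D g -> perm_on D p -> a0 \in D ->
  reflect {in D &, forall a b, connect (step g p) a b} [transitive <<[set g; p]>>%g, on D | 'P].
Proof.
move=> gD pD a0D; have orbE a : action.orbit 'P <<[set g; p]>> a =i connect (step g p) a.
  move=> b; apply/idP/idP => [/orbitP[h hG <-]|].
    pose C := [set z | connect (step g p) a z].
    have st : [set g; p] \subset 'N(C | 'P)%g.
      apply/fintype.subsetP => u; rewrite !inE => /orP[]/eqP ->; apply/fintype.subsetP => z; rewrite !inE => az;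
        apply: connect_trans az (connect1 _); by rewrite /step /= eqxx ?orbT.
    have := fintype.subsetP (_ : <<[set g; p]>>%g \subset 'N(C | 'P)%g) _ hG.
    rewrite gen_subG => /(_ st) hN.
    have := astabs_act a hN; rewrite !inE connect0 => ->; done.
  move=> c; apply: (connect_closed_step (A := mem (action.orbit 'P <<[set g; p]>> a)) _ _ c); last exact: orbit_refl.
    move=> z /= /orbitP[h hG <-]; apply/orbitP; exists (h * g)%g; last by rewrite actM.
    by rewrite groupM // mem_gen // !inE eqxx.
  move=> z /= /orbitP[h hG <-]; apply/orbitP; exists (h * p)%g; last by rewrite actM.
  by rewrite groupM // mem_gen // !inE eqxx orbT.
have clos a b : a \in D -> connect (step g p) a b -> b \in D.
  move=> aD c; apply: (connect_closed_step (A := mem D) _ _ c) => // z /= zD; by rewrite perm_closed.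
apply: (iffP idP) => [tr a b aD bD|h].
  by have := atransP tr a aD => /setP/(_ b); rewrite orbE bD.
apply/imsetP; exists a0 => //; apply/setP => b.
rewrite orbE; apply/idP/idP => [bD|]; [exact: h | exact: clos].
Qed.

(** Transitivity provides a point [x] that [p] sends to the other cycle, where
    the two cycles can be glued. *)
Lemma ann_nc_planar (c1 c2 : seq T) p : uniq (c1 ++ c2) -> c1 != [::] -> c2 != [::] ->
  let D := [set z in c1 ++ c2] in let g := cyc c1 ∘ cyc c2 in
  ann_nc D g p =
  [&& perm_on D p, [transitive <<[set g; p]>>%g, on D | 'P] & planar g p].
Proof.
move=> u n1 n2 D g; have /and3P[u1 /hasPn dis u2] : [&& uniq c1, ~~ has (mem c1) c2 & uniq c2] by rewrite -cat_uniq.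
have gD : perm_on D g.
  apply/fintype.subsetP => z; rewrite finset.in_set mem_cat; apply: contraR.
  by rewrite negb_or => /andP[z1 z2]; rewrite pcompE !cyc_out.
apply/(ann_ncP _ gD)/and3P => -[pD tr h]; split=> //; last exact: planar_ann_noncrossing.
have [x0 x0c] : exists x0, x0 \in c1 by case: (c1) n1 => // x c _; exists x; rewrite mem_head.
have [y0 y0c] : exists y0, y0 \in c2 by case: (c2) n2 => // x c _; exists x; rewrite mem_head.
have inD z : (z \in D) = (z \in c1) || (z \in c2) by rewrite finset.in_set mem_cat.
have x0D : x0 \in D by rewrite inD x0c.
have y0D : y0 \in D by rewrite inD y0c orbT.
have cn := trans_connect gD pD x0D tr.
have [x xc1 pxc2] : exists2 x, x \in c1 & p x \in c2.
  apply/hasP; apply: contraT => /hasPn hn.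
  have := @connect_closed_step _ g p (mem c1) x0 y0 _ _ (cn _ _ x0D y0D) x0c.
  have y0n : mem c1 y0 = false by apply/negP; exact/negP/dis.
  rewrite y0n; apply=> z /= zc; last first.
    by have := perm_closed z pD; rewrite !inD zc (negbTE (hn _ zc)) orbF.
  by rewrite pcompE (cyc_out u2) ?cycE ?mem_next //; apply/negP => /dis; rewrite /= zc.
have [i1 E e1] := rot_to xc1; have [i2 F e2] := rot_to pxc2.
have gE : g = cyc (x :: E) ∘ cyc (p x :: F) by rewrite -e1 -e2 !cyc_rot.
have DE : D = [set z in (x :: E) ++ p x :: F].
  by apply/setP => z; rewrite !finset.in_set !mem_cat -e1 -e2 !mem_rot.
rewrite gE; apply: ann_noncrossing_planar_xy => //; last by rewrite -gE -DE.
  rewrite -e1 -e2 cat_uniq !rot_uniq u1 u2 andbT; apply/hasPn => z.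
  by rewrite mem_rot => /dis; rewrite /= mem_rot.
by rewrite -DE.
Qed.

End Annular.

(** * The Euler characteristic of a premap *)

Section Counting.
Variable T : finType.
Implicit Types (f g p h : {perm T}) (A D : {set T}).

Lemma porbit_agree A f h x : {in A, f =1 h} -> (forall z, z \in A -> f z \in A) ->
  x \in A -> porbit f x = porbit h x.
Proof.
move=> fh fA xA; have it i : ((f ^+ i)%g x \in A) /\ (f ^+ i)%g x = (h ^+ i)%g x.
  rewrite !permX; elim: i => //= i [iA e]; split; first exact: fA.
  by rewrite -e fh.
by apply/setP => y; apply/porbitP/porbitP => -[i ->]; exists i; case: (it i).
Qed.

Lemma ncycles_agree A f h : {in A, f =1 h} -> (forall z, z \in A -> f z \in A) ->
  ncycles A f = ncycles A h.
Proof.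
move=> fh fA; congr #|pred_of_set _|; apply: eq_in_imset => x; exact: (porbit_agree fh fA).
Qed.

Lemma ncyc_setC A f : (forall z, (f z \in A) = (z \in A)) ->
  ncyc f = ncycles A f + ncycles (~: A) f.
Proof.
move=> fA; have oA x y : y \in porbit f x -> (y \in A) = (x \in A).
  move=> yx; apply/idP/idP => h; last by apply: (porbit_closed (A := mem A) _ yx) => // z; rewrite /= fA.
  by rewrite porbit_sym in yx; apply: (porbit_closed (A := mem A) _ yx) => // z; rewrite /= fA.
rewrite /ncyc /ncycles -cardsUI (_ : _ :&: _ = finset.set0) ?cards0 ?addn0.
  apply: eq_card => B; rewrite inE; apply/imsetP/orP => [[x _ ->]|[]/imsetP[x _ ->]]; try by exists x.
  by have [xA|xA] := boolP (x \in A); [left|right]; rewrite imset_f // inE.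
apply/setP => B; rewrite !inE; apply/negP => /andP[/imsetP[x xA ->] /imsetP[y]].
rewrite inE => yA /eqP; rewrite eq_porbit_mem => /oA; by rewrite xA (negbTE yA).
Qed.

Lemma ncycles_conj A f h : ncycles (h @: A) (h ∘ f ∘ h^-1%g) = ncycles A f.
Proof.
rewrite /ncycles -[RHS](card_imset _ (imset_inj (@perm_inj _ h))).
apply: eq_card => B; apply/imsetP/imsetP => [[k /imsetP[l lA ->] ->]|[C /imsetP[k kA ->] ->]].
  by exists (porbit f l); rewrite ?imset_f // porbit_conj.
by exists (h k); rewrite ?imset_f // porbit_conj.
Qed.

Lemma ncyclesV A f : ncycles A f^-1%g = ncycles A f.
Proof. by congr #|pred_of_set _|; apply: eq_imset => x; rewrite porbitV. Qed.

Lemma ncycles_id A f : {in A, forall z, f z = z} -> ncycles A f = #|A|.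
Proof.
move=> fz; rewrite /ncycles card_in_imset // => x y xA yA /eqP; rewrite eq_porbit_mem.
move=> /(porbit_closed (A := pred1 y)) /= h; apply/eqP; apply: h => // z /eqP ->.
by rewrite fz.
Qed.

Lemma ncyc_perm_on A f : perm_on A f -> ncyc f = ncycles A f + #|~: A|.
Proof.
move=> fA; rewrite (@ncyc_setC A); last by move=> z; rewrite perm_closed.
by rewrite (@ncycles_id (~: A)) // => z; rewrite inE => /(out_perm fA).
Qed.

Lemma even_invol (S : finType) (A : {set S}) (f : S -> S) : involutive f ->
  {in A, forall z, f z \in A} -> {in A, forall z, f z != z} -> ~~ odd #|A|.
Proof.
move=> fK fA fn; have [n] := ubnP #|A|; elim: n A fA fn => // n IH A fA fn An.
have [->|[x xA]] := set_0Vmem A; first by rewrite cards0.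
have fxA := fA x xA; have fxx := fn x xA.
have e : #|A| = (#|(A :\ x) :\ f x|).+2.
  by rewrite (cardsD1 x A) xA (cardsD1 (f x)) !inE fxx fxA.
rewrite e /= negbK; apply: IH.
- move=> z; rewrite !inE => /and3P[zf zx zA]; rewrite fA // andbT (inj_eq (inv_inj fK)) zx /=.
  by apply: contraNneq zf => <-; rewrite fK.
- by move=> z; rewrite !inE => /and3P[_ _ /fn].
by move: An; rewrite e !ltnS => /ltnW.
Qed.

Lemma norb_le2 g p x y : (forall z, connect (step g p) x z \/ connect (step g p) y z) ->
  norb g p <= 2.
Proof.
move=> h; rewrite /norb /n_comp_mem.
have s := step_sym g p.
apply: (@leq_trans #|[set fingraph.root (step g p) x; fingraph.root (step g p) y]|).
  apply: subset_leq_card; apply/fintype.subsetP => z; rewrite !inE andbT => /eqP <-.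
  by case: (h z) => /(fingraph.rootP s) ->; rewrite eqxx ?orbT.
by rewrite cards2; case: (_ != _).
Qed.

Lemma norb_le1 g p x : (forall z, connect (step g p) x z) -> norb g p <= 1.
Proof.
move=> h; rewrite /norb /n_comp_mem.
have s := step_sym g p.
apply: (@leq_trans #|[set fingraph.root (step g p) x]|); last by rewrite cards1.
apply: subset_leq_card; apply/fintype.subsetP => z; rewrite !inE andbT => /eqP <-.
by move/(fingraph.rootP s): (h z) => ->.
Qed.

(** One orbit on [A] and a fixed point for every element outside. *)
Lemma norb_connected A g p x : perm_on A g -> perm_on A p -> x \in A ->
  {in A &, forall a b, connect (step g p) a b} -> norb g p = (#|~: A|).+1.
Proof.
move=> gA pA xA c; rewrite (@norb_full T g p (cyc (enum A)) 1%g A) //.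
- rewrite norb1 (@ncyc_perm_on A); last first.
    by apply/fintype.subsetP => z; rewrite -topredE /=; apply: contraR => zA; rewrite cyc_out ?enum_uniq ?mem_enum.
  suff -> : ncycles A (cyc (enum A)) = 1 by rewrite add1n.
  rewrite /ncycles; apply/eqP/cards1P; exists [set z in A]; apply/setP => B; rewrite inE.
  have oE z : z \in A -> porbit (cyc (enum A)) z = [set z in A].
    move=> zA; apply/setP => w; rewrite inE.
    by rewrite (porbit_fcycle _ (cyc_fcycle (enum_uniq A))) ?mem_enum.
  apply/imsetP/eqP => [[z zA ->]|->]; first exact: oE.
  by exists x; rewrite ?oE.
- by apply/fintype.subsetP => z; rewrite -topredE /=; apply: contraR => zA; rewrite cyc_out ?enum_uniq ?mem_enum.
- exact: perm_on1.
move=> a b aA bA; apply: connect_porbit_l.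
by rewrite (porbit_fcycle _ (cyc_fcycle (enum_uniq A))) ?mem_enum.
Qed.

End Counting.

Section SignedPerm.
Variable I : {fset nat}.
Local Notation K := (I * bool)%type.
Implicit Types (k l : K) (g p r : {perm K}) (D : {set K}).

Lemma negK : involutive (@neg I). Proof. by move=> [k b]; rewrite /neg negbK. Qed.
Lemma neg_neq k : neg k != k.
Proof. by case: k => k []; rewrite /neg; apply/eqP => -[]. Qed.

Lemma deltaE k : delta I k = neg k. Proof. by rewrite permE. Qed.
Lemma minusE g k : minus g k = neg (g (neg k)).
Proof. by rewrite !pcompE !deltaE. Qed.
Lemma minusVE g k : (minus g)^-1%g k = neg (g^-1%g (neg k)).
Proof. by apply: (@perm_inj _ (minus g)); rewrite permKV minusE negK permKV negK. Qed.

(** This is [r_+ r_-^-1], the permutation of the signed points whose restriction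
    to the support of [r] is [r] and that runs backwards through the negatives. *)
Definition ext r := r ∘ (minus r)^-1%g.
Lemma extE r k : ext r k = r (neg (r^-1%g (neg k))).
Proof. by rewrite pcompE minusVE. Qed.

(** The first defining property of a premap: [f] runs through the negatives of
    its cycles backwards. *)
Definition reversing (f : {perm K}) := forall k, f (neg (f k)) = neg k.

Lemma reversingV f k : reversing f -> f^-1%g (neg k) = neg (f k).
Proof. by move=> rf; apply: (@perm_inj _ f); rewrite permKV rf. Qed.

Lemma premapP p : premap p <-> reversing p /\ forall k, neg k \notin porbit p k.
Proof.
split=> [/forallP h|[rp nc]].
  split=> k; last by case/andP: (h k).
  have /andP[/eqP e _] := h (neg (p k)).
  by rewrite e negK permK.
apply/forallP => k; rewrite nc andbT; apply/eqP.
by rewrite (reversingV k rp) negK.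
Qed.

(** Applied to a cycle from [k] to [neg k], the reversal symmetry moves both ends
    one step inwards, until some point is sent to its own negative. *)
Lemma reversing_noloop f k : reversing f -> (forall l, f l != neg l) ->
  neg k \notin porbit f k.
Proof.
move=> rf nf; apply/negP => /porbitP[m]; rewrite permX => e.
have [n] := ubnP m; elim: n m k e => // n IH [|[|i]] k e.
- by move=> _; have := neg_neq k; rewrite e eqxx.
- by move=> _; have := nf k; rewrite e eqxx.
move=> ni; apply: (IH i (f k)); last by rewrite ltnS in ni; apply: ltnW.
by apply: (@perm_inj _ f); rewrite rf e iterSr.
Qed.

Lemma deltaV : (delta I)^-1%g = delta I.
Proof.
by apply/permP => l; apply: (@perm_inj _ (delta I)); rewrite permKV !deltaE negK.
Qed.

(** The sign exchanges the cycles in pairs. *)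
Lemma reversing_even f : reversing f -> (forall k, neg k \notin porbit f k) -> ~~ odd (ncyc f).
Proof.
move=> rf nf; have pn k : porbit f (neg k) = delta I @: porbit f k.
  have e : delta I ∘ f^-1%g ∘ (delta I)^-1%g = f.
    apply/permP => l; rewrite !pcompE deltaE.
    have -> : (delta I)^-1%g l = neg l by apply: (@perm_inj _ (delta I)); rewrite permKV deltaE negK.
    by rewrite reversingV // negK.
  by rewrite -deltaE -{1}e porbit_conj porbitV.
apply: (@even_invol _ (porbits f) (fun B : {set K} => delta I @: B)).
- move=> B; rewrite -imset_comp -[RHS]imset_id; apply: eq_imset => k /=.
  by rewrite !deltaE negK.
- by move=> B /imsetP[k _ ->]; rewrite -pn imset_f.
move=> B /imsetP[k _ ->]; rewrite -pn eq_porbit_mem porbit_sym porbit_sym; exact: nf.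
Qed.

Section WithGamma.
Variables (g p : {perm K}).
Hypothesis gpos : perm_on (posI I) g.
Hypothesis pp : premap p.

Lemma ext_gamma k : ext g k = if k.2 then g k else neg (g^-1%g (neg k)).
Proof.
have nout l : ~~ l.2 -> g l = l by move=> h; rewrite (out_perm gpos) // inE.
have npos l : (g l).2 = l.2.
  by have := perm_closed l gpos; rewrite !inE.
have nposV l : (g^-1%g l).2 = l.2 by rewrite -{2}(permKV g l) npos.
rewrite extE; case: ifP => k2.
  have -> : g^-1%g (neg k) = neg k.
    by apply: (@perm_inj _ g); rewrite permKV nout //= k2.
  by rewrite negK.
by rewrite nout //= nposV /= k2.
Qed.

Lemma ext_gamma_sign k : (ext g k).2 = k.2.
Proof.
have npos l : (g l).2 = l.2 by have := perm_closed l gpos; rewrite !inE.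
have nposV l : (g^-1%g l).2 = l.2 by rewrite -{2}(permKV g l) npos.
by rewrite ext_gamma; case: ifP => k2; rewrite ?npos //= nposV /= k2.
Qed.

Lemma ext_gamma_rev : reversing (ext g).
Proof.
move=> k; rewrite (ext_gamma (neg _)) /= ext_gamma_sign ext_gamma; case: (k.2) => /=.
  by rewrite negK permK.
by rewrite negK permKV.
Qed.

Lemma ext_gamma_premap : premap (ext g).
Proof.
apply/premapP; split; first exact: ext_gamma_rev.
move=> k; apply/negP => /(porbit_closed (A := fun l => l.2 == k.2)) h.
have h1 z : z.2 == k.2 -> (ext g z).2 == k.2 by rewrite ext_gamma_sign.
by have := h h1 (eqxx _); rewrite /=; case: (k.2).
Qed.

(** The third permutation whose cycles [chi] counts.  It has as many cycles as the
    product of the other two ([ncyc_kreweras]), so [chi] is half the Euler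
    characteristic of the hypermap of [ext g] and [p]. *)
Definition kreweras := g^-1%g ∘ p^-1%g ∘ minus g.

Lemma krewerasE k : kreweras k = g^-1%g (p^-1%g (minus g k)).
Proof. by rewrite (pcompE _ (minus g)) (pcompE g^-1%g). Qed.

Lemma ncyc_kreweras : ncyc kreweras = ncyc (ext g ∘ p).
Proof.
rewrite -ncycV.
have -> : kreweras^-1%g = (minus g)^-1%g ∘ (p ∘ g).
  apply/permP => k; apply: (@perm_inj _ kreweras); rewrite permKV krewerasE.
  by rewrite (pcompE (minus g)^-1%g) permKV (pcompE p) permK permK.
by rewrite (ncycC (minus g)^-1%g) -pcompA (ncycC p).
Qed.

Lemma g_minus k : g (minus g k) = minus g (g k).
Proof.
have nout l : ~~ l.2 -> g l = l by move=> h; rewrite (out_perm gpos) // inE.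
have npos l : (g l).2 = l.2 by have := perm_closed l gpos; rewrite !inE.
rewrite !minusE; have [k2|k2] := boolP k.2.
  rewrite (nout (neg k)) /= ?k2 // negK (nout (neg (g k))) ?negK //= npos k2 //.
by rewrite (nout k) // nout //= npos /= k2.
Qed.

Lemma kreweras_rev : reversing kreweras.
Proof.
have [rp_ _] := (premapP p).1 pp.
have mn l : minus g (neg l) = neg (g l) by rewrite minusE negK.
have gv l : g^-1%g (minus g l) = minus g (g^-1%g l).
  by apply: (@perm_inj _ g); rewrite permKV g_minus permKV.
move=> k; rewrite !krewerasE mn.
by rewrite permKV reversingV // permKV minusE negK permK.
Qed.

Lemma kreweras_noloop k : neg k \notin porbit kreweras k.
Proof.
apply: reversing_noloop; first exact: kreweras_rev.
have [rp_ np] := (premapP p).1 pp.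
move=> l; apply/eqP => /(congr1 g); rewrite krewerasE permKV => e.
have := np (minus g l); rewrite -porbitV; apply/negP/negPn.
suff <- : p^-1%g (minus g l) = neg (minus g l) by exact: mem_porbit1.
by rewrite e minusE negK.
Qed.

Lemma chiE : chi g p = (((ncyc (ext g))./2 + (ncyc p)./2 + (ncyc (ext g ∘ p))./2)%N%:Z - (#|` I|)%:Z)%R.
Proof. by rewrite -ncyc_kreweras. Qed.

(** The cycles of all three permutations come in pairs, so halving is exact. *)
Lemma chi_double : (ncyc (ext g))./2.*2 = ncyc (ext g) /\ (ncyc p)./2.*2 = ncyc p /\
  (ncyc (ext g ∘ p))./2.*2 = ncyc (ext g ∘ p).
Proof.
split; [|split]; apply: even_halfK.
- by apply: reversing_even; case/premapP: ext_gamma_premap.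
- by apply: reversing_even; case/premapP: pp.
by rewrite -ncyc_kreweras; apply: reversing_even; [exact: kreweras_rev | exact: kreweras_noloop].
Qed.

Lemma card_signed : #|{: K}| = (#|` I|).*2.
Proof. by rewrite card_prod card_bool -cardfE muln2. Qed.

(** The orientation cover of a connected surface has at most two components, each
    contributing at most 2 to twice [chi]. *)
Lemma chi_le2 x : (forall z, connect (step (ext g) p) x z \/ connect (step (ext g) p) (neg x) z) ->
  (chi g p <= 2)%R.
Proof.
move=> h; have n2 := norb_le2 h; have := genus_ge0 (ext g) p; rewrite card_signed chiE.
have [e1 [e2 e3]] := chi_double; lia.
Qed.

(** If the cover is connected it contributes at most 2 to twice [chi]. *)
Lemma chi_lt2 x : (forall z, connect (step (ext g) p) x z) -> (chi g p < 2)%R.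
Proof.
move=> h; have n2 := norb_le1 h; have := genus_ge0 (ext g) p; rewrite card_signed chiE.
have [e1 [e2 e3]] := chi_double; lia.
Qed.

End WithGamma.

Section Transversal.
Variables (D : {set K}).
Hypothesis Dneg : forall k, (neg k \in D) = (k \notin D).

Lemma setC_transversal : ~: D = delta I @: D.
Proof.
apply/setP => k; rewrite inE -Dneg; apply/idP/imsetP => [h|[l lD ->]].
  by exists (neg k); rewrite // deltaE negK.
by rewrite deltaE negK.
Qed.

Lemma card_transversal : #|D| = #|` I| /\ #|~: D| = #|` I|.
Proof.
have c : #|~: D| = #|D| by rewrite setC_transversal card_imset //; exact: perm_inj.
by have := cardsC D; rewrite card_signed c addnn => /double_inj <-.
Qed.

(** The cycles outside the sheet [D] are the negatives of those inside, run
    backwards. *)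
Lemma ncycles_transversal f : reversing f -> (forall k, (f k \in D) = (k \in D)) ->
  ncyc f = (ncycles D f).*2.
Proof.
move=> rf fD; rewrite (ncyc_setC fD) -addnn; congr addn.
rewrite setC_transversal -(ncyclesV D) -(ncycles_conj D f^-1%g (delta I)); congr ncycles.
by apply/permP => l; rewrite !pcompE deltaV !deltaE reversingV // negK.
Qed.

(** The product of two reversing permutations is not reversing, but the sign
    conjugates it to the inverse of the product in the other order. *)
Lemma ncycles_transversal2 f h : reversing f -> reversing h ->
  (forall k, (f k \in D) = (k \in D)) -> (forall k, (h k \in D) = (k \in D)) ->
  ncyc (f ∘ h) = (ncycles D (f ∘ h)).*2.
Proof.
move=> rf rh fD hD; have fhD k : ((f ∘ h) k \in D) = (k \in D) by rewrite pcompE fD hD.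
rewrite (ncyc_setC fhD) -addnn; congr addn.
have fDD : f @: D = D.
  apply/eqP; rewrite eqEcard card_imset ?leqnn ?andbT; last exact: perm_inj.
  by apply/fintype.subsetP => _ /imsetP[k kD ->]; rewrite fD.
have -> : ncycles D (f ∘ h) = ncycles D (h ∘ f).
  rewrite -{1}fDD -(ncycles_conj D (h ∘ f) f); congr ncycles.
  by apply/permP => l; rewrite !pcompE permKV.
rewrite setC_transversal -(ncyclesV D (h ∘ f)) -(ncycles_conj D (h ∘ f)^-1%g (delta I)); congr ncycles.
apply/permP => l; rewrite !pcompE deltaV !deltaE.
have -> : (h ∘ f)^-1%g (neg l) = f^-1%g (h^-1%g (neg l)).
  by apply: (@perm_inj _ (h ∘ f)); rewrite permKV pcompE !permKV.
by rewrite !reversingV // negK.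
Qed.

Lemma ext_in r k : perm_on D r -> k \in D -> ext r k = r k.
Proof.
move=> rD kD; rewrite extE; have nk : neg k \notin D by rewrite Dneg negbK.
have -> : r^-1%g (neg k) = neg k by apply: (@perm_inj _ r); rewrite permKV (out_perm rD).
by rewrite negK.
Qed.

Lemma ext_stable r k : perm_on D r -> (ext r k \in D) = (k \in D).
Proof.
move=> rD; rewrite extE perm_closed // Dneg.
by rewrite -(perm_closed _ rD) permKV Dneg negbK.
Qed.

Lemma ext_rev r : perm_on D r -> reversing (ext r).
Proof.
move=> rD k; have [kD|kD] := boolP (k \in D).
  rewrite (ext_in rD kD) extE negK permK (out_perm rD) // Dneg kD //.
have nkD : neg k \in D by rewrite Dneg.
rewrite ext_in //; last by rewrite Dneg ext_stable.
rewrite (extE r k) (out_perm rD (_ : neg (r^-1%g (neg k)) \notin D)) ?negK ?permKV //.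
by rewrite Dneg negbK -(perm_closed _ rD) permKV.
Qed.

(** A reversing permutation is determined by what it does on a sheet. *)
Lemma ext_rp f : reversing f -> (forall k, (f k \in D) = (k \in D)) ->
  ext (rp (mem D) f) = f.
Proof.
move=> rf fD; have rD : perm_on D (rp (mem D) f).
  apply/fintype.subsetP => z; rewrite -topredE /=; apply: contraR => zD.
  by rewrite rpE /= (negbTE zD).
have rin k : k \in D -> rp (mem D) f k = f k by move=> kD; rewrite rp1 //= fD.
apply/permP => k; have [kD|kD] := boolP (k \in D); first by rewrite ext_in // rin.
apply: (can_inj negK); apply: (@perm_inj _ f); rewrite rf.
have kD' : neg (ext (rp (mem D) f) k) \in D by rewrite Dneg ext_stable.
by have := ext_rev rD k; rewrite (ext_in rD kD') rin.
Qed.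

Lemma rp_ext r : perm_on D r -> rp (mem D) (ext r) = r.
Proof.
move=> rD; apply/permP => k; have [kD|kD] := boolP (k \in D).
  by rewrite rp1 /= ?ext_stable // ext_in.
by rewrite rpE /= (negbTE kD) (out_perm rD).
Qed.

(** Each sheet of a trivial double cover is a copy of the surface. *)
Lemma chi_planar g p h q x : perm_on (posI I) g -> premap p ->
  (forall k, (ext g k \in D) = (k \in D)) -> (forall k, (p k \in D) = (k \in D)) ->
  perm_on D h -> {in D, h =1 ext g} -> perm_on D q -> {in D, q =1 p} -> x \in D ->
  {in D &, forall a b, connect (step h q) a b} ->
  (chi g p == 2)%R = planar h q.
Proof.
move=> gpos pp gD pD hD hg qD qp xD c.
rewrite chiE // /planar (norb_connected hD qD xD c).
have [rg _] := (premapP _).1 (ext_gamma_premap gpos).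
have [rp_ _] := (premapP _).1 pp.
have [DI DCI] := card_transversal.
have hqD : perm_on D (h ∘ q) by exact: perm_onM.
rewrite (ncyc_perm_on hD) (ncyc_perm_on qD) (ncyc_perm_on hqD) DCI.
rewrite (ncycles_agree hg); last by move=> z zD; rewrite perm_closed.
rewrite (ncycles_agree qp); last by move=> z zD; rewrite perm_closed.
have hq : {in D, h ∘ q =1 ext g ∘ p}.
  by move=> z zD; rewrite (pcompE h q) (pcompE (ext g) p) qp // hg // pD.
rewrite (ncycles_agree hq); last by move=> z zD; rewrite perm_closed.
rewrite (ncycles_transversal rg gD) (ncycles_transversal rp_ pD).
rewrite (ncycles_transversal2 rg rp_ gD pD) !doubleK card_signed; lia.
Qed.

End Transversal.

(** ** Sheets of the orientation cover *)

Definition full D h q := [forall a in D, forall b in D, connect (step h q) a b].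

Lemma fullP D h q : reflect {in D &, forall a b, connect (step h q) a b} (full D h q).
Proof.
apply: (iffP forall_inP) => [h1 a b aD bD|h1 a aD]; first exact: (forall_inP (h1 a aD)).
by apply/forall_inP => b bD; apply: h1.
Qed.

(** [D] is a sheet over which the surface of [g] and [p] is a sphere. *)
Definition sheet g D p := [&& [forall k, (p k \in D) == (k \in D)],
  full D (rp (mem D) (ext g)) (rp (mem D) p) & planar (rp (mem D) (ext g)) (rp (mem D) p)].

Lemma rp_perm_on D f : perm_on D (rp (mem D) f).
Proof.
by apply/fintype.subsetP => z; rewrite -topredE /=; apply: contraR => zD; rewrite rpE /= (negbTE zD).
Qed.

Lemma rp_in D (f : {perm K}) k : (forall l, (f l \in D) = (l \in D)) -> k \in D -> rp (mem D) f k = f k.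
Proof. by move=> fD kD; rewrite rp1 //= fD. Qed.

Lemma sheet_chi g D p x : perm_on (posI I) g -> premap p ->
  (forall k, (neg k \in D) = (k \notin D)) -> (forall k, (ext g k \in D) = (k \in D)) ->
  x \in D -> sheet g D p -> chi g p = 2%R.
Proof.
move=> gpos pp Dneg gD xD /and3P[/forallP pD /fullP c pl].
have pD' k : (p k \in D) = (k \in D) by apply/eqP.
apply/eqP; rewrite (chi_planar Dneg gpos pp gD pD' (rp_perm_on D _) _ (rp_perm_on D _) _ xD c) //.
  by move=> k kD; rewrite rp_in.
by move=> k kD; rewrite rp_in.
Qed.

Section Blocks.
Variables (J : finType) (blk : I -> J) (g p : {perm K}).
Hypothesis gpos : perm_on (posI I) g.
Hypothesis gblk : forall k, blk (g k).1 = blk k.1.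
Hypothesis gcyc : forall k l, blk k.1 = blk l.1 -> k.2 -> l.2 -> l \in porbit g k.

Definition link p : rel J := [rel i j | [exists k : K, (blk k.1 == i) && (blk (p k).1 == j)]].

Lemma ext_blk k : blk (ext g k).1 = blk k.1.
Proof.
rewrite ext_gamma //; case: ifP => // _ /=.
by rewrite -[RHS]/(blk (neg k).1) -{2}(permKV g (neg k)) gblk.
Qed.

Hypothesis pp : premap p.

Lemma connect_neg x z : connect (step (ext g) p) x z -> connect (step (ext g) p) (neg x) (neg z).
Proof.
move=> c; have rg := ext_gamma_rev gpos; have [rp_ _] := (premapP p).1 pp.
have s := step_sym (ext g) p.
apply: (connect_closed_step (A := fun z => connect (step (ext g) p) (neg x) (neg z)) _ _ c); last exact: connect0.
  move=> w xw; apply: connect_trans xw _; rewrite s; apply: connect1.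
  by rewrite /step /= rg eqxx.
move=> w xw; apply: connect_trans xw _; rewrite s; apply: connect1.
by rewrite /step /= rp_ eqxx orbT.
Qed.

Lemma connect_block w z : blk w.1 = blk z.1 -> w.2 = z.2 -> connect (step (ext g) p) w z.
Proof.
have pos k l : blk k.1 = blk l.1 -> k.2 -> l.2 -> connect (step (ext g) p) k l.
  move=> b k2 l2; apply: connect_porbit_l.
  rewrite (porbit_agree (A := posI I) (h := g)) ?gcyc ?inE // => u; rewrite inE => u2.
    by rewrite ext_gamma // u2.
  by rewrite inE ext_gamma_sign.
move=> b; case w2 : w.2 => z2; first by apply: pos; rewrite -?z2.
rewrite -(negK w) -(negK z); apply: connect_neg; apply: pos => //=; by rewrite ?w2 -?z2.
Qed.

(** Points over the same word with the same sign are connected by [ext g], and a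
    link connects points over different words up to the signs. *)
Lemma linked_connected x : (forall j, connect (link p) (blk x.1) j) ->
  forall z, connect (step (ext g) p) x z \/ connect (step (ext g) p) (neg x) z.
Proof.
move=> cn; pose U z := connect (step (ext g) p) x z || connect (step (ext g) p) (neg x) z.
have Uneg z : U z -> U (neg z).
  by case/orP=> /connect_neg; rewrite /U ?negK => ->; rewrite ?orbT.
have Ublk w z : blk w.1 = blk z.1 -> U w -> U z.
  have same u v : blk u.1 = blk v.1 -> u.2 = v.2 -> U u -> U v.
    by move=> b s; have c := connect_block b s; case/orP=> h; apply/orP; [left|right]; apply: connect_trans h c.
  move=> b Uw; have [s|s] := eqVneq w.2 z.2; first exact: same Uw.
  apply: (@same (neg w)) => //; last exact: Uneg.
  by move: s => /=; case: (w.2); case: (z.2).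
have Q j : connect (link p) (blk x.1) j -> [forall z : K, (blk z.1 == j) ==> U z].
  move=> /connectP[s]; elim/last_ind: s j => [|s i IH] j /=.
    by move=> _ ->; apply/forallP => z; apply/implyP => /eqP b; apply: (@Ublk x) => //; rewrite /U connect0.
  rewrite rcons_path last_rcons => /andP[ps /existsP[k /andP[/eqP k1 /eqP k2]]] ->.
  have /forallP/(_ k) := IH _ ps erefl; rewrite k1 eqxx => /= Uk.
  apply/forallP => z; apply/implyP => /eqP b; apply: (@Ublk (p k)); first by rewrite b.
  have st u : connect (step (ext g) p) u k -> connect (step (ext g) p) u (p k).
    by move=> c; apply: connect_trans c _; apply: connect1; rewrite /step /= eqxx orbT.
  by case/orP: Uk => /st h; apply/orP; [left|right].
by move=> z; apply/orP; have /forallP/(_ z) := Q _ (cn (blk z.1)); rewrite eqxx.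
Qed.

Lemma sheet_linked D x : (forall k, (neg k \in D) = (k \notin D)) ->
  (forall k, (ext g k \in D) = (k \in D)) ->
  x \in D -> (forall j, exists i : I, blk i = j) -> sheet g D p ->
  forall j, connect (link p) (blk x.1) j.
Proof.
move=> Dneg gD xD surj /and3P[/forallP pD /fullP c _] j.
have pD' k : (p k \in D) = (k \in D) by apply/eqP.
have [i ij] := surj j.
have [k kD kj] : exists2 k : K, k \in D & blk k.1 = j.
  have [h|h] := boolP ((i, true) \in D); first by exists (i, true).
  by exists (neg (i, true)); rewrite ?Dneg.
rewrite -kj; apply: (connect_closed_step (A := fun z : K => connect (link p) (blk x.1) (blk z.1)) _ _ (c _ _ xD kD)); last exact: connect0.
  move=> z /= cz; have [zD|zD] := boolP (z \in D); first by rewrite rp_in // ext_blk.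
  by rewrite rpE /= (negbTE zD).
move=> z /= cz; have [zD|zD] := boolP (z \in D); last by rewrite rpE /= (negbTE zD).
rewrite rp_in //; apply: connect_trans cz (connect1 _).
by apply/existsP; exists z; rewrite !eqxx.
Qed.

(** If [x] were connected to its negative, the cover would be connected and [chi]
    smaller than 2; so the component of [x] is a sheet. *)
Lemma chi2_sheet x : (forall j, connect (link p) (blk x.1) j) -> chi g p = 2%R ->
  exists D, [/\ x \in D, forall k, (neg k \in D) = (k \notin D),
    forall k, (ext g k \in D) = (k \in D) & sheet g D p].
Proof.
move=> cn chi2; have U := linked_connected cn.
have s := step_sym (ext g) p; set C := connect (step (ext g) p) in U.
(* [x] is not connected to its negative, so the two sheets are disjoint. *)
have nx : ~~ C x (neg x).
  apply/negP => h; suff : (chi g p < 2)%R by rewrite chi2.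
  apply: (chi_lt2 gpos pp (x := x)) => z; case: (U z) => // h'; exact: connect_trans h h'.
pose D := [set z | C x z].
have Dneg k : (neg k \in D) = (k \notin D).
  rewrite !inE; apply/idP/negP => [h1 h2|h].
    by case/negP: nx; apply: connect_trans h1 _; rewrite s; apply: connect_neg.
  by case: (U k) => // /connect_neg; rewrite negK.
have gD k : (ext g k \in D) = (k \in D).
  by rewrite !inE; apply/esym/(same_connect_r s)/connect1; rewrite /step /= eqxx.
have pD k : (p k \in D) = (k \in D).
  by rewrite !inE; apply/esym/(same_connect_r s)/connect1; rewrite /step /= eqxx orbT.
have xD : x \in D by rewrite inE /C connect0.
exists D; split=> //; apply/and3P.
have fl : full D (rp (mem D) (ext g)) (rp (mem D) p).
  apply/fullP => a b aD bD.
  have cab : C a b by move: aD bD; rewrite !inE => xa xb; apply: connect_trans xb; rewrite s.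
  suff /andP[] : (b \in D) && connect (step (rp (mem D) (ext g)) (rp (mem D) p)) a b by [].
  apply: (connect_closed_step (A := fun z => (z \in D) && connect (step (rp (mem D) (ext g)) (rp (mem D) p)) a z) _ _ cab).
  - move=> z /andP[zD az]; rewrite gD zD; apply: connect_trans az (connect1 _).
    by rewrite /step /= (rp_in gD zD) eqxx.
  - move=> z /andP[zD az]; rewrite pD zD; apply: connect_trans az (connect1 _).
    by rewrite /step /= (rp_in pD zD) eqxx orbT.
  by rewrite aD connect0.
split=> //; first by apply/forallP => k; rewrite pD.
rewrite -(chi_planar Dneg gpos pp gD pD (rp_perm_on D _) _ (rp_perm_on D _) _ xD) ?chi2 //.
- by move=> k kD; rewrite rp_in.
- by move=> k kD; rewrite rp_in.
exact/fullP.
Qed.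

End Blocks.

(** ** Conjugation by signs *)

Section Signs.
Variable e : I -> bool.
Definition pe p := delta_eps e ∘ p ∘ delta_eps e.

Lemma delta_epsE k : delta_eps e k = (k.1, k.2 == e k.1).
Proof. by rewrite permE. Qed.

Lemma delta_epsK : involutive (delta_eps e).
Proof. by move=> [k b]; rewrite !delta_epsE /=; case: b; case: (e k). Qed.

Lemma peE p k : pe p k = delta_eps e (p (delta_eps e k)).
Proof. by rewrite !pcompE. Qed.

Lemma peK : involutive pe.
Proof. by move=> p; apply/permP => k; rewrite !peE !delta_epsK. Qed.

Lemma pe1 p k : (pe p k).1 = (p (delta_eps e k)).1.
Proof. by rewrite peE delta_epsE. Qed.

Lemma delta_eps_neg k : delta_eps e (neg k) = neg (delta_eps e k).
Proof. by rewrite !delta_epsE /neg /=; case: (k.2); case: (e k.1). Qed.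

Lemma pe_premap p : premap p -> premap (pe p).
Proof.
move=> /premapP[rp_ np]; apply/premapP; split.
  by move=> k; rewrite !peE delta_eps_neg delta_epsK rp_ delta_eps_neg delta_epsK.
have dV : (delta_eps e)^-1%g = delta_eps e.
  by apply/permP => l; apply: (@perm_inj _ (delta_eps e)); rewrite permKV delta_epsK.
move=> k; rewrite /pe -{2}dV -(delta_epsK k) -delta_eps_neg porbit_conj.
rewrite mem_imset; [exact: np|exact: perm_inj].
Qed.

Lemma pe_link (J : finType) (blk : I -> J) p : link blk (pe p) =2 link blk p.
Proof.
move=> i j; apply/existsP/existsP => -[k /andP[/eqP k1 /eqP k2]].
  by exists (delta_eps e k); rewrite -pe1 k2 delta_epsE /= k1 !eqxx.
by exists (delta_eps e k); rewrite pe1 delta_epsK k2 delta_epsE /= k1 !eqxx.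
Qed.

(** Restriction to the sheet is a bijection from the premaps that preserve it
    onto the permutations of the sheet, with inverse [ext]. *)
Lemma sum_sheet (V : nmodType) (M : {set {perm K}}) (F : {perm K} -> V) g D :
  (forall k, (neg k \in D) = (k \notin D)) -> (forall p, p \in M -> premap p) ->
  (\sum_(p in M | sheet g D (pe p)) F p =
  \sum_(r | [&& perm_on D r, full D (rp (mem D) (ext g)) r & planar (rp (mem D) (ext g)) r]
            && (pe (ext r) \in M)) F (pe (ext r)))%R.
Proof.
move=> Dneg Mp.
rewrite (reindex_onto (fun r => pe (ext r)) (fun p => rp (mem D) (pe p))) /=.
  apply: eq_bigl => r; rewrite peK.
  apply/idP/idP.
    case/andP=> /andP[rM /and3P[rD fl pl]] /eqP e1; rewrite rM andbT.
    by rewrite e1 in fl pl; rewrite fl pl -e1 rp_perm_on.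
  case/andP=> /and3P[rD fl pl] rM; rewrite rM /sheet !(rp_ext Dneg rD) fl pl eqxx !andbT /=.
  by apply/forallP => k; rewrite ext_stable.
move=> p /andP[pM /and3P[/forallP pD _ _]].
have [rpe _] := (premapP _).1 (pe_premap (Mp p pM)).
by rewrite ext_rp ?peK // => k; apply/eqP.
Qed.

End Signs.

End SignedPerm.

Import Order.TTheory GRing.Theory Num.Theory.

(** * Gluing signed permutations *)

Section Glue.
Variables (I J K : {fset nat}).
Hypotheses (JI : (J `<=` I)%fset) (KI : (K `<=` I)%fset) (KE : K = (I `\` J)%fset).
Implicit Types (p f g h : {perm (I * bool)}) (pj fj gj hj : {perm (J * bool)})
  (pk fk gk hk : {perm (K * bool)}).

(** [p] is the product of [pj] and [pk], transported to the larger index set. *)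
Definition glued p pj pk := (forall k, p (sincl JI k) = sincl JI (pj k)) /\
  (forall k, p (sincl KI k) = sincl KI (pk k)).

Lemma notinK (j : J) : val j \notin K.
Proof. by move: (valP j); rewrite KE inE => ->. Qed.

Lemma notinJ (k : K) : val k \notin J.
Proof. by have h : val k \in K := valP k; move: h; move: (val k) => m; rewrite KE inE => /andP[]. Qed.

Lemma glue_case (k : I * bool) : (exists j, k = sincl JI j) \/ (exists j, k = sincl KI j).
Proof.
case: k => k b; have [kJ|kJ] := boolP (val k \in J).
  by left; exists ([` kJ]%fset, b); congr (_, _); apply/val_inj.
have kK : val k \in K by rewrite KE inE kJ (valP k).
by right; exists ([` kK]%fset, b); congr (_, _); apply/val_inj.
Qed.

Lemma glue_disj j k : sincl JI j <> sincl KI k.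
Proof.
move=> /(congr1 (fun z : I * bool => val z.1)) /= e.
by have := notinJ k.1; have := valP j.1; rewrite /= e => ->.
Qed.

Definition glue_fun pj pk (k : I * bool) : I * bool :=
  if [pick j | sincl JI j == k] is Some j then sincl JI (pj j) else
  if [pick j | sincl KI j == k] is Some j then sincl KI (pk j) else k.

Lemma glue_funJ pj pk j : glue_fun pj pk (sincl JI j) = sincl JI (pj j).
Proof.
rewrite /glue_fun; case: pickP => [j' /eqP/sincl_inj -> //|/(_ j)]; by rewrite eqxx.
Qed.

Lemma glue_funK pj pk j : glue_fun pj pk (sincl KI j) = sincl KI (pk j).
Proof.
rewrite /glue_fun; case: pickP => [j' /eqP/glue_disj //|_].
by case: pickP => [j' /eqP/sincl_inj -> //|/(_ j)]; rewrite eqxx.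
Qed.

Lemma glue_inj pj pk : injective (glue_fun pj pk).
Proof.
move=> k l; have [[j ->]|[j ->]] := glue_case k; have [[j' ->]|[j' ->]] := glue_case l;
  rewrite ?glue_funJ ?glue_funK.
- by move=> /sincl_inj /(@perm_inj _ pj) ->.
- by move/glue_disj.
- by move/esym/glue_disj.
by move=> /sincl_inj /(@perm_inj _ pk) ->.
Qed.

Definition glue pj pk : {perm (I * bool)} := perm (@glue_inj pj pk).

Lemma glued_glue pj pk : glued (glue pj pk) pj pk.
Proof. by split=> k; rewrite permE ?glue_funJ ?glue_funK. Qed.

Lemma glued_eq f h pj pk : glued f pj pk -> glued h pj pk -> f = h.
Proof.
move=> [fJ fK] [hJ hK]; apply/permP => k.
by have [[j ->]|[j ->]] := glue_case k; rewrite ?fJ ?hJ ?fK ?hK.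
Qed.

Lemma glued_inj f pj pk hj hk : glued f pj pk -> glued f hj hk -> pj = hj /\ pk = hk.
Proof.
move=> [fJ fK] [hJ hK]; by split; apply/permP => k;
  [apply: (@sincl_inj _ _ JI); rewrite -fJ hJ | apply: (@sincl_inj _ _ KI); rewrite -fK hK].
Qed.

Lemma glued_comp f h fj hj fk hk : glued f fj fk -> glued h hj hk ->
  glued (f ∘ h) (fj ∘ hj) (fk ∘ hk).
Proof. by move=> [fJ fK] [hJ hK]; split=> k; rewrite !pcompE ?hJ ?hK ?fJ ?fK. Qed.

Lemma gluedV f fj fk : glued f fj fk -> glued f^-1%g fj^-1%g fk^-1%g.
Proof.
by move=> [fJ fK]; split=> k; apply: (@perm_inj _ f); rewrite permKV ?fJ ?fK permKV.
Qed.

Lemma glued_delta : glued (delta I) (delta J) (delta K).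
Proof. by split=> k; rewrite !permE. Qed.

Lemma glued_minus f fj fk : glued f fj fk -> glued (minus f) (minus fj) (minus fk).
Proof. by move=> h; do !apply: glued_comp => //; exact: glued_delta. Qed.

Lemma glued_delta_eps e : glued (delta_eps e) (delta_eps (e \o fincl JI)) (delta_eps (e \o fincl KI)).
Proof. by split=> k; rewrite !permE. Qed.

Lemma glued_pe e f fj fk : glued f fj fk ->
  glued (pe e f) (pe (e \o fincl JI) fj) (pe (e \o fincl KI) fk).
Proof. by move=> h; do !apply: glued_comp => //; exact: glued_delta_eps. Qed.

Lemma ncyc_glued f fj fk : glued f fj fk -> ncyc f = (ncyc fj + ncyc fk)%N.
Proof.
move=> [fJ fK]; pose A := sincl JI @: [set: (J * bool)%type].
have inA j : sincl JI j \in A by rewrite imset_f.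
have outA k : sincl KI k \notin A by apply/imsetP => -[j _ /esym/glue_disj].
have fA k : (f k \in A) = (k \in A).
  by have [[j ->]|[j ->]] := glue_case k; rewrite ?fJ ?fK ?inA // !(negbTE (outA _)).
have CA : ~: A = sincl KI @: [set: (K * bool)%type].
  apply/setP => k; rewrite inE; have [[j ->]|[j ->]] := glue_case k.
    by rewrite inA; apply/esym/imsetP => -[l _ /glue_disj].
  by rewrite outA imset_f.
rewrite (ncyc_setC fA) CA.
have gen (M : {fset nat}) (MI : (M `<=` I)%fset) (q : {perm (M * bool)}) :
    (forall k, f (sincl MI k) = sincl MI (q k)) ->
    ncycles (sincl MI @: [set: (M * bool)%type]) f = ncyc q.
  move=> fq; have it i k : (f ^+ i)%g (sincl MI k) = sincl MI ((q ^+ i)%g k).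
    by rewrite !permX; elim: i => //= i ->; rewrite fq.
  have po k : porbit f (sincl MI k) = sincl MI @: porbit q k.
    apply/setP => y; apply/porbitP/imsetP => [[i ->]|[z /porbitP[i ->] ->]].
      by exists ((q ^+ i)%g k); rewrite ?mem_porbit.
    by exists i; rewrite it.
  rewrite /ncycles /ncyc -[RHS](card_imset _ (imset_inj (@sincl_inj _ _ MI))).
  apply: eq_card => B; apply/imsetP/imsetP => [[k /imsetP[l _ ->] ->]|[D /imsetP[k _ ->] ->]].
    by exists (porbit q l); rewrite ?imset_f.
  by exists (sincl MI k); rewrite ?imset_f.
by rewrite (gen _ _ _ fJ) (gen _ _ _ fK).
Qed.

(** All cycle counts and the number of points add up. *)
Lemma chi_glued g gj gk f fj fk : glued g gj gk -> glued f fj fk ->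
  perm_on (posI I) g -> perm_on (posI J) gj -> perm_on (posI K) gk ->
  premap f -> premap fj -> premap fk ->
  chi g f = (chi gj fj + chi gk fk)%R.
Proof.
move=> gg ff gp g1p g2p pf pf1 pf2; rewrite !chiE //.
have ge : glued (ext g) (ext gj) (ext gk).
  by apply: glued_comp => //; apply: gluedV; apply: glued_minus.
have [a1 [a2 a3]] := chi_double g1p pf1; have [b1 [b2 b3]] := chi_double g2p pf2.
have c1 := ncyc_glued ge; have c2 := ncyc_glued ff; have c3 := ncyc_glued (glued_comp ge ff).
have cI : #|` I| = (#|` J| + #|` K|)%N.
  rewrite KE -(cardfsID J I); congr addn; congr (#|` _|).
  by apply/fsetIidPr.
rewrite c1 c2 c3 cI -a1 -a2 -a3 -b1 -b2 -b3 -!doubleD !doubleK.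
by move: _./2 _./2 _./2 _./2 _./2 _./2 #|`J| #|`K| => *; clear; lia.
Qed.

Lemma act_signed_in (M : {fset nat}) (q : {perm (M * bool)}) (k : M * bool) :
  act_signed q (val k.1, k.2) = (val (q k).1, (q k).2).
Proof. by rewrite /act_signed /= valK; case: k. Qed.

Lemma act_signed_out (M : {fset nat}) (q : {perm (M * bool)}) x : x.1 \notin M -> act_signed q x = x.
Proof. by move=> xM; rewrite /act_signed insubN. Qed.

(** This matches the form in which condition (G) states the factorization, on all
    signed integers. *)
Lemma glued_act f fj fk : glued f fj fk <->
  act_signed f =1 act_signed fj \o act_signed fk.
Proof.
have ev (M : {fset nat}) (MI : (M `<=` I)%fset) (k : M * bool) :
  (val k.1, k.2) = (val (sincl MI k).1, (sincl MI k).2) by [].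
split=> [[fJ fK] [m b]|h].
  rewrite /=; have [mI|mI] := boolP (m \in I); last first.
    rewrite !act_signed_out //= ?act_signed_out //=.
    1,3: by apply: contra mI; apply: (fsubsetP KI).
    by apply: contra mI; apply: (fsubsetP JI).
  have e : (m, b) = (val ([` mI]%fset, b).1, ([` mI]%fset, b).2) by [].
  rewrite e; have [[j ->]|[j ->]] := glue_case ([` mI]%fset, b).
    rewrite (act_signed_in f) fJ (@act_signed_out K) ?notinK //.
    exact/esym/(act_signed_in fj j).
  rewrite (act_signed_in f) fK.
  have -> := act_signed_in fk j; rewrite act_signed_out //=; exact: notinJ.
have pE (x y : I * bool) : (val x.1, x.2) = (val y.1, y.2) -> x = y.
  by case: x y => [x b] [y c] /= [/val_inj -> ->].
split=> k; apply: pE; rewrite -(act_signed_in f) h [LHS]/=.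
  by rewrite (@act_signed_out K) ?notinK // (act_signed_in fj k).
have -> := act_signed_in fk k; rewrite act_signed_out //=; exact: notinJ.
Qed.

Lemma induced_glued f fj fk : glued f fj fk -> Defs.induced JI f = fj /\ Defs.induced KI f = fk.
Proof.
have gen (M : {fset nat}) (MI : (M `<=` I)%fset) (q : {perm (M * bool)}) :
    (forall k, f (sincl MI k) = sincl MI (q k)) -> Defs.induced MI f = q.
  move=> fq; apply/permP => k; rewrite permE; apply: (@sincl_inj _ _ MI).
  by rewrite sincl_induced first_return1 ?fq // inE codom_f.
by case=> fJ fK; split; apply: gen.
Qed.

Lemma glued_link (B : finType) (blk : nat -> B) f fj fk : glued f fj fk ->
  forall i j, link (fun k : I => blk (val k)) f i j =
    link (fun k : J => blk (val k)) fj i j || link (fun k : K => blk (val k)) fk i j.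
Proof.
move=> [fJ fK] i j; apply/existsP/orP => [[k]|[]/existsP[k]].
- have [[l ->]|[l ->]] := glue_case k; rewrite ?fJ ?fK => h; [left|right]; by apply/existsP; exists l.
- by move=> h; exists (sincl JI k); rewrite fJ.
by move=> h; exists (sincl KI k); rewrite fK.
Qed.

Lemma glued_connects f fj fk : glued f fj fk -> ~~ connects J f.
Proof.
move=> [fJ fK]; apply/existsP => -[k /existsP[l /and3P[lk kJ lJ]]].
have [[j kj]|[j kj]] := glue_case k; last first.
  by move: kJ; rewrite kj /= (negbTE (notinJ _)).
have := porbit_closed (A := mem (sincl JI @: [set: (J * bool)%type])) _ lk.
case/(_ _ _)/imsetP; first by move=> z /imsetP[i _ ->]; rewrite /= fJ imset_f.
  by rewrite kj /= imset_f.
by move=> i _ li; move: lJ; rewrite li /= (valP i.1).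
Qed.

End Glue.

(** * Several cyclic words *)

Section System.
Variables (r : nat) (c : 'I_r -> seq nat) (blk : nat -> 'I_r).
Hypotheses (c_uniq : forall i, uniq (c i)) (c_n0 : forall i, c i != [::])
  (c_pos : forall i, 0 \notin c i) (c_blk : forall i k, k \in c i -> blk k = i).
Implicit Types S B : {set 'I_r}.

(** The letter after [k] in its word; the words are lists of distinct positions
    and [blk] tells in which word a position lies. *)
Definition nx k := next (c (blk k)) k.

Definition dom S : {fset nat} := [fset k in flatten [seq c i | i <- enum S]]%fset.

Lemma mem_dom S k : (k \in dom S) = (k \in c (blk k)) && (blk k \in S).
Proof.
rewrite inE /=; apply/flattenP/andP => [[s /mapP[i iS ->] ki]|[kc bS]].
  by rewrite (c_blk ki) ki -mem_enum.
by exists (c (blk k)) => //; apply: map_f; rewrite mem_enum.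
Qed.

Lemma dom_posset S : posset (dom S).
Proof. by rewrite /posset mem_dom (negbTE (c_pos _)). Qed.

Lemma nx_in k : k \in c (blk k) -> nx k \in c (blk k).
Proof. by rewrite /nx mem_next. Qed.

Lemma blk_nx k : k \in c (blk k) -> blk (nx k) = blk k.
Proof. by move=> /nx_in /c_blk. Qed.

Lemma dom_nx S k : k \in dom S -> nx k \in dom S.
Proof. by rewrite !mem_dom => /andP[kc kS]; rewrite blk_nx // nx_in. Qed.

Lemma nx_inj S : {in dom S &, injective nx}.
Proof.
move=> k l; rewrite !mem_dom => /andP[kc _] /andP[lc _] e.
have b : blk k = blk l by rewrite -(blk_nx kc) e blk_nx.
by apply: (can_inj (prev_next (c_uniq (blk k)))); move: e; rewrite /nx b.
Qed.

Definition gam_fun S (k : dom S * bool) : dom S * bool :=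
  if k.2 then (insubd k.1 (nx (val k.1)), true) else k.

Lemma gam_fun1 S (k : dom S * bool) : val (gam_fun k).1 = if k.2 then nx (val k.1) else val k.1.
Proof. by rewrite /gam_fun; case: ifP => //= _; rewrite insubdK //; apply: dom_nx; apply: valP. Qed.

Lemma gam_fun2 S (k : dom S * bool) : (gam_fun k).2 = k.2.
Proof. by case: k => k []. Qed.

Lemma gam_inj S : injective (@gam_fun S).
Proof.
move=> k l e; have e2 : k.2 = l.2 by rewrite -gam_fun2 e gam_fun2.
have := congr1 (fun z : dom S * bool => val z.1) e; rewrite !gam_fun1 -e2 => e1.
rewrite (surjective_pairing k) (surjective_pairing l) -e2; congr (_, _).
apply/val_inj; move: e1; case: ifP => // _; apply: (@nx_inj S); exact: valP.
Qed.

(** The permutation with one cycle for each word indexed by [S]. *)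
Definition gam S : {perm (dom S * bool)} := perm (@gam_inj S).

Lemma gam1 S k : val (gam S k).1 = if k.2 then nx (val k.1) else val k.1.
Proof. by rewrite permE gam_fun1. Qed.

Lemma gam2 S k : (gam S k).2 = k.2.
Proof. by rewrite permE gam_fun2. Qed.

Lemma gam_pos S : perm_on (posI (dom S)) (gam S).
Proof.
apply/fintype.subsetP => k; rewrite -topredE /= inE; apply: contraR => /negbTE k2.
by apply/eqP; rewrite permE /gam_fun k2.
Qed.

Definition word_of S (k : dom S) : 'I_r := blk (val k).

Lemma bl_in S (k : dom S) : word_of k \in S.
Proof. by have := valP k; rewrite mem_dom => /andP[]. Qed.

Lemma bl_c S (k : dom S) : val k \in c (word_of k).
Proof. by have := valP k; rewrite mem_dom => /andP[]. Qed.

Lemma bl_surj S i : i \in S -> exists k : dom S, word_of k = i.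
Proof.
move=> iS; case E : (c i) (c_n0 i) => [//|k s] _.
have ki : k \in c i by rewrite E mem_head.
have kd : k \in dom S by rewrite mem_dom (c_blk ki) ki.
by exists [` kd]%fset; rewrite /word_of (c_blk ki).
Qed.

Lemma gam_blk S k : word_of (gam S k).1 = word_of k.1.
Proof. by rewrite /word_of gam1; case: ifP => // _; rewrite blk_nx //; apply: bl_c. Qed.

Definition pts_of S i : seq (dom S * bool) := signed_pts true (pmap insub (c i)).

Lemma val_pts S i : i \in S -> [seq val k.1 | k <- pts_of S i] = c i.
Proof.
move=> iS; rewrite /pts_of /signed_pts -map_comp -[LHS]/(map val _) pmap_filter; last exact: insubK.
by apply/all_filterP/allP => k kc; rewrite insubT // mem_dom (c_blk kc) kc.
Qed.

Lemma mem_pts S i k : i \in S -> (k \in pts_of S i) = k.2 && (word_of k.1 == i).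
Proof.
move=> iS; apply/mapP/andP => [[l + ->]|[k2 /eqP b]].
  rewrite mem_pmap_sub /= => lc; split=> //; by rewrite /word_of (c_blk lc).
by exists k.1; [rewrite mem_pmap_sub /= -b bl_c | rewrite -k2 -surjective_pairing].
Qed.

Lemma word_pts_uniq S i : uniq (pts_of S i).
Proof. by rewrite map_inj_uniq ?pmap_sub_uniq // => x y []. Qed.

Lemma pts_cycle S i : i \in S -> fcycle (gam S) (pts_of S i).
Proof.
move=> iS; have u := word_pts_uniq S i; apply: (cycle_from_next u) => k kp.
apply/eqP; move: (kp); rewrite (mem_pts _ iS) => /andP[k2 /eqP b].
have inj : {in pts_of S i &, injective (fun k : dom S * bool => val k.1)}.
  move=> x y; rewrite !(mem_pts _ iS) => /andP[x2 _] /andP[y2 _].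
  by move: x y x2 y2 => [x []] [y []] //= _ _ /val_inj ->.
apply: inj; rewrite ?mem_next //.
  by rewrite (mem_pts _ iS) gam2 gam_blk k2 b eqxx.
rewrite gam1 k2 /nx -/(word_of k.1) b -(val_pts iS).
have inj' : injective (fun k : dom S => (k, true)) by move=> x y [].
rewrite /pts_of /signed_pts -map_comp.
have -> : k = (k.1, true) by rewrite [LHS]surjective_pairing k2.
by rewrite (next_map inj') ?pmap_sub_uniq // (next_map val_inj) ?pmap_sub_uniq.
Qed.

Lemma gam_cyc S (k l : dom S * bool) : word_of k.1 = word_of l.1 -> k.2 -> l.2 -> l \in porbit (gam S) k.
Proof.
move=> b k2 l2; have iS := bl_in k.1.
by rewrite (porbit_fcycle _ (pts_cycle iS)) ?mem_pts ?k2 ?l2 -?b ?eqxx.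
Qed.

Lemma ncycles_gam S : ncycles (posI (dom S)) (gam S) = #|S|.
Proof.
rewrite /ncycles; pose f (A : {set dom S * bool}) := [set word_of k.1 | k in A].
have fE k : f (porbit (gam S) k) = [set word_of k.1].
  apply/setP => i; rewrite inE; apply/imsetP/eqP => [[l]|->]; last by exists k; rewrite ?mem_porbit1 ?porbit_id.
  move=> lk ->.
  have := porbit_closed (A := fun l => word_of l.1 == word_of k.1) _ lk.
  by move=> /(_ _ _)/eqP; apply => // z; rewrite gam_blk.
rewrite -(card_in_imset (f := f)); last first.
  move=> A B /imsetP[k + ->] /imsetP[l + ->]; rewrite !inE !fE => k2 l2 /set1_inj b.
  by apply/eqP; rewrite eq_porbit_mem gam_cyc.
rewrite -[RHS](card_imset _ (@finset.set1_inj _)); apply: eq_card => A.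
apply/imsetP/imsetP => [[B /imsetP[k _ ->] ->]|[i iS ->]].
  by exists (word_of k.1); rewrite ?bl_in ?fE.
have [k <-] := bl_surj iS; exists (porbit (gam S) (k, true)); last by rewrite fE.
by rewrite imset_f // inE.
Qed.

(** A part of the words and the remaining words glue to all of them. *)
Lemma glued_gam S B : B \subset S ->
  forall (JI : (dom B `<=` dom S)%fset) (KI : (dom (S :\: B) `<=` dom S)%fset),
  glued JI KI (gam S) (gam B) (gam (S :\: B)).
Proof.
have pE (x y : dom S * bool) : val x.1 = val y.1 -> x.2 = y.2 -> x = y.
  by case: x y => [x b] [y d] /= /val_inj -> ->.
by move=> BS JI KI; split=> k; apply: pE; rewrite ?gam1 ?gam2 //= ?gam1 ?gam2.
Qed.

Lemma dom_sub S B : B \subset S -> (dom B `<=` dom S)%fset.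
Proof.
move=> /fintype.subsetP BS; apply/fsubsetP => k; rewrite !mem_dom => /andP[-> /BS ->] //.
Qed.

Lemma dom_diff S B : dom (S :\: B) = (dom S `\` dom B)%fset.
Proof.
apply/fsetP => k; rewrite in_fsetD !mem_dom !finset.in_setD.
by case: (k \in _) => //=; rewrite ?andbF.
Qed.

Section Traces.
Context (R : realType) (n : nat).
Local Notation C := R[i].
Local Open Scope ring_scope.

Lemma ntr_cyclic (A B : 'M[C]_n.+1) : ntr (A * B) = ntr (B * A).
Proof. by rewrite /ntr [\tr (A * B)]mxtrace_mulC. Qed.

Lemma ntr_rot (K : Type) (F : K -> 'M[C]_n.+1) (s : seq K) j :
  ntr (\prod_(k <- rot j s) F k) = ntr (\prod_(k <- s) F k).
Proof. by rewrite /rot big_cat ntr_cyclic -big_cat cat_take_drop. Qed.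

(** The cycles of [gam S] are the words, and the choice of a root of each cycle
    does not matter because the trace is cyclic. *)
Lemma tr_gam S (z : nat -> 'M[C]_n.+1) :
  tr_perm (posI (dom S)) (gam S) (fun k => z (val k)) =
  \prod_(i in S) ntr (\prod_(k <- c i) z k).
Proof.
rewrite /tr_perm (partition_big (fun k => word_of k.1) (mem S)) /=; last by move=> k _; apply: bl_in.
apply: eq_bigr => i iS; have [k0 k0i] := bl_surj iS.
have cy := pts_cycle iS; pose x0 : dom S * bool := (k0, true).
have x0p : x0 \in pts_of S i by rewrite mem_pts //= k0i eqxx.
have s := fconnect_sym (@perm_inj _ (gam S)).
have rp_ : froot (gam S) x0 \in pts_of S i.
  by rewrite -(fconnect_cycle cy x0p) connect_root.
rewrite (big_pred1 (froot (gam S) x0)) => [|k]; last first.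
  rewrite inE -andbA andbCA -(mem_pts _ iS) /=.
  apply/andP/eqP => [[/eqP rk kp]|->]; last by rewrite rp_ roots_root.
  by rewrite -rk; apply/eqP; rewrite root_connect // s (fconnect_cycle cy x0p).
have [j ->] := orbit_rot_cycle cy (word_pts_uniq S i) rp_.
rewrite ntr_rot -(val_pts iS) [in RHS]big_map; congr ntr.
by apply: eq_big_seq => k; rewrite (mem_pts _ iS) => /andP[k2 _]; rewrite k2.
Qed.

End Traces.

End System.

Import numFieldNormedType.Exports.
Local Open Scope ring_scope.

(** * Expectations and classical cumulants *)

Section Expectation.
Context (R : realType) (d : measure_display) (T : measurableType d)
  (P : probability T R).
Local Notation C := R[i].
Implicit Types (f g : T -> C).

Lemma eq_cE f g : f =1 g -> cE P f = cE P g.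
Proof. by move=> /funext ->. Qed.

Lemma eq_cintegrable f g : f =1 g -> cintegrable P f -> cintegrable P g.
Proof. by move=> /funext ->. Qed.

Local Notation rint u := (P.-integrable setT (fun w => (u w)%:E)).

Lemma rint_lin (a b : R) (u v w : T -> R) : rint u -> rint v -> rint w ->
  rint (fun t => a * u t + b * v t + w t).
Proof.
move=> iu iv iw.
have h := integrableD measurableT (integrableD measurableT
  (integrableZl measurableT a iu) (integrableZl measurableT b iv)) iw.
by apply: eq_integrable h => // t _; rewrite /= !EFinD !EFinM.
Qed.

Lemma fine_lin (a b : R) (u v w : T -> R) : rint u -> rint v -> rint w ->
  fine ('E_P[fun t => a * u t + b * v t + w t]) =
  a * fine ('E_P[u]) + b * fine ('E_P[v]) + fine ('E_P[w]).
Proof.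
move=> iu iv iw; rewrite !unlock.
have iau := integrableZl measurableT a iu; have ibv := integrableZl measurableT b iv.
have e : (\int[P]_t (a * u t + b * v t + w t)%R%:E =
   \int[P]_t (a%:E * (u t)%:E + b%:E * (v t)%:E + (w t)%:E))%E.
  by apply: eq_integral => t _; rewrite !EFinD !EFinM.
rewrite e integralD //; last exact: integrableD.
rewrite integralD // !integralZl //.
have fu := integrable_fin_num measurableT iu.
have fv := integrable_fin_num measurableT iv.
have fw := integrable_fin_num measurableT iw.
by rewrite -(fineK fu) -(fineK fv) -(fineK fw) -!EFinM -!EFinD.
Qed.

Lemma ReML (a z : C) : complex.Re (a * z) = complex.Re a * complex.Re z - complex.Im a * complex.Im z.
Proof. by case: a; case: z. Qed.
Lemma ImML (a z : C) : complex.Im (a * z) = complex.Re a * complex.Im z + complex.Im a * complex.Re z.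
Proof. by case: a => a b; case: z => x y /=. Qed.
Lemma ReDL (a z : C) : complex.Re (a + z) = complex.Re a + complex.Re z.
Proof. by case: a; case: z. Qed.
Lemma ImDL (a z : C) : complex.Im (a + z) = complex.Im a + complex.Im z.
Proof. by case: a; case: z. Qed.

Lemma cint_lin c f g : cintegrable P f -> cintegrable P g ->
  cintegrable P (fun w => c * f w + g w).
Proof.
move=> [f1 f2] [g1 g2]; split.
  have := rint_lin (complex.Re c) (- complex.Im c) f1 f2 g1.
  by congr (P.-integrable _ _); apply/funext => w; rewrite ReDL ReML mulNr.
have := rint_lin (complex.Re c) (complex.Im c) f2 f1 g2.
by congr (P.-integrable _ _); apply/funext => w; rewrite ImDL ImML.
Qed.

Lemma cE_lin c f g : cintegrable P f -> cintegrable P g ->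
  cE P (fun w => c * f w + g w) = c * cE P f + cE P g.
Proof.
move=> [f1 f2] [g1 g2]; apply/eqP; rewrite eq_complex; apply/andP; split; apply/eqP.
  rewrite ReDL ReML /= -mulNr -(fine_lin (complex.Re c) (- complex.Im c) f1 f2 g1).
  by congr (fine ('E_P[_])); apply/funext => w; rewrite ReDL ReML mulNr.
rewrite ImDL ImML /= -(fine_lin (complex.Re c) (complex.Im c) f2 f1 g2).
by congr (fine ('E_P[_])); apply/funext => w; rewrite ImDL ImML.
Qed.

Lemma cint_cst c : cintegrable P (fun=> c).
Proof.
by split; apply: (@finite_measure_integrable_cst _ _ _ P).
Qed.

Lemma cE_cst c : cE P (fun=> c) = c.
Proof.
by rewrite /cE (expectation_cst P (complex.Re c)) (expectation_cst P (complex.Im c)); case: c.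
Qed.

Lemma cint_sum (J : Type) (r : seq J) (c : J -> C) (f : J -> T -> C) :
  (forall j, cintegrable P (f j)) -> cintegrable P (fun w => \sum_(j <- r) c j * f j w).
Proof.
move=> h; elim: r => [|j r IH].
  by apply: (eq_cintegrable _ (cint_cst 0)) => w; rewrite big_nil.
by apply: (eq_cintegrable _ (cint_lin (c j) (h j) IH)) => w; rewrite big_cons.
Qed.

End Expectation.

Section Cumulants.
Context (R : realType) (d : measure_display) (T : measurableType d)
  (P : probability T R) (I : finType).
Local Notation C := R[i].
Implicit Types (Z : I -> T -> C) (S B : {set I}).

Definition moment Z S : C := cE P (fun w => \prod_(i in S) Z i w).

Lemma moment0 Z : moment Z finset.set0 = 1.
Proof. by rewrite /moment -[RHS](cE_cst P); apply: eq_cE => w; rewrite big_set0. Qed.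

Lemma moment_partitions Z S : moment Z S =
  \sum_(Q : {set {set I}} | finset.partition Q S) \prod_(B in Q) cumulant_on P Z B.
Proof.
have [->|S0] := eqVneq S finset.set0.
  rewrite moment0 (big_pred1 finset.set0) ?big_set0 // => Q.
  by rewrite partition_set0.
by apply: moment_cumulant; rewrite card_gt0.
Qed.

(** The moment-cumulant formula summed by the block containing [i0]. *)
Lemma moment_recursion Z S i0 : i0 \in S ->
  moment Z S = \sum_(B : {set I} | (i0 \in B) && (B \subset S))
     cumulant_on P Z B * moment Z (S :\: B).
Proof.
move=> i0S; rewrite moment_partitions.
rewrite (partition_big (fun Q => finset.pblock Q i0) (fun B => (i0 \in B) && (B \subset S))) /=; last first.
  move=> Q pQ; have iQ : i0 \in finset.cover Q by rewrite (cover_partition pQ).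
  by rewrite mem_pblock iQ (partitionS pQ) // finset.pblock_mem.
apply: eq_bigr => B /andP[iB BS]; rewrite moment_partitions mulr_sumr.
rewrite (reindex_onto (fun Q => B |: Q) (fun Q => Q :\ B)) /=; last first.
  move=> Q /andP[pQ /eqP <-]; apply: finset.setD1K; apply: finset.pblock_mem.
  by rewrite (cover_partition pQ).
have B0 : B != finset.set0 by apply/finset.set0Pn; exists i0.
apply: eq_big => Q.
  apply/idP/idP.
    case/andP=> /andP[pQ pb] /eqP e; rewrite -e.
    by apply: partitionD1 => //; rewrite !inE eqxx.
  move=> pQ; have pBQ : finset.partition (B |: Q) S.
    have -> : S = B :|: (S :\: B) by apply/finset.setP => z; rewrite !inE; case: (boolP (z \in B)) => //= /(fintype.subsetP BS) ->.
    apply: partitionU1 => //; rewrite -finset.setI_eq0; apply/eqP/finset.setP => z; rewrite !inE.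
    by case: (z \in B).
  rewrite pBQ; apply/andP; split.
    by apply/eqP; apply: (def_pblock (partition_trivIset pBQ)); rewrite ?inE ?eqxx.
  rewrite finset.setU1K //; apply/negP => /(partitionS pQ) /fintype.subsetP/(_ _ iB).
  by rewrite !inE iB.
case/andP=> _ /eqP e; rewrite big_setU1 //.
by rewrite -e !inE eqxx.
Qed.

Lemma moment_recursion_top Z S j : j \in S ->
  moment Z S = cumulant_on P Z S +
  \sum_(B : {set I} | [&& j \in B & B \subset S] && (B != S)) cumulant_on P Z B * moment Z (S :\: B).
Proof.
move=> jS; rewrite (moment_recursion _ jS) (bigD1 S) ?jS //=.
by rewrite finset.setDv moment0 mulr1.
Qed.

(** Solving the recursion for its top term, with [B = S], shows that the moments
    determine the cumulants.  The point [i0 S] through which the recursion is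
    taken may depend on [S]. *)
Lemma cumulant_unique Z (k : {set I} -> C) (i0 : {set I} -> I) :
  (forall S, S != finset.set0 -> i0 S \in S) ->
  (forall S, S != finset.set0 -> moment Z S =
     \sum_(B : {set I} | (i0 S \in B) && (B \subset S)) k B * moment Z (S :\: B)) ->
  forall S, S != finset.set0 -> cumulant_on P Z S = k S.
Proof.
move=> iS rec S; have [n] := ubnP #|S|; elim: n S => // n IH S Sn S0.
have := rec S S0; rewrite (moment_recursion _ (iS S S0)).
rewrite (bigD1 S) ?iS //= [RHS](bigD1 S) ?iS //= finset.setDv moment0 !mulr1.
move=> e.
suff h : \sum_(B : {set I} | [&& i0 S \in B, B \subset S & B != S]) cumulant_on P Z B * moment Z (S :\: B) =
   \sum_(B : {set I} | [&& i0 S \in B, B \subset S & B != S]) k B * moment Z (S :\: B).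
  move: e; under eq_bigl do rewrite -andbA; under [X in _ = _ + X]eq_bigl do rewrite -andbA.
  by rewrite h => /addIr.
apply: eq_bigr => B /and3P[iB BS nB]; congr (_ * _); apply: IH.
  rewrite ltnS in Sn; apply: leq_trans Sn; apply: proper_card.
  by rewrite finset.properEneq nB.
by apply/finset.set0Pn; exists (i0 S).
Qed.

Lemma eq_moment Z Z' S : (forall i, i \in S -> Z i =1 Z' i) -> moment Z S = moment Z' S.
Proof. by move=> h; apply: eq_cE => w; apply: eq_bigr => i /h ->. Qed.

Lemma eq_cumulant Z Z' S : (forall i, i \in S -> Z i =1 Z' i) ->
  cumulant_on P Z S = cumulant_on P Z' S.
Proof.
rewrite /cumulant_on; move: #|S| => m; elim: m S => //= m IH S h; congr (_ - _).
  exact: (@eq_moment Z Z' S).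
apply: eq_bigr => Q /andP[pQ _]; apply: eq_bigr => B BQ; apply: IH => i iB.
by apply: h; apply: (fintype.subsetP (partitionS pQ BQ)).
Qed.

(** A constant factors out of all moments, so in the recursion through [j] the
    block consisting of [j] alone already accounts for the moment; by induction
    all other blocks contribute 0. *)
Lemma cumulant_cst Z S j c : j \in S -> (1 < #|S|)%N -> (forall w, Z j w = c) ->
  (forall B, cintegrable P (fun w => \prod_(i in B) Z i w)) -> cumulant_on P Z S = 0.
Proof.
move=> jS S1 Zc int; have [n] := ubnP #|S|; elim: n S jS S1 => // n IH S jS S1 Sn.
have c1 : cumulant_on P Z [set j] = c.
  have := moment_recursion Z (set11 j); rewrite (big_pred1 [set j]); last first.
    move=> B /=; apply/andP/eqP => [[jB Bj]|->]; last by rewrite set11.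
    by apply/eqP; rewrite finset.eqEsubset Bj finset.sub1set.
  rewrite finset.setDv moment0 mulr1 => <-.
  by rewrite /moment -[RHS](cE_cst P); apply: eq_cE => w; rewrite big_set1 Zc.
have eS : moment Z S = c * moment Z (S :\ j).
  rewrite -[RHS]addr0 -[X in _ + X](cE_cst P 0) -cE_lin //; last exact: cint_cst.
  by apply: eq_cE => w; rewrite addr0 (big_setD1 j) //= Zc.
have := moment_recursion Z jS; rewrite (bigD1 S) ?jS //= (bigD1 [set j]) /=; last first.
  rewrite set11 finset.sub1set jS /=; apply: contraTneq S1 => <-; by rewrite cards1.
rewrite finset.setDv moment0 mulr1 c1 eS big1 ?addr0.
  by rewrite addrC -[LHS]addr0 => /addrI.
move=> B /andP[/andP[/andP[jB BS] nB] nj]; rewrite IH ?mul0r //.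
  rewrite ltn_neqAle eq_sym; apply/andP; split; last by rewrite card_gt0; apply/finset.set0Pn; exists j.
  by apply: contra nj => /cards1P[x e]; move: jB; rewrite e !inE => /eqP ->.
rewrite ltnS in Sn; apply: leq_trans Sn; apply: proper_card.
by rewrite finset.properEneq nB.
Qed.

(** In the recursion through [j] the variable number [j] occurs in the cumulant
    only, so linearity of the moments is inherited. *)
Lemma cumulant_lin Z Za Zb S j c : j \in S ->
  (forall i, i != j -> Z i =1 Za i) -> (forall i, i != j -> Z i =1 Zb i) ->
  (forall w, Z j w = c * Za j w + Zb j w) ->
  (forall B, cintegrable P (fun w => \prod_(i in B) Za i w)) ->
  (forall B, cintegrable P (fun w => \prod_(i in B) Zb i w)) ->
  cumulant_on P Z S = c * cumulant_on P Za S + cumulant_on P Zb S.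
Proof.
move=> jS ea eb el inta intb; have [n] := ubnP #|S|; elim: n S jS => // n IH S jS Sn.
have out Z' B : (forall i, i != j -> Z i =1 Z' i) -> j \notin B -> moment Z B = moment Z' B.
  by move=> e jB; apply: eq_moment => i iB; apply: e; apply: contraNneq jB => <-.
have eS : moment Z S = c * moment Za S + moment Zb S.
  rewrite -cE_lin //; apply: eq_cE => w; rewrite !(big_setD1 j jS) /= el mulrDl mulrA.
  congr (_ + _); congr (_ * _); apply: eq_bigr => i; rewrite !inE => /andP[nj _].
    by rewrite ea.
  by rewrite eb.
move: eS; rewrite (moment_recursion_top Z jS) (moment_recursion_top Za jS) (moment_recursion_top Zb jS).
have -> : \sum_(B : {set I} | [&& j \in B & B \subset S] && (B != S)) cumulant_on P Z B * moment Z (S :\: B) =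
  c * \sum_(B : {set I} | [&& j \in B & B \subset S] && (B != S)) cumulant_on P Za B * moment Za (S :\: B) +
  \sum_(B : {set I} | [&& j \in B & B \subset S] && (B != S)) cumulant_on P Zb B * moment Zb (S :\: B).
  rewrite mulr_sumr -big_split /=; apply: eq_bigr => B /andP[/andP[jB BS] nB].
  have jSB : j \notin S :\: B by rewrite !inE jB.
  rewrite (IH B) //; last first.
    by rewrite ltnS in Sn; apply: leq_trans Sn; apply: proper_card; rewrite finset.properEneq nB.
  by rewrite -(out Za) // -(out Zb) // mulrDl mulrA.
by rewrite mulrDr addrACA => /addIr.
Qed.

End Cumulants.

Local Open Scope classical_set_scope.
Local Open Scope ring_scope.

Lemma connect_inv (K : finType) (e : rel K) (A : pred K) x y :
  (forall u v, A u -> e u v -> A v) -> connect e x y -> A x -> A y.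
Proof.
move=> h /connectP[s + ->]; elim: s x => //= z s IH x /andP[xz zs] Ax.
exact: (IH z zs (h _ _ Ax xz)).
Qed.

(** * Condition (G) and the cumulants of traces of words *)

Section LinkSym.
Variables (I : {fset nat}) (B : finType) (bk : I -> B).

(** A premap sends [neg (p k)] to [neg k], over the same numbers. *)
Lemma link_sym p : premap p -> connect_sym (link bk p).
Proof.
move=> /premapP[rp_ _].
have s : symmetric (link bk p).
  suff h i j : link bk p i j -> link bk p j i by move=> i j; apply/idP/idP; apply: h.
  move=> /existsP[k /andP[/eqP k1 /eqP k2]]; apply/existsP; exists (neg (p k)).
  by rewrite rp_ /neg /= k1 k2 !eqxx.
exact: sym_connect_sym.
Qed.

End LinkSym.

Section Condition.
Context (R : realType) (L : choiceType) (d : nat -> measure_display)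
  (T : forall n, measurableType (d n)) (P : forall n, probability (T n) R).
Local Notation C := R[i].
Variable X : forall n, L -> T n -> 'M[C]_n.+1.
Variable PMc : forall I : {fset nat}, {set {perm (I * bool)}}.
Variable fc : nat -> forall I : {fset nat}, (I -> L) -> {perm (I * bool)} -> C.
Hypothesis HG : condition_G P X PMc fc.

(** The factorization of [PM_c] as a gluing.  The complement [K] is a variable of
    its own because for the systems of words below it is only provably equal to
    the difference. *)
Lemma factor (I J K : {fset nat}) (JI : (J `<=` I)%fset) (KI : (K `<=` I)%fset) p :
  K = (I `\` J)%fset -> posset I ->
  (p \in PMc I /\ ~~ connects J p) <->
  exists p1 p2, [/\ p1 \in PMc J, p2 \in PMc K & glued JI KI p p1 p2].
Proof.
move=> KE Ipos; move: KI; rewrite KE => KI; apply: (iff_trans (G_factor HG p Ipos JI)).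
by split=> -[p1 [p2 [h1 h2 h3]]]; exists p1, p2; split=> //; apply/(glued_act JI KI erefl).
Qed.

Lemma fc_mul n (I J K : {fset nat}) (JI : (J `<=` I)%fset) (KI : (K `<=` I)%fset) l p p1 p2 :
  K = (I `\` J)%fset -> posset I -> p \in PMc I -> glued JI KI p p1 p2 ->
  fc n l p = fc n (l \o fincl JI) p1 * fc n (l \o fincl KI) p2.
Proof.
move=> KE; move: KI p2; rewrite KE => KI p2 Ipos pM gp.
rewrite (G_multiplicative HG n JI l Ipos pM (glued_connects erefl gp)).
rewrite (bool_irrelevance (fsubsetDl I J) KI).
by have [-> ->] := induced_glued gp.
Qed.

(** Constant matrices generate the trivial sigma-algebra, so they are
    independent of everything and can be used in condition (G). *)
Lemma sigma_cst n (K : Type) (M : K -> 'M[C]_n.+1) (B : set (T n)) :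
  sigma_entries (fun k _ => M k) B -> B = set0 \/ B = setT.
Proof.
apply: (smallest_sub (X := [set B | B = set0 \/ B = setT])).
  split; first by left.
    by move=> A [->|->]; rewrite ?setD0 ?setDT; [right|left].
  move=> F FA; have [[i Fi]|h] := pselect (exists i, F i = setT).
    by right; apply/seteqP; split=> // x _; exists i; rewrite ?Fi.
  left; apply/seteqP; split=> // x [i _]; case: (FA i) => [-> //|Fi].
  by case: h; exists i.
move=> A [k [i [j [D _ [->|->]]]]].
  have [h|h] := pselect (D (complex.Re (M k i j))); [right|left]; apply/seteqP; split=> //.
have [h|h] := pselect (D (complex.Im (M k i j))); [right|left]; apply/seteqP; split=> //.
Qed.

Lemma independent_cst n (K : Type) (M : K -> 'M[C]_n.+1) :
  independent_families (P n) (@X n) (fun k _ => M k).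
Proof.
move=> A B _ /sigma_cst[->|->]; first by rewrite setI0 measure0 mule0.
by rewrite setIT probability_setT mule1.
Qed.

Lemma ntr1 n : ntr (1 : 'M[C]_n.+1) = 1.
Proof. by rewrite /ntr mxtrace1 divff // pnatr_eq0. Qed.

Lemma tr_perm1 n (I : {fset nat}) D (p : {perm (I * bool)}) :
  tr_perm D p (fun _ => 1%:M : 'M[C]_n.+1) = 1.
Proof.
rewrite /tr_perm big1 // => k _; rewrite big1 ?ntr1 // => j _.
by rewrite /mxsgn; case: ifP => // _; rewrite trmx1.
Qed.

Definition Tr_word n (s : seq (L * bool)) (w : T n) : C :=
  \tr (\prod_(x <- s) mxsgn x.2 (X x.1 w)).

Lemma ntrE n (A : 'M[C]_n.+1) : \tr A = n.+1%:R * ntr A.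
Proof. by rewrite /ntr mulrC divfK // pnatr_eq0. Qed.

Section Words.
Variables (r : nat) (c : 'I_r -> seq nat) (blk : nat -> 'I_r).
Hypotheses (c_uniq : forall i, uniq (c i)) (c_n0 : forall i, c i != [::])
  (c_pos : forall i, 0%N \notin c i) (c_blk : forall i k, k \in c i -> blk k = i).
Variable lt : nat -> L * bool.
Implicit Types S B : {set 'I_r}.

Notation dom := (dom c).
Notation gam := (gam c_uniq c_blk).
Let bl S : dom S -> 'I_r := @word_of r c blk S.
Definition letters (S : {set 'I_r}) (k : dom S) : L := (lt (val k)).1.
Definition signs (S : {set 'I_r}) (k : dom S) : bool := (lt (val k)).2.
Let Z n i : T n -> C := Tr_word (map lt (c i)).

(** The contribution of one premap to the moment of the unnormalised traces of
    the words in [S].  Condition (G) has the exponent [chi - 2 #S] for normalised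
    traces, and [N ^ #S] restores the normalisation. *)
Definition weight n S (p : {perm (dom S * bool)}) : C :=
  n.+1%:R ^ (chi (gam S) (pe (@signs S) p) - #|S|%:Z) * fc n (@letters S) p.

Lemma prod_Tr n S w : \prod_(i in S) Z (n := n) i w =
  n.+1%:R ^+ #|S| * tr_perm (posI (dom S)) (gam S) (fun k => mxsgn (signs k) (X (letters k) w)).
Proof.
rewrite (tr_gam c_uniq c_n0 c_blk S (fun k => mxsgn (lt k).2 (X (lt k).1 w))).
rewrite -prodr_const -big_split /=; apply: eq_bigr => i _.
by rewrite /Z /Tr_word big_map ntrE.
Qed.

Lemma cintegrable_words n S : cintegrable (P n) (fun w => \prod_(i in S) Z i w).
Proof.
have h := G_moments HG n (@signs S) (@letters S) (dom_posset c_pos c_blk S) (gam_pos c_uniq c_blk S).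
have := cint_lin (n.+1%:R ^+ #|S|) h (cint_cst (P n) 0); apply: eq_cintegrable => w.
by rewrite prod_Tr addr0.
Qed.

(** Condition (G) with identity matrices for [Y]: all traces on its right-hand
    side are 1. *)
Lemma moment_words n S : moment (P n) (@Z n) S = \sum_(p in PMc (dom S)) weight n p.
Proof.
have dp := dom_posset c_pos c_blk S; have gp := gam_pos c_uniq c_blk S.
have h := G_moments HG n (@signs S) (@letters S) dp gp.
have e1 w : \prod_(i in S) Z (n := n) i w = n.+1%:R ^+ #|S| *
    tr_perm (posI (dom S)) (gam S) (fun k => mxsgn (signs k) (X (letters k) w) *m 1%:M) + 0.
  by rewrite addr0 prod_Tr; congr (_ * tr_perm _ _ _); apply/funext => k; rewrite mulmx1.
have h' : cintegrable (P n) (fun w => tr_perm (posI (dom S)) (gam S) (fun k => mxsgn (signs k) (X (letters k) w) *m 1%:M)).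
  by apply: eq_cintegrable h => w; congr tr_perm; apply/funext => k; rewrite mulmx1.
rewrite /moment (eq_cE _ e1) cE_lin //; last exact: cint_cst.
have mY (k : dom S) i j : cmeasurable (fun _ : T n => (1%:M : 'M[C]_n.+1) i j).
  by split; exact: measurable_cst.
have rY p : p \in PMc (dom S) -> cintegrable (P n) (fun w =>
    tr_perm (particular ((minus (gam S))^-1%g ∘ pe (@signs S) p ∘ gam S))
      ((minus (gam S))^-1%g ∘ pe (@signs S) p ∘ gam S) (fun k => 1%:M : 'M[C]_n.+1)).
  by move=> _; apply: eq_cintegrable (cint_cst (P n) 1) => w; rewrite tr_perm1.
have := G_expectation HG dp gp mY (@independent_cst n _ (fun _ => 1%:M)) h' rY.
rewrite /= cE_cst addr0 => ->.
rewrite mulr_sumr; apply: eq_bigr => p _.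
under eq_cE do rewrite tr_perm1.
rewrite cE_cst mulr1 mulrA; congr (_ * _).
rewrite exprnP -expfzDr ?pnatr_eq0 // (ncycles_gam c_uniq c_n0 c_blk).
rewrite -[delta_eps _ ∘ _ ∘ _]/(pe (@signs S) p); congr (_ ^ _).
by move: (chi _ _) #|S| => x m; clear; lia.
Qed.

Definition conn S (p : {perm (dom S * bool)}) : bool :=
  [forall i in S, forall j in S, connect (link (@bl S) p) i j].

(** The contribution of the connected premaps, which will turn out to be the
    cumulant. *)
Definition kap n S : C := \sum_(p in PMc (dom S) | conn p) weight n p.

Lemma dom_premap S p : p \in PMc (dom S) -> premap p.
Proof. exact: (G_premap HG (dom_posset c_pos c_blk S)). Qed.

Section Glued.
Variables (S B : {set 'I_r}) (BS : B \subset S).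
Let BI : (dom B `<=` dom S)%fset := dom_sub c_blk BS.
Let KI : (dom (S :\: B) `<=` dom S)%fset := dom_sub c_blk (finset.subsetDl S B).
Let KE := dom_diff c_blk S B.

Lemma weight_glued n p p1 p2 : p \in PMc (dom S) -> p1 \in PMc (dom B) ->
  p2 \in PMc (dom (S :\: B)) -> glued BI KI p p1 p2 -> weight n p = weight n p1 * weight n p2.
Proof.
move=> pM pM1 pM2 gp; rewrite /weight mulrACA.
rewrite (fc_mul n _ KE (dom_posset c_pos c_blk S) pM gp); congr (_ * _).
rewrite -expfzDr ?pnatr_eq0 //; congr (_ ^ _).
have := chi_glued KE (glued_gam c_uniq c_blk BS BI KI) (glued_pe (@signs S) gp)
  (gam_pos _ _ S) (gam_pos _ _ B) (gam_pos _ _ (S :\: B)).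
move=> /(_ (pe_premap _ (dom_premap pM)) (pe_premap _ (dom_premap pM1)) (pe_premap _ (dom_premap pM2))) ->.
have -> : #|S| = (#|B| + #|S :\: B|)%N by rewrite -(cardsID B S) (finset.setIidPr BS).
by rewrite -/(@signs B) -/(@signs (S :\: B)) PoszD opprD addrACA.
Qed.

(** The component of a word of [B] does not leave [B]. *)
Lemma glued_comp_link p p1 p2 i j : glued BI KI p p1 p2 -> i \in B ->
  connect (link (@bl S) p) i j = connect (link (@bl B) p1) i j.
Proof.
move=> gp iB; apply/idP/idP => [h|]; last first.
  apply: connect_sub => u v uv; apply: connect1.
  by rewrite (glued_link KE blk gp) uv.
have /andP[] : (j \in B) && connect (link (@bl B) p1) i j; last by [].
apply: (connect_inv (A := fun j => (j \in B) && connect (link (@bl B) p1) i j) _ h); last by rewrite iB connect0.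
move=> u v /andP[uB iu]; rewrite (glued_link KE blk gp) => /orP[uv|].
  rewrite (connect_trans iu (connect1 uv)) andbT.
  by case/existsP: uv => k /andP[_ /eqP <-]; apply: bl_in.
case/existsP=> k /andP[/eqP ku _]; have := bl_in c_blk k.1.
by rewrite -[word_of _ _]/(blk _) ku !inE uB.
Qed.

End Glued.

Definition comp S i0 (p : {perm (dom S * bool)}) : {set 'I_r} :=
  [set j in S | connect (link (@bl S) p) i0 j].

(** Sort the premaps by the component [B] of the word [i0]: such a premap does not
    connect [B] to the other words, so it is glued from a connected premap on
    [B] and an arbitrary one on the complement, and its weight is the product. *)
Lemma moment_split n S i0 : i0 \in S -> \sum_(p in PMc (dom S)) weight n p =
  \sum_(B : {set 'I_r} | (i0 \in B) && (B \subset S))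
    kap n B * \sum_(p in PMc (dom (S :\: B))) weight n p.
Proof.
move=> i0S; rewrite (partition_big (comp i0) (fun B => (i0 \in B) && (B \subset S))) /=; last first.
  by move=> p _; rewrite inE i0S connect0; apply/fintype.subsetP => j; rewrite inE => /andP[].
apply: eq_bigr => B /andP[i0B BS]; rewrite /kap big_distrlr /= pair_big /=.
pose BI : (dom B `<=` dom S)%fset := dom_sub c_blk BS.
pose KI : (dom (S :\: B) `<=` dom S)%fset := dom_sub c_blk (finset.subsetDl S B).
have KE := dom_diff c_blk S B.
have dS := dom_posset c_pos c_blk S.
(* A cycle of [p] that starts over [B] stays over the component of [i0]. *)
have split_ p : p \in PMc (dom S) -> comp i0 p = B -> exists p1 p2,
    [/\ p1 \in PMc (dom B), p2 \in PMc (dom (S :\: B)) & glued BI KI p p1 p2].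
  move=> pM cB; apply/(factor BI KI p KE dS); split=> //.
  have pp := dom_premap pM.
  have inB (k : dom S * bool) : (bl k.1 \in B) = connect (link (@bl S) p) i0 (bl k.1).
    by rewrite -cB inE bl_in.
  apply/existsP => -[k /existsP[l /and3P[lk kB]]]; rewrite (mem_dom c_blk) (bl_c c_blk) -/(bl l.1) /=.
  move: kB; rewrite (mem_dom c_blk) => /andP[_ kB]; apply/negP/negPn.
  apply: (porbit_closed (A := fun k : dom S * bool => bl k.1 \in B) _ lk) => // z.
  rewrite !inB => h; apply: connect_trans h (connect1 _).
  by apply/existsP; exists z; rewrite !eqxx.
rewrite (reindex_onto (fun q => glue BI KI KE q.1 q.2)
  (fun p => (Defs.induced BI p, Defs.induced KI p))) /=; last first.
  move=> p /andP[pM /eqP cB]; have [p1 [p2 [_ _ gp]]] := split_ p pM cB.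
  have [-> ->] := induced_glued gp; apply: (glued_eq KE _ gp); exact: glued_glue.
apply: eq_big => [[p1 p2] /=|[p1 p2] /= /andP[/andP[pM /eqP cB] _]]; last first.
  have [q1 [q2 [qM1 qM2 gq]]] := split_ _ pM cB.
  have [e1 e2] := glued_inj gq (glued_glue BI KI KE p1 p2).
  by move: qM1 qM2 gq; rewrite e1 e2 => qM1 qM2 gq; apply: (weight_glued _ pM qM1 qM2 gq).
have gg := glued_glue BI KI KE p1 p2.
apply/andP/idP => [[/andP[pM /eqP cB] _]|/andP[/andP[pM1 cn] pM2]].
  have [q1 [q2 [qM1 qM2 gq]]] := split_ _ pM cB.
  have [e1 e2] := glued_inj gq gg; rewrite -e1 -e2 qM1 qM2 andbT /=.
  have cj j : j \in B -> connect (link (@bl B) q1) i0 j.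
    by rewrite -(glued_comp_link _ gq i0B) -{1}cB inE => /andP[].
  have sy := link_sym (@bl B) (dom_premap qM1).
  apply/forall_inP => i iB; apply/forall_inP => j jB.
  by apply: connect_trans (cj j jB); rewrite sy cj.
have gM : glue BI KI KE p1 p2 \in PMc (dom S).
  by have [] := (factor BI KI (glue BI KI KE p1 p2) KE dS).2 (ex_intro _ p1 (ex_intro _ p2 (And3 pM1 pM2 gg))).
have [-> ->] := induced_glued gg; rewrite eqxx gM; split=> //; apply/eqP/setP => j.
rewrite inE (glued_comp_link _ gg i0B); apply/andP/idP => [[_]|jB]; last first.
  split; first exact: (fintype.subsetP BS).
  exact: (forall_inP (forall_inP cn i0 i0B)).
move=> h; apply: (connect_inv (A := mem B) _ h i0B) => u v _ /existsP[k /andP[_ /eqP <-]].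
exact: bl_in.
Qed.

(** The connected contributions satisfy the recursion of the cumulants. *)
Lemma cumulant_words n S : S != finset.set0 -> cumulant_on (P n) (@Z n) S = kap n S.
Proof.
pose i0 S := odflt (blk 0%N) [pick i in S : {set 'I_r}].
have i0P S' : S' != finset.set0 -> i0 S' \in S'.
  by rewrite /i0; case: pickP => [//|h] /finset.set0Pn[j]; rewrite h.
apply: (cumulant_unique (i0 := i0)) => // S' S0.
rewrite moment_words (moment_split _ (i0P _ S0)).
by apply: eq_bigr => B _; rewrite moment_words.
Qed.

End Words.

End Condition.

(** * Limits of the cumulants of words *)

Section Powers.
Variable R : realType.
Local Notation C := R[i].

Lemma cvg_inv_size : (fun n : nat => n.+1%:R^-1 : C^o) @ \oo --> (0 : C^o).
Proof.
apply/cvgr0Pnorm_lt => e e0.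
have er : e = (complex.Re e)%:C%C by move: e0; rewrite ltcE /= => /andP[/eqP h _]; case: e h => a b /= ->.
have e1 : 0 < complex.Re e by move: e0; rewrite ltcE /= => /andP[].
have := near_infty_natSinv_lt (PosNum e1); apply: filterS => n /= h.
rewrite normfV normr_nat er -(rmorph_nat (@real_complex R)) -fmorphV ltcR.
exact: h.
Qed.

Lemma cvg_power (z : int) (f : nat -> C) (l : C) : (z <= 0)%R -> (f : nat -> C^o) @ \oo --> (l : C^o) ->
  (fun n => n.+1%:R ^ z * f n : C^o) @ \oo --> ((if z == 0 then l else 0) : C^o).
Proof.
move=> z0 fl; case: eqP => [->|/eqP zn].
  by under eq_fun do rewrite expr0z mul1r.
have [m ->] : exists m : nat, z = - (m.+1%:Z) by exists (`|z|.-1)%N; lia.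
elim: m => [|m IH].
  under eq_fun do rewrite -invr_expz expr1z.
  rewrite -(mul0r l); exact: (cvgM cvg_inv_size fl).
have -> : (fun n => n.+1%:R ^ (- m.+2%:Z) * f n : C^o) =
    (fun n => n.+1%:R^-1 * (n.+1%:R ^ (- m.+1%:Z) * f n) : C^o).
  apply/funext => n; rewrite mulrA -{1}[n.+1%:R^-1]/(n.+1%:R ^ (-1)) -expfzDr ?pnatr_eq0 //.
rewrite -(mul0r (0 : C)); exact: (cvgM cvg_inv_size IH).
Qed.

Lemma cvg_sumC (J : Type) (s : seq J) (Q : pred J) (f : J -> nat -> C) (l : J -> C) :
  (forall j, Q j -> (f j : nat -> C^o) @ \oo --> (l j : C^o)) ->
  (fun n => \sum_(j <- s | Q j) f j n : C^o) @ \oo --> (\sum_(j <- s | Q j) l j : C^o).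
Proof.
move=> h; elim: s => [|j s IH].
  by rewrite big_nil; under eq_fun do rewrite big_nil; apply: cvg_cst.
rewrite big_cons; under eq_fun do rewrite big_cons.
have [/h hj|_] := boolP (Q j); last exact: IH.
exact: (@cvgD _ C^o _ _ _ (f j) (fun n => \sum_(j <- s | Q j) f j n) _ _ hj IH).
Qed.

End Powers.

Section Limits.
Context (R : realType) (L : choiceType) (d : nat -> measure_display)
  (T : forall n, measurableType (d n)) (P : forall n, probability (T n) R).
Local Notation C := R[i].
Variable X : forall n, L -> T n -> 'M[C]_n.+1.
Variable PMc : forall I : {fset nat}, {set {perm (I * bool)}}.
Variable fc : nat -> forall I : {fset nat}, (I -> L) -> {perm (I * bool)} -> C.
Hypothesis HG : condition_G P X PMc fc.

Section Words.
Variables (r : nat) (c : 'I_r -> seq nat) (blk : nat -> 'I_r).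
Hypotheses (c_uniq : forall i, uniq (c i)) (c_n0 : forall i, c i != [::])
  (c_pos : forall i, 0%N \notin c i) (c_blk : forall i k, k \in c i -> blk k = i).
Variable lt : nat -> L * bool.

(** The leading coefficient of the connected contributions. *)
Definition limit_sum (I : {fset nat}) (g : {perm (I * bool)}) (e : I -> bool) (l : I -> L) : C :=
  \sum_(p in PMc I | [forall i, forall j, connect (link (blk \o val) p) i j] &&
       (chi g (pe e p) == 2)) lim ((fun n => fc n l p : C^o) @ \oo).

(** Each term has the exponent [chi - 2], which is nonpositive for linked
    premaps, and only the terms with exponent 0 survive. *)
Lemma cvg_kap : (0 < r)%N ->
  (fun n => n.+1%:R ^ (r%:Z - 2) * kap PMc fc c_uniq c_blk lt n [set: 'I_r]%SET : C^o) @ \oo -->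
  (limit_sum (gam c_uniq c_blk [set: 'I_r]%SET) (@signs L r c lt _) (@letters L r c lt _) : C^o).
Proof.
move=> r0.
set S := [set: 'I_r]%SET; set g := gam _ _ _; set e := @signs _ _ _ _ _; set l := @letters _ _ _ _ _.
pose cn (p : {perm (dom c S * bool)}) := [forall i, forall j, connect (link (blk \o val) p) i j].
have -> : (fun n => n.+1%:R ^ (r%:Z - 2) * kap PMc fc c_uniq c_blk lt n S : C^o) =
    (fun n => \sum_(p in PMc (dom c S) | cn p) (n.+1%:R ^ (chi g (pe e p) - 2) * fc n l p) : C^o).
  apply/funext => n; rewrite /kap mulr_sumr; apply: eq_big => [p|p _].
    congr (_ && _); apply: eq_forallb => i; rewrite inE; apply: eq_forallb => j.
    by rewrite inE.
  rewrite /weight mulrA -expfzDr ?pnatr_eq0 //; congr (_ ^ _ * _).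
  by rewrite cardsT card_ord addrC subrKA.
rewrite (_ : limit_sum _ _ _ = \sum_(p in PMc (dom c S) | cn p)
   (if chi g (pe e p) - 2 == 0 then lim ((fun n => fc n l p : C^o) @ \oo) else 0)); last first.
  rewrite /limit_sum (eq_bigl (fun p => ((p \in PMc (dom c S)) && cn p) && (chi g (pe e p) == 2))).
    by rewrite big_mkcondr; apply: eq_bigr => p _; rewrite subr_eq0.
  by move=> p; rewrite andbA.
apply: cvg_sumC => p /andP[pM cnp]; apply: cvg_power; last first.
  exact: (G_limit HG (dom_posset c_pos c_blk S) pM).
rewrite subr_le0.
have pp := pe_premap e (dom_premap HG c_pos c_blk pM).
have [k kb] := bl_surj c_n0 c_blk (finset.in_setT (Ordinal r0)).
apply: (chi_le2 (gam_pos c_uniq c_blk S) pp (x := (k, true))).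
apply: (linked_connected (gam_pos c_uniq c_blk S) (gam_cyc c_uniq c_blk (S := S)) pp).
by move=> j; rewrite (eq_connect (pe_link e (blk \o val) p)); apply: (forallP (forallP cnp _)).
Qed.

(** [g] is the permutation whose cycles are all the words, on whatever
    presentation [I] of their set of letters.  The segments of integers in the
    limit functionals are not convertible to [dom c setT]. *)
Definition is_gam (I : {fset nat}) (g : {perm (I * bool)}) : Prop :=
  [/\ I = dom c [set: 'I_r]%SET,
      forall k, val (g k).1 = if k.2 then nx c blk (val k.1) else val k.1 &
      forall k, (g k).2 = k.2].

(** Transport along the equality of the two index sets. *)
Lemma is_gam_ind (Q : forall I : {fset nat}, {perm (I * bool)} -> Prop) I g :
  is_gam g -> Q _ (gam c_uniq c_blk [set: 'I_r]%SET) -> Q I g.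
Proof.
case=> IE; move: g; rewrite IE => g g1 g2; suff -> : g = gam c_uniq c_blk [set: 'I_r]%SET by [].
apply/permP => k; rewrite [LHS]surjective_pairing [RHS]surjective_pairing g2 gam2.
by congr (_, _); apply/val_inj; rewrite g1 gam1.
Qed.

Section Sheets.
Variables (I : {fset nat}) (g : {perm (I * bool)}).
Hypothesis gg : is_gam g.
Let bl : I -> 'I_r := blk \o val.

Lemma is_gam_pos : perm_on (posI I) g.
Proof. apply: (is_gam_ind (Q := fun I g => perm_on (posI I) g) gg); exact: gam_pos. Qed.

Lemma is_gam_blk k : bl (g k).1 = bl k.1.
Proof.
apply: (is_gam_ind (Q := fun I g => forall k, blk (val (g k).1) = blk (val k.1)) gg).
exact: (gam_blk c_uniq c_blk).
Qed.

Lemma is_gam_cyc (k l : I * bool) : bl k.1 = bl l.1 -> k.2 -> l.2 -> l \in porbit g k.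
Proof.
move: k l; apply: (is_gam_ind (Q := fun I g => forall k l : I * bool,
  blk (val k.1) = blk (val l.1) -> k.2 -> l.2 -> l \in porbit g k) gg).
exact: (gam_cyc c_uniq c_blk).
Qed.

Lemma is_gam_surj i : exists k : I, bl k = i.
Proof.
apply: (is_gam_ind (Q := fun I _ => exists k : I, blk (val k) = i) gg).
by apply: (bl_surj c_n0 c_blk); rewrite inE.
Qed.

Lemma is_gam_posset : posset I.
Proof. by apply: (is_gam_ind (Q := fun I _ => posset I) gg); exact: dom_posset c_pos c_blk _. Qed.

(** [ext g] moves along a word without changing the sign. *)
Lemma stable_blk (D : {set I * bool}) (x y : I) : (forall k, (ext g k \in D) = (k \in D)) ->
  bl x = bl y -> (x, true) \in D -> (y, true) \in D.
Proof.
move=> gD b xD; have yx : (y, true) \in porbit g (x, true) by apply: is_gam_cyc.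
have /andP[] // : (fun z : I * bool => z.2 && (z \in D)) (y, true).
apply: (porbit_closed (A := fun z => z.2 && (z \in D)) _ yx); last by rewrite xD.
move=> z /andP[z2 zD]; case: gg => _ _ ->; rewrite z2.
by have := gD z; rewrite (ext_gamma is_gam_pos) z2 zD.
Qed.

Lemma posE (k : I * bool) : k.2 -> k = (k.1, true).
Proof. by case: k => k []. Qed.

Lemma sheet_conn (D : {set I * bool}) x p : (forall k, (neg k \in D) = (k \notin D)) ->
  (forall k, (ext g k \in D) = (k \in D)) -> x \in D -> premap p -> sheet g D p ->
  [forall i, forall j, connect (link bl p) i j] && (chi g p == 2).
Proof.
move=> Dneg gD xD pp sh; rewrite (sheet_chi is_gam_pos pp Dneg gD xD sh) eqxx andbT.
have cn := sheet_linked is_gam_pos is_gam_blk Dneg gD xD is_gam_surj sh.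
apply/forallP => i; apply/forallP => j; apply: connect_trans (cn j).
by rewrite link_sym // cn.
Qed.

Lemma posI_neg k : (neg k \in posI I) = (k \notin posI I).
Proof. by rewrite !inE. Qed.

Lemma posI_stable k : (ext g k \in posI I) = (k \in posI I).
Proof. by rewrite !inE (ext_gamma_sign is_gam_pos). Qed.

Lemma posI_subset (D : {set I * bool}) : (forall k, (neg k \in D) = (k \notin D)) ->
  (forall k : I, (k, true) \in D) -> D = posI I.
Proof.
move=> Dneg Dp; apply/setP => k; rewrite inE; apply/idP/idP => [kD|/posE -> //].
by apply: contraLR kD => k2; rewrite -Dneg [neg k]posE.
Qed.

(** The right-hand side of [sum_sheet] for the limits of [f_c]. *)
Definition sheet_sum (e : I -> bool) (l : I -> L) (D : {set I * bool}) : C :=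
  \sum_(q | [&& perm_on D q, full D (rp (mem D) (ext g)) q & planar (rp (mem D) (ext g)) q]
            && (pe e (ext q) \in PMc I)) lim ((fun n => fc n l (pe e (ext q)) : C^o) @ \oo).

Lemma sheet_sumE e l (D : {set I * bool}) : (forall k, (neg k \in D) = (k \notin D)) -> sheet_sum e l D =
  \sum_(p in PMc I | sheet g D (pe e p)) lim ((fun n => fc n l p : C^o) @ \oo).
Proof.
move=> Dneg; apply: esym.
exact: (sum_sheet e (fun p => lim ((fun n => fc n l p : C^o) @ \oo)) g Dneg (G_premap HG is_gam_posset)).
Qed.

Lemma pe_conn e p : [forall i, forall j, connect (link bl p) i j] =
  [forall i, forall j, connect (link bl (pe e p)) i j].
Proof.
by apply: eq_forallb => i; apply: eq_forallb => j; rewrite (eq_connect (pe_link e bl p)).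
Qed.

(** The letters of a single word lie on the same sheet; choosing the sheet that
    contains one positive letter, it consists of all positive letters. *)
Lemma limit_sum1 e l : r = 1%N -> limit_sum g e l = sheet_sum e l (posI I).
Proof.
move=> r1; rewrite (sheet_sumE _ _ posI_neg).
apply: eq_bigl => p; have [pM|//] := boolP (p \in PMc I) => /=.
have pp := pe_premap e (G_premap HG is_gam_posset pM); rewrite (pe_conn e).
have [k0 _] := is_gam_surj (cast_ord (esym r1) ord0).
have alli i j : i = j :> 'I_r by apply/val_inj; case: i j => i hi [j hj] /=; lia.
apply/idP/idP => [/andP[cn /eqP c2]|sh]; last first.
  by apply: (sheet_conn posI_neg posI_stable (x := (k0, true)) _ pp sh); rewrite inE.
have [D [xD Dneg gD sh]] := chi2_sheet is_gam_pos is_gam_cyc pp (x := (k0, true)) (forallP (forallP cn _)) c2.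
rewrite -(posI_subset Dneg) // => k; exact: (stable_blk gD (alli _ _) xD).
Qed.

(** The sheet that contains the first word positively contains the second word
    positively or negatively, and not both, as all words are linked inside a
    sheet. *)
Lemma limit_sum2 e l (D : {set I * bool}) (x y : I) : r = 2%N ->
  (forall k, (neg k \in D) = (k \notin D)) -> (forall k, (ext g k \in D) = (k \in D)) ->
  (x, true) \in D -> (y, true) \notin D ->
  limit_sum g e l = sheet_sum e l (posI I) + sheet_sum e l D.
Proof.
move=> r2 Dneg gD xD yD.
have xy : bl x != bl y by apply: contra yD => /eqP b; apply: (stable_blk gD b xD).
have cases i : i = bl x \/ i = bl y.
  move: xy; rewrite -val_eqE /=; case: (bl x) (bl y) i => [a ha] [b hb] [i hi] /= ab.
  have [h|h] : i = a \/ i = b by lia. 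
    by left; apply/val_inj.
  by right; apply/val_inj.
rewrite (sheet_sumE _ _ posI_neg) (sheet_sumE _ _ Dneg).
rewrite /limit_sum (bigID (fun p => sheet g (posI I) (pe e p))) /=; congr (_ + _); apply: eq_bigl => p.
  have [pM|//] := boolP (p \in PMc I) => /=; rewrite (pe_conn e).
  have pp := pe_premap e (G_premap HG is_gam_posset pM).
  apply/andP/idP => [[] //|sh]; split=> //.
  by apply: (sheet_conn posI_neg posI_stable (x := (x, true)) _ pp sh); rewrite inE.
have [pM|//] := boolP (p \in PMc I) => /=; rewrite (pe_conn e).
have pp := pe_premap e (G_premap HG is_gam_posset pM).
apply/andP/idP => [[/andP[cn /eqP c2] ns]|sh].
  have [E [xE Eneg gE sh]] := chi2_sheet is_gam_pos is_gam_cyc pp (x := (x, true)) (forallP (forallP cn _)) c2.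
  have kin (F : {set I * bool}) (k : I) : (forall k, (ext g k \in F) = (k \in F)) -> (x, true) \in F -> (y, true) \notin F ->
      ((k, true) \in F) = (bl k == bl x).
    move=> gF xF yF; case: (cases (bl k)) => b; rewrite b ?eqxx; first by rewrite (stable_blk gF (esym b) xF).
    by rewrite eq_sym (negbTE xy); apply: contraNF yF => h; apply: (stable_blk gF b h).
  have yE : (y, true) \notin E.
    apply: contra ns => yE; rewrite -(posI_subset Eneg) // => k.
    by case: (cases (bl k)) => b; [apply: (stable_blk gE (esym b) xE)|apply: (stable_blk gE (esym b) yE)].
  suff -> : D = E by [].
  apply/setP => -[k []]; first by rewrite (kin D k gD xD yD) (kin E k gE xE yE).
  by rewrite -(negK (k, false)) Dneg Eneg (kin D k gD xD yD) (kin E k gE xE yE).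
split; first exact: (sheet_conn Dneg gD xD pp sh).
apply: contra yD => /and3P[/forallP pP /fullP cn _].
have {}cn := cn (x, true) (y, true); rewrite !inE in cn.
have pD k : (pe e p k \in D) = (k \in D) by have /and3P[/forallP/(_ k)/eqP] := sh.
have pos (f : {perm (I * bool)}) z : (forall k, (f k \in posI I) = (k \in posI I)) -> (forall k, (f k \in D) = (k \in D)) ->
    z \in D -> rp (mem (posI I)) f z \in D.
  move=> fP fD zD; have [zP|zP] := boolP (z \in posI I); first by rewrite rp_in ?fD.
  by rewrite rpE /= (negbTE zP).
apply: (connect_closed_step (A := mem D) _ _ (cn isT isT) xD) => z zD; apply: pos => //.
  exact: posI_stable.
by move=> k; apply/eqP.
Qed.

End Sheets.

(** The exponent of the connected contributions is [chi - r]; multiplied by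
    [N ^ (r - 2)] the spheres remain. *)
Lemma cvg_cumulant (I : {fset nat}) (g : {perm (I * bool)}) e l : (0 < r)%N -> is_gam g ->
  (forall k : I, e k = (lt (val k)).2) -> (forall k : I, l k = (lt (val k)).1) ->
  (fun n => n.+1%:R ^ (r%:Z - 2) *
     cumulant (P n) (fun i : 'I_r => Tr_word X (n := n) (map lt (c i))) : C^o) @ \oo -->
  (limit_sum g e l : C^o).
Proof.
move=> r0 gg /funext -> /funext ->.
have e0 n : cumulant (P n) (fun i : 'I_r => Tr_word X (n := n) (map lt (c i))) =
    kap PMc fc c_uniq c_blk lt n [set: 'I_r]%SET.
  apply: (cumulant_words HG c_uniq c_n0 c_pos c_blk lt n).
  by apply/finset.set0Pn; exists (Ordinal r0); rewrite inE.
under eq_fun do rewrite e0.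
apply: (is_gam_ind (Q := fun I g => _ --> (limit_sum g (fun k => (lt (val k)).2) (fun k => (lt (val k)).1) : C^o)) gg).
exact: cvg_kap.
Qed.

End Words.
End Limits.

(** * The limits for one and two words *)

Section Standard.
Local Open Scope nat_scope.

Lemma cyc_signed (I : {fset nat}) (s : seq I) b (k : I * bool) : uniq s ->
  cyc (signed_pts b s) k = if k.2 == b then (next s k.1, b) else k.
Proof.
move=> us; have ij : injective (fun k : I => (k, b)) by move=> x y [].
rewrite cycE ?map_inj_uniq //; case: k => k b' /=; case: eqP => [->|nb].
  by rewrite (next_map ij).
rewrite next_nth; case: ifP => // /mapP[x _ [_ /nb]] //.
Qed.

Lemma signed_uniq (I : {fset nat}) (s : seq I) b : uniq s -> uniq (signed_pts b s).
Proof. by move=> us; rewrite map_inj_uniq // => x y []. Qed.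

Lemma mem_signed (I : {fset nat}) (s : seq I) b (k : I * bool) :
  (k \in signed_pts b s) = (k.2 == b) && (k.1 \in s).
Proof.
apply/mapP/andP => [[l ls ->]|[/eqP kb ks]]; first by rewrite /= eqxx.
by exists k.1 => //; rewrite -kb -surjective_pairing.
Qed.

Lemma pts_uniq I a m : uniq (pts I a m).
Proof. by rewrite pmap_sub_uniq // iota_uniq. Qed.

Lemma mem_pts_seg (I : {fset nat}) a m (k : I) : (k \in pts I a m) = (val k \in iota a m).
Proof. exact: mem_pmap_sub. Qed.

Lemma in_seg N k : (k \in seg N) = (0 < k <= N).
Proof. by rewrite inE /= mem_iota add1n ltnS. Qed.

Lemma val_pts_seg N a m : 0 < a -> a + m <= N.+1 -> map val (pts (seg N) a m) = iota a m.
Proof.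
move=> a0 amN; rewrite pmap_filter; last exact: insubK.
apply/all_filterP/allP => k; rewrite mem_iota => /andP[ak kam].
by rewrite insubT // in_seg (leq_trans a0 ak) -ltnS (leq_trans kam).
Qed.

Lemma ann_nc_full (I : {fset nat}) (c1 c2 : seq (I * bool)) p :
  uniq (c1 ++ c2) -> c1 != [::] -> c2 != [::] ->
  let D := [set z in c1 ++ c2]%SET in let g := cyc c1 ∘ cyc c2 in
  ann_nc D g p = [&& perm_on D p, full D g p & planar g p].
Proof.
move=> u n1 n2 D g; rewrite /D /g ann_nc_planar //; case pD : (perm_on _ p) => //=.
congr (_ && _); case E : c1 n1 => [//|a0 s] _.
have gD : perm_on D g.
  have [u1 u2] : uniq c1 /\ uniq c2 by move: u; rewrite cat_uniq => /and3P[].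
  apply/fintype.subsetP => z; rewrite !inE; apply: contraNT; rewrite mem_cat negb_or => /andP[z1 z2].
  by rewrite /g pcompE (cyc_out u2) // (cyc_out u1).
have a0D : a0 \in D by rewrite inE E mem_head.
rewrite -E; exact/(trans_connect gD pD a0D)/fullP.
Qed.

End Standard.

Section WordLimits.
Context (R : realType) (L : choiceType) (d : nat -> measure_display)
  (T : forall n, measurableType (d n)) (P : forall n, probability (T n) R).
Local Notation C := R[i].
Variable X : forall n, L -> T n -> 'M[C]_n.+1.
Variable PMc : forall I : {fset nat}, {set {perm (I * bool)}}.
Variable fc : nat -> forall I : {fset nat}, (I -> L) -> {perm (I * bool)} -> C.
Hypothesis HG : condition_G P X PMc fc.

Let lt (w : seq (L * bool)) x0 k := nth x0 w k.-1.

Lemma map_lt (w : seq (L * bool)) x0 a m : map (lt w x0) (iota a.+1 m) = [seq nth x0 w k | k <- iota a m].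
Proof. by rewrite -[a.+1]/(1 + a)%N iotaDl -map_comp. Qed.

Lemma letter_nth (w : seq (L * bool)) x0 (k : seg (size w)) : letter k = lt w x0 (val k).
Proof. by rewrite /letter (tnth_nth x0). Qed.

(** The limit functionals sum over [q_+ q_-^-1], which is [ext q]. *)
Lemma sheet_sum_nc w g D nc :
  (forall q, nc q = [&& perm_on D q, full D (rp (mem D) (ext g)) q & planar (rp (mem D) (ext g)) q]) ->
  sheet_sum PMc fc g (fun k : seg (size w) => (letter k).2) (fun k => (letter k).1) D =
  sum_nc PMc fc (w := w) nc.
Proof.
move=> ncE; have sE q : summand q = pe (fun k : seg (size w) => (letter k).2) (ext q).
  by rewrite /summand /pe /ext !pcompA.
by apply: eq_big => [q|q _]; rewrite /lim_fc sE // ncE.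
Qed.

(** With one word transitivity is automatic, and planar means disc-noncrossing. *)
Lemma cvg_word1 w : w != [::] ->
  (fun n => n.+1%:R^-1 * cumulant (P n) (fun _ : 'I_1 => Tr_word X (n := n) w) : C^o) @ \oo -->
  (phi1_word PMc fc w : C^o).
Proof.
case E : w => [//|x0 w'] _; rewrite -E; set N := size w.
pose c (_ : 'I_1) := iota 1 N; pose blk (_ : nat) : 'I_1 := ord0.
have cu i : uniq (c i) by apply: iota_uniq.
have cn i : c i != [::] by rewrite /c /N E.
have cp i : 0%N \notin c i by rewrite mem_iota.
have cb i k : k \in c i -> blk k = i by move=> _; rewrite (ord1 i).
have ci i : map (lt w x0) (c i) = w by rewrite map_lt -/(mkseq _ _) mkseq_nth.
have gg : is_gam c blk (gamma1 N).
  split.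
  - by apply/fsetP => k; rewrite (mem_dom cb) !inE andbT.
  - move=> k; rewrite cyc_signed ?pts_uniq //; case: k => k [] //=.
    by rewrite -(next_map val_inj) ?pts_uniq // val_pts_seg.
  by move=> k; rewrite cyc_signed ?pts_uniq //; case: k => k [].
have sE : limit_sum PMc fc blk (gamma1 N) (fun k : seg N => (letter k).2) (fun k => (letter k).1) =
    phi1_word PMc fc w.
  rewrite (limit_sum1 HG cu cn cp cb gg _ _ erefl).
  have -> : phi1_word PMc fc w = sum_nc PMc fc (disc_nc (posI (seg (size w))) (gamma1 (size w))) by rewrite E.
  apply: sheet_sum_nc => q.
  have gpos := is_gam_pos cu cb gg.
  have e1 : posI (seg N) = [set z in signed_pts true (pts (seg N) 1 N)]%SET.
    apply/setP => k; rewrite !inE mem_signed eqb_id; case: k.2 => //=.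
    by rewrite mem_pts_seg mem_iota add1n ltnS -in_seg (valP k.1).
  rewrite (rp_ext (@posI_neg _) gpos) {1}e1 {1}/gamma1 disc_nc_planar ?signed_uniq ?pts_uniq //.
  rewrite -e1; case: (perm_on _ _) => //=.
  rewrite (_ : full _ _ _ = true) //; apply/fullP => a b; rewrite !inE => a2 b2.
  by apply: connect_porbit_l; apply: (is_gam_cyc cu cb gg); rewrite // /blk.
have h := cvg_cumulant HG cu cn cp cb (isT : (0 < 1)%N) gg
  (fun k => congr1 snd (letter_nth x0 k)) (fun k => congr1 fst (letter_nth x0 k)).
rewrite sE in h.
rewrite (_ : (fun n => _) = (fun n => n.+1%:R ^ (1%Z - 2) * cumulant (P n)
  (fun i : 'I_1 => Tr_word X (n := n) (map (lt w x0) (c i))) : C^o)); first exact: h.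
apply/funext => n; congr (_ * _); congr cumulant.
by apply/funext => i; rewrite ci.
Qed.

Definition two_words N m (i : 'I_2) : seq nat := if i == ord0 then iota 1 m else iota m.+1 (N - m).
Definition which_word m (k : nat) : 'I_2 := if (k <= m)%N then ord0 else ord_max.

Lemma which_word0 m k : (which_word m k == ord0) = (k <= m)%N.
Proof. by rewrite /which_word; case: leqP. Qed.

Section TwoWords.
Variables (N m : nat).
Hypotheses (m0 : (0 < m)%N) (mN : (m < N)%N).
Let c := two_words N m.
Let blk := which_word m.
Let pts1 := pts (seg N) 1 m.
Let pts2 := pts (seg N) m.+1 (N - m).
Let g := gamma2 N m.

Lemma two_uniq i : uniq (c i). Proof. by rewrite /c /two_words; case: ifP => _; apply: iota_uniq. Qed.
Lemma two_n0 i : c i != [::].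
Proof. by rewrite /c /two_words -size_eq0; case: ifP => _; rewrite size_iota -lt0n // subn_gt0. Qed.
Lemma two_pos i : 0%N \notin c i. Proof. by rewrite /c /two_words; case: ifP => _; rewrite mem_iota. Qed.
Lemma two_blk i k : k \in c i -> blk k = i.
Proof.
rewrite /c /blk /two_words /which_word; case: eqP => [-> |n0]; rewrite mem_iota; first by rewrite add1n ltnS => /andP[_ ->].
move=> /andP[/ltn_geF -> _]; apply/val_inj; case: i n0 => [[|[|//]] hi] n0 //=.
by case: n0; apply/val_inj.
Qed.

Lemma mem_pts1 k : (k \in pts1) = (val k <= m)%N.
Proof. by have := valP k; rewrite in_seg mem_pts_seg mem_iota add1n ltnS => /andP[-> _]. Qed.

Lemma mem_pts2 k : (k \in pts2) = ~~ (val k <= m)%N.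
Proof.
have := valP k; rewrite in_seg mem_pts_seg mem_iota -ltnNge addSn subnKC ?ltnS; last exact: ltnW.
by move=> /andP[_ ->]; rewrite andbT.
Qed.

Lemma gamma2E k : g k = if k.2 then
  ((if (val k.1 <= m)%N then next pts1 k.1 else next pts2 k.1), true) else k.
Proof.
have out s l : l \notin s -> next s l = l :> seg N by move=> ls; rewrite next_nth (negbTE ls).
rewrite /g /gamma2 pcompE !cyc_signed ?pts_uniq //; case: k => k [] //=.
case: ifP => h; first by rewrite (out pts2) // mem_pts2 h.
rewrite (out pts1) // mem_pts1; have : next pts2 k \in pts2 by rewrite mem_next mem_pts2 h.
by rewrite mem_pts2.
Qed.

Lemma gamma2_is_gam : is_gam c blk g.
Proof.
split.
- apply/fsetP => k; rewrite (mem_dom two_blk) in_seg finset.in_setT andbT /c /two_words which_word0.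
  case: (leqP k m) => km; rewrite mem_iota addSn ltnS.
    by rewrite add0n km (leq_trans km) ?andbT // ltnW.
  by rewrite km /= (leq_ltn_trans _ km) // subnKC ?ltnS // ltnW.
- move=> k; rewrite gamma2E; case: k => k [] //=; rewrite /nx /c /two_words which_word0.
  case: ifP => h.
    by rewrite -(next_map val_inj) ?pts_uniq // val_pts_seg // add1n ltnS ltnW.
  by rewrite -(next_map val_inj) ?pts_uniq // val_pts_seg // addSn subnKC // ltnW.
by move=> k; rewrite gamma2E; case: k => k [].
Qed.

Let gpos := is_gam_pos two_uniq two_blk gamma2_is_gam.

Lemma dom_op_neg k : (neg k \in dom_op N m) = (k \notin dom_op N m).
Proof. by rewrite !inE /=; case: (k.2); case: (_ <= _)%N. Qed.

Lemma dom_op_stable k : (ext g k \in dom_op N m) = (k \in dom_op N m).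
Proof.
rewrite !inE (ext_gamma_sign gpos); congr (_ == _).
have := ext_blk (blk := blk \o val) gpos (is_gam_blk two_uniq two_blk gamma2_is_gam) k.
by rewrite /= -!which_word0 -/blk => ->.
Qed.

(** Negating the second word reverses its cycle. *)
Lemma gamma_opE : rp (mem (dom_op N m)) (ext g) = gamma_op N m.
Proof.
have out s l : l \notin s -> next s l = l :> seg N by move=> ls; rewrite next_nth (negbTE ls).
apply/permP => k; rewrite /gamma_op pcompE !cyc_signed ?rev_uniq ?pts_uniq // -/pts1 -/pts2.
have [kD|kD] := boolP (k \in dom_op N m).
  rewrite rp_in //; last exact: dom_op_stable.
  rewrite (ext_gamma gpos); case: k kD => k []; rewrite inE /= => /eqP h.
    by rewrite gamma2E /= -h.
  rewrite next_rev ?pts_uniq // -[RHS]negK; congr neg.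
  apply: (@perm_inj _ g); rewrite permKV gamma2E /neg /=.
  have : prev pts2 k \in pts2 by rewrite mem_prev mem_pts2 -h.
  by rewrite mem_pts2 => /negbTE ->; rewrite next_prev ?pts_uniq.
rewrite rpE /= (negbTE kD); move: kD; rewrite inE; case: k => k [] /= h.
  by rewrite out // mem_pts1; move: h; case: (_ <= _)%N.
by rewrite out // mem_rev mem_pts2; move: h; case: (_ <= _)%N.
Qed.

Lemma ann_nc_posI q : ann_nc (posI (seg N)) g q = [&& perm_on (posI (seg N)) q,
  full (posI (seg N)) (rp (mem (posI (seg N))) (ext g)) q &
  planar (rp (mem (posI (seg N))) (ext g)) q].
Proof.
have e1 : posI (seg N) = [set z in signed_pts true pts1 ++ signed_pts true pts2]%SET.
  by apply/setP => k; rewrite !inE mem_cat !mem_signed mem_pts1 mem_pts2; case: k.2; case: (_ <= _)%N.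
rewrite (rp_ext (@posI_neg _) gpos) {1}e1 {1}/g /gamma2 ann_nc_full -?e1 //.
- rewrite cat_uniq !signed_uniq ?pts_uniq // andbT /=; apply/hasPn => k.
  by rewrite /= !mem_signed mem_pts1 mem_pts2 => /andP[-> /negbTE ->].
- by rewrite -size_eq0 size_map -(size_map val) val_pts_seg ?size_iota -?lt0n // add1n ltnS ltnW.
by rewrite -size_eq0 size_map -(size_map val) val_pts_seg ?size_iota -?lt0n ?subn_gt0 // addSn subnKC // ltnW.
Qed.

Lemma ann_nc_dom_op q : ann_nc (dom_op N m) (gamma_op N m) q = [&& perm_on (dom_op N m) q,
  full (dom_op N m) (rp (mem (dom_op N m)) (ext g)) q &
  planar (rp (mem (dom_op N m)) (ext g)) q].
Proof.
have e1 : dom_op N m = [set z in signed_pts true pts1 ++ signed_pts false (rev pts2)]%SET.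
  apply/setP => k; rewrite !inE mem_cat !mem_signed mem_rev mem_pts1 mem_pts2.
  by case: k.2; case: (_ <= _)%N.
rewrite gamma_opE {1}e1 {1}/gamma_op ann_nc_full -?e1 //.
- rewrite cat_uniq !signed_uniq ?rev_uniq ?pts_uniq // andbT /=; apply/hasPn => k.
  by rewrite /= !mem_signed => /andP[/eqP -> _].
- by rewrite -size_eq0 size_map -(size_map val) val_pts_seg ?size_iota -?lt0n // add1n ltnS ltnW.
by rewrite -size_eq0 size_map size_rev -(size_map val) val_pts_seg ?size_iota -?lt0n ?subn_gt0 // addSn subnKC // ltnW.
Qed.

End TwoWords.

(** The two sheets of two words give the two annular sums. *)
Lemma cvg_word2 u v : u != [::] -> v != [::] ->
  (fun n => cumulant (P n) (pair2 (Tr_word X (n := n) u) (Tr_word X (n := n) v)) : C^o) @ \oo -->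
  (phi2_word PMc fc u v : C^o).
Proof.
move=> nu nv; rewrite /phi2_word (negbTE nu) (negbTE nv) /=.
case E : u (nu) => [//|x0 u'] _; rewrite -E {u' E}; set w := u ++ v.
have m0 : (0 < size u)%N by rewrite lt0n size_eq0.
have mN : (size u < size w)%N by rewrite size_cat -addn1 leq_add2l lt0n size_eq0.
have gg := gamma2_is_gam mN.
have cu := two_uniq (size w) (size u); have cn := two_n0 m0 mN.
have cp := two_pos (size w) (size u); have cb := @two_blk (size w) (size u).
have sE : limit_sum PMc fc (which_word (size u)) (gamma2 (size w) (size u)) (fun k : seg (size w) => (letter k).2) (fun k => (letter k).1) =
    phi2_word PMc fc u v.
  have w1 : (size u)%N \in seg (size w) by rewrite in_seg m0 ltnW.
  have w2 : (size w)%N \in seg (size w) by rewrite in_seg (ltn_trans m0 mN) leqnn.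
  have xD : ([` w1]%fset, true) \in dom_op (size w) (size u) by rewrite inE /= leqnn.
  have yD : ([` w2]%fset, true) \notin dom_op (size w) (size u) by rewrite inE /= leqNgt mN.
  rewrite (limit_sum2 HG cu cn cp cb gg _ _ erefl (@dom_op_neg _ _) (dom_op_stable mN) xD yD).
  rewrite /phi2_word (negbTE nu) (negbTE nv) /=; congr (_ + _).
    by apply: sheet_sum_nc => q; apply: ann_nc_posI.
  by apply: sheet_sum_nc => q; apply: ann_nc_dom_op.
have h := cvg_cumulant HG cu cn cp cb (isT : (0 < 2)%N) gg
  (fun k => congr1 snd (letter_nth x0 k)) (fun k => congr1 fst (letter_nth x0 k)).
rewrite sE /phi2_word (negbTE nu) (negbTE nv) /= in h.
rewrite [X in X @ _](_ : _ = (fun n => n.+1%:R ^ (2%Z - 2) * cumulant (P n)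
  (fun i : 'I_2 => Tr_word X (n := n) (map (lt w x0) (if i == ord0 then iota 1 (size u) else iota (size u).+1 (size w - size u)))) : C^o)); first exact: h.
apply/funext => n; rewrite subrr expr0z mul1r; congr cumulant.
apply/funext => i; rewrite /pair2 /two_words; case: ifP => _; congr Tr_word; rewrite map_lt.
  apply: (@eq_from_nth _ x0) => [|k]; first by rewrite size_map size_iota.
  by move=> ku; rewrite (nth_map 0%N) ?size_iota // nth_iota // nth_cat ku.
apply: (@eq_from_nth _ x0) => [|k]; first by rewrite size_map size_iota size_cat addKn.
move=> kv; rewrite (nth_map 0%N) ?size_iota size_cat addKn // nth_iota // nth_cat.
by rewrite ltnNge leq_addr addKn.
Qed.

End WordLimits.

(** * Traces of linear combinations of words *)

Section Combinations.
Context (R : realType) (L : choiceType) (d : nat -> measure_display)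
  (T : forall n, measurableType (d n)) (P : forall n, probability (T n) R).
Local Notation C := R[i].
Variable X : forall n, L -> T n -> 'M[C]_n.+1.
Variable PMc : forall I : {fset nat}, {set {perm (I * bool)}}.
Variable fc : nat -> forall I : {fset nat}, (I -> L) -> {perm (I * bool)} -> C.
Hypothesis HG : condition_G P X PMc fc.
Implicit Types (u v : seq (L * bool)).

(** The letter number [j] of the word number [i] is placed at the code of the pair
    [(i, j)], shifted by one so as to be positive. *)
Lemma word_system r (w : 'I_r -> seq (L * bool)) : (0 < r)%N -> (forall i, w i != [::]) ->
  exists (c : 'I_r -> seq nat) (blk : nat -> 'I_r) (lt : nat -> L * bool),
  [/\ forall i, uniq (c i), forall i, c i != [::], forall i, 0%N \notin c i,
      forall i k, k \in c i -> blk k = i & forall i, map lt (c i) = w i].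
Proof.
move=> r0 nw; pose i0 := Ordinal r0.
have x0 : L * bool by case: (w i0) (nw i0) => [//|x].
pose code (i j : nat) : nat := (choice.pickle (i, j)).+1.
pose dec k : nat * nat := odflt (0%N, 0%N) (choice.unpickle k.-1).
have codeK i j : dec (code i j) = (i, j) by rewrite /dec /code /= choice.pickleK.
have insK (i : 'I_r) : insubd i0 (val i) = i by apply/val_inj; rewrite insubdK // -topredE /=.
exists (fun i : 'I_r => [seq code i j | j <- iota 0 (size (w i))]), (fun k => insubd i0 (dec k).1),
  (fun k => nth x0 (w (insubd i0 (dec k).1)) (dec k).2); split=> i.
- by rewrite map_inj_uniq ?iota_uniq // => j j' /(congr1 dec); rewrite !codeK => -[].
- by rewrite -size_eq0 size_map size_iota size_eq0.
- by apply/mapP => -[].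
- by move=> k /mapP[j _ ->]; rewrite codeK insK.
rewrite -map_comp; apply: (@eq_from_nth _ x0) => [|j]; rewrite size_map size_iota // => jw.
by rewrite (nth_map 0%N) ?size_iota // nth_iota //= codeK insK.
Qed.

Lemma Tr_nil n w : Tr_word X (n := n) [::] w = n.+1%:R.
Proof. by rewrite /Tr_word big_nil mxtrace1. Qed.

(** Empty words, whose trace is the constant [N], are not covered by condition
    (G) and are split off. *)
Lemma cintegrable_Tr n (s : seq (seq (L * bool))) :
  cintegrable (P n) (fun w => \prod_(u <- s) Tr_word X (n := n) u w).
Proof.
pose s' := [seq u <- s | u != [::]].
have h : cintegrable (P n) (fun w => \prod_(u <- s') Tr_word X u w).
  have [s0|s0] := posnP (size s').
    by apply: eq_cintegrable (cint_cst (P n) 1) => w; rewrite (size0nil s0) big_nil.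
  have nw (i : 'I_(size s')) : nth [::] s' i != [::].
    by have := mem_nth [::] (ltn_ord i); rewrite mem_filter => /andP[].
  have [c [blk [lt [cu cn cp cb cw]]]] := word_system s0 nw.
  apply: eq_cintegrable (cintegrable_words HG cu cn cp cb lt n [set: 'I_(size s')]%SET) => w.
  rewrite (big_nth [::]) big_mkord; apply: eq_big => [i|i _]; first by rewrite inE.
  by rewrite cw.
have := cint_lin (n.+1%:R ^+ count (pred1 [::]) s) h (cint_cst (P n) 0); apply: eq_cintegrable => w.
rewrite addr0 /s'; elim: s {s' h} => [|u s IH] /=; first by rewrite !big_nil mulr1.
rewrite big_cons -IH; case: eqP => [->|_] /=; first by rewrite Tr_nil exprS mulrA.
by rewrite big_cons mulrCA.
Qed.

(** A class of functions that contains the traces of all polynomials, is stable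
    under products and consists of integrable functions: this is what is needed
    to compute with moments. *)
Definition trace_poly n (f : T n -> C) : Prop :=
  exists s : seq (C * seq (seq (L * bool))),
    f =1 fun w => \sum_(x <- s) x.1 * \prod_(u <- x.2) Tr_word X u w.

Lemma trace_poly_int n f : trace_poly (n := n) f -> cintegrable (P n) f.
Proof.
case=> s fs; apply: (eq_cintegrable (fun w => esym (fs w))).
by apply: cint_sum => x; apply: cintegrable_Tr.
Qed.

Lemma trace_poly_sum n (J : Type) (s : seq J) (c : J -> C) (u : J -> seq (L * bool)) :
  trace_poly (n := n) (fun w => \sum_(j <- s) c j * Tr_word X (u j) w).
Proof.
exists [seq (c j, [:: u j]) | j <- s] => w; rewrite big_map.
by apply: eq_bigr => j _; rewrite big_seq1.
Qed.

Lemma trace_poly_word n u : trace_poly (n := n) (Tr_word X u).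
Proof. by exists [:: (1, [:: u])] => w; rewrite !big_seq1 mul1r. Qed.

Lemma trace_poly_prod n (J : finType) (f : J -> T n -> C) (Q : pred J) :
  (forall j, trace_poly (f j)) -> trace_poly (fun w => \prod_(j | Q j) f j w).
Proof.
move=> h; suff gen (s : seq J) : trace_poly (fun w => \prod_(j <- s | Q j) f j w) by apply: gen.
elim: s => [|j s [t IH]].
  by exists [:: (1, [::])] => w; rewrite big_seq1 !big_nil mulr1.
have [Qj|nQ] := boolP (Q j); last by exists t => w; rewrite big_cons (negbTE nQ) IH.
have [t' jt] := h j; exists [seq (x.1 * y.1, x.2 ++ y.2) | x <- t', y <- t] => w.
rewrite big_cons Qj IH jt big_distrlr /= big_allpairs_dep; apply: eq_bigr => x _.
by apply: eq_bigr => y _; rewrite big_cat mulrACA.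
Qed.

Lemma trace_poly_moments n (J : finType) (f : J -> T n -> C) (B : {set J}) :
  (forall j, trace_poly (f j)) -> cintegrable (P n) (fun w => \prod_(j in B) f j w).
Proof. by move=> h; apply/trace_poly_int/trace_poly_prod. Qed.

Definition upd n r (Z : 'I_r -> T n -> C) j f : 'I_r -> T n -> C :=
  fun i => if i == j then f else Z i.

Lemma trace_poly_upd n r (Z : 'I_r -> T n -> C) j f i : trace_poly f ->
  (forall i, trace_poly (Z i)) -> trace_poly (upd Z j f i).
Proof. by rewrite /upd; case: ifP. Qed.

(** Induction on the number of terms by [cumulant_lin].  Without terms the
    variable is 0, that is -1 times itself plus itself, and so the cumulant is 0
    as well. *)
Lemma cumulant_sum n r (Z : 'I_r -> T n -> C) j (J : Type) (s : seq J) (c : J -> C)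
    (u : J -> seq (L * bool)) : (forall i, trace_poly (Z i)) ->
  cumulant (P n) (upd Z j (fun w => \sum_(x <- s) c x * Tr_word X (u x) w)) =
  \sum_(x <- s) c x * cumulant (P n) (upd Z j (Tr_word X (u x))).
Proof.
move=> hZ; have jT := finset.in_setT j.
have off f f' i : i != j -> upd Z j f i =1 upd Z j f' i by rewrite /upd => /negbTE ->.
have at_j f w : upd Z j f j w = f w by rewrite /upd eqxx.
elim: s => [|x s IH]; rewrite ?big_nil ?big_cons.
  set Z0 := upd _ _ _; have Z00 w : Z0 j w = 0 by rewrite /Z0 at_j big_nil.
  have gZ (B : {set 'I_r}) : cintegrable (P n) (fun w => \prod_(i in B) Z0 i w).
    apply: trace_poly_moments => i; apply: trace_poly_upd => //; exact: (trace_poly_sum _ [::]).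
  rewrite /cumulant (cumulant_lin (Za := Z0) (Zb := Z0) (c := -1) jT) ?mulN1r ?addNr //.
  by move=> w; rewrite Z00 mulr0 addr0.
rewrite -IH /cumulant.
apply: (cumulant_lin (c := c x) jT) => //; try exact: off.
- by move=> w; rewrite !at_j big_cons.
- by move=> B; apply: trace_poly_moments => i; apply: trace_poly_upd => //; apply: trace_poly_word.
by move=> B; apply: trace_poly_moments => i; apply: trace_poly_upd => //; apply: trace_poly_sum.
Qed.

Lemma eq_upd n r (Z Z' : 'I_r -> T n -> C) : (forall i, Z i =1 Z' i) -> cumulant (P n) Z = cumulant (P n) Z'.
Proof. by move=> h; apply: eq_cumulant. Qed.

(** The trace of the empty word is constant. *)
Lemma cumulant_nil n r (Z : 'I_r -> T n -> C) j : (1 < r)%N -> Z j =1 Tr_word X [::] ->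
  (forall i, trace_poly (Z i)) -> cumulant (P n) Z = 0.
Proof.
move=> r1 Zj hZ; apply: (cumulant_cst (c := n.+1%:R) (finset.in_setT j)).
- by rewrite cardsT card_ord.
- by move=> w; rewrite Zj Tr_nil.
by move=> B; apply: trace_poly_moments.
Qed.

(** After multiplication by [N ^ (r - 2)] the cumulant still converges. *)
Lemma cvg_words r (w : 'I_r -> seq (L * bool)) : (2 < r)%N ->
  (fun n => cumulant (P n) (fun i => Tr_word X (n := n) (w i)) : C^o) @ \oo --> (0 : C^o).
Proof.
move=> r2; have [nw|] := boolP [forall i, w i != [::]]; last first.
  rewrite negb_forall => /existsP[j]; rewrite negbK => /eqP wj.
  rewrite [X in X @ _](_ : _ = fun=> 0); first exact: cvg_cst.
  apply/funext => n; apply: (cumulant_nil (j := j)); [exact: ltnW|by rewrite wj|].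
  by move=> i; apply: trace_poly_word.
have [c [blk [lt [cu cn cp cb cw]]]] := word_system (ltnW (ltnW r2)) (forallP nw).
have gg : is_gam c blk (gam cu cb [set: 'I_r]%SET).
  by split=> // k; rewrite ?gam1 ?gam2.
have h := cvg_cumulant HG cu cn cp cb (ltnW (ltnW r2)) gg
  (fun k => erefl (lt (val k)).2) (fun k => erefl (lt (val k)).1).
have z0 : 2 - r%:Z <= 0 by lia.
have := cvg_power z0 h; rewrite ifN; last by lia.
rewrite (_ : (fun n => _) = (fun n => cumulant (P n) (fun i => Tr_word X (n := n) (w i)) : C^o)) //.
apply/funext => n; rewrite mulrA -expfzDr ?pnatr_eq0 // addrC subrKA subrr expr0z mul1r.
by apply: eq_upd => i; rewrite cw.
Qed.

End Combinations.

(** * The free algebra and its linear functionals *)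

Section LinearExtension.
Context (C : comNzRingType) (K : choiceType) (V : lmodType C).
Local Open Scope fset_scope.
Implicit Types (F : seq K -> V) (a b : ncpoly C K).

(** The linear map with values [F] on the monomials. *)
Definition linext F a : V := \sum_(w <- msupp a) mcoeff w a *: F w.

Lemma linext_dom F (D : {fset fmonom K}) a : (msupp a `<=` D)%fset ->
  linext F a = \sum_(w <- D) mcoeff w a *: F w.
Proof.
move=> aD; rewrite /linext; apply: big_fset_incl => // w _ wa.
by rewrite mcoeff_outdom // scale0r.
Qed.

Lemma linext_is_linear F : linear (linext F).
Proof.
move=> c a b; pose D := (msupp a `|` msupp b)%fset.
have aD : (msupp a `<=` D)%fset by apply: fsubsetUl.
have bD : (msupp b `<=` D)%fset by apply: fsubsetUr.
have cD : (msupp (c *: a + b) `<=` D)%fset.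
  apply: fsubset_trans (msuppD_le _ _) _; apply: fsetSU; exact: msuppZ_le.
rewrite (linext_dom F aD) (linext_dom F bD) (linext_dom F cD) scaler_sumr -big_split /=.
by apply: eq_bigr => w _; rewrite mcoeffD mcoeffZ scalerDl scalerA.
Qed.

Lemma linext_sum F (J : Type) (s : seq J) (c : J -> C) (g : J -> ncpoly C K) :
  linext F (\sum_(x <- s) c x *: g x) = \sum_(x <- s) c x *: linext F (g x).
Proof.
elim: s => [|x s IH]; last by rewrite !big_cons linext_is_linear IH.
by rewrite !big_nil /linext msupp0 big_seq_fset0.
Qed.

Definition ncmon (w : seq K) : ncpoly C K := mkmalgU (FMonom w) 1.

Lemma linext_mon F w : linext F (ncmon w) = F w.
Proof. by rewrite /linext msuppU oner_eq0 big_seq_fset1 mcoeffU eqxx scale1r. Qed.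

End LinearExtension.

Section FreeAlgebra.
Context (C : comNzRingType) (K : choiceType).
Implicit Types (a b : ncpoly C K) (u v w : seq K).

Lemma ncmonM u v : ncmon C u * ncmon C v = ncmon C (u ++ v).
Proof.
apply: etrans (fgmulUU _ _ _ _) _; rewrite mulr1 /ncmon; congr mkmalgU; exact: fmmulE.
Qed.

Lemma ncmon1 : 1 = ncmon C ([::] : seq K).
Proof. by rewrite /ncmon -fmoneE. Qed.

Lemma ncvarE (k : K) : ncvar C k = ncmon C [:: k].
Proof. by rewrite /ncvar fmuE. Qed.

Lemma ncmon_prod (J : Type) (s : J -> K) (w : seq J) :
  \prod_(j <- w) ncvar C (s j) = ncmon C (map s w).
Proof.
elim: w => [|j w IH]; first by rewrite big_nil ncmon1.
by rewrite big_cons IH ncvarE ncmonM.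
Qed.

Lemma linext_id a : linext (@ncmon C K) a = a.
Proof.
rewrite [RHS]monalgE; apply: eq_bigr => w _; apply/malgP => k.
by rewrite mcoeffZ /ncmon fmK !mcoeffU mulrnAr mulr1.
Qed.

Lemma nceval_ncvar (J : choiceType) (s : J -> K) (p : ncpoly C J) :
  nceval (fun j => ncvar C (s j)) p = \sum_(w <- msupp p) mcoeff w p *: ncmon C (map s w).
Proof. by apply: eq_bigr => w _; rewrite (ncmon_prod s). Qed.

Lemma linextM (A : algType C) (F G : seq K -> A) a b : linext F a * linext G b =
  \sum_(u <- msupp a) \sum_(v <- msupp b) (mcoeff u a * mcoeff v b) *: (F u * G v).
Proof.
rewrite /linext big_distrlr /=; apply: eq_bigr => u _; apply: eq_bigr => v _.
by rewrite -scalerAl -scalerAr scalerA.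
Qed.

Lemma ncmulE a b : a * b =
  \sum_(u <- msupp a) \sum_(v <- msupp b) (mcoeff u a * mcoeff v b) *: ncmon C (u ++ v).
Proof.
rewrite -{1}(linext_id a) -{1}(linext_id b) linextM.
by apply: eq_bigr => u _; apply: eq_bigr => v _; rewrite ncmonM.
Qed.

Lemma linext_mul (V : lmodType C) (F : seq K -> V) a b : linext F (a * b) =
  \sum_(u <- msupp a) \sum_(v <- msupp b) (mcoeff u a * mcoeff v b) *: F (u ++ v).
Proof.
rewrite ncmulE (eq_bigr (fun u : fmonom K => 1 *: \sum_(v <- msupp b)
    (mcoeff u a * mcoeff v b) *: ncmon C (u ++ v))) => [|u _]; last by rewrite scale1r.
rewrite linext_sum; apply: eq_bigr => u _; rewrite scale1r linext_sum.
by apply: eq_bigr => v _; rewrite linext_mon.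
Qed.

(** Both sides are bilinear, so it suffices to compare them on monomials. *)
Lemma linext_tracial (V : lmodType C) (F : seq K -> V) :
  (forall u v, F (u ++ v) = F (v ++ u)) -> forall a b, linext F (a * b) = linext F (b * a).
Proof.
move=> h a b; apply: etrans (linext_mul F a b) _; apply: etrans _ (esym (linext_mul F b a)).
rewrite exchange_big; apply: eq_bigr => v _; apply: eq_bigr => u _.
by rewrite h [X in X *: _]mulrC.
Qed.

End FreeAlgebra.

Section Transpose.
Context (C : comNzRingType) (L : choiceType).
Local Notation A := (ncpoly C (L * bool)%type).
Implicit Types (w : seq (L * bool)) (a b : A).

Definition flip (x : L * bool) : L * bool := (x.1, ~~ x.2).
Definition tword w : seq (L * bool) := rev (map flip w).
(** The involution of the algebra extending the transposition of matrices. *)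
Definition nctr : A -> A := linext (fun w => ncmon C (tword w)).

Lemma twordK : involutive tword.
Proof.
by move=> w; rewrite /tword map_rev revK -map_comp map_id_in // => -[l b] _; rewrite /flip /= negbK.
Qed.

Lemma nctr_transpose : [/\ forall c a b, nctr (c *: a + b) = c *: nctr a + nctr b,
  involutive nctr, forall a b, nctr (a * b) = nctr b * nctr a &
  forall l (e : bool), ncvar C (l, ~~ e) = nctr (ncvar C (l, e))].
Proof.
split.
- exact: linext_is_linear.
- move=> a; rewrite {2}/nctr /linext /nctr linext_sum -[RHS]linext_id; apply: eq_bigr => w _.
  by rewrite linext_mon twordK.
- move=> a b; rewrite /nctr linextM linext_mul exchange_big; apply: eq_bigr => v _.
  by apply: eq_bigr => u _; rewrite ncmonM /tword map_cat rev_cat mulrC.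
by move=> l b; rewrite /nctr !ncvarE linext_mon.
Qed.

End Transpose.

Section Polynomials.
Context (R : realType) (L : choiceType) (d : nat -> measure_display)
  (T : forall n, measurableType (d n)) (P : forall n, probability (T n) R).
Local Notation C := R[i].
Variable X : forall n, L -> T n -> 'M[C]_n.+1.
Variable PMc : forall I : {fset nat}, {set {perm (I * bool)}}.
Variable fc : nat -> forall I : {fset nat}, (I -> L) -> {perm (I * bool)} -> C.
Hypothesis HG : condition_G P X PMc fc.
Implicit Types (u v : seq (L * bool)).
Local Notation A := (ncpoly C (L * bool)%type).

Lemma phi1E (a : A) : phi1 PMc fc a = linext (V := C^o) (phi1_word PMc fc) a.
Proof. by []. Qed.

(** As an iterated linear extension, [phi2] is visibly linear in its first
    argument; exchanging the sums gives the same for the second one. *)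
Lemma phi2E (a b : A) : phi2 PMc fc a b =
  linext (V := C^o) (fun u => linext (V := C^o) (phi2_word PMc fc u) b) a.
Proof.
apply: eq_bigr => u _; rewrite /linext scaler_sumr; apply: eq_bigr => v _.
by rewrite scalerA.
Qed.

Lemma phi2E' (a b : A) : phi2 PMc fc a b =
  linext (V := C^o) (fun v => linext (V := C^o) (fun u => phi2_word PMc fc u v) a) b.
Proof.
rewrite /phi2 exchange_big; apply: eq_bigr => v _; rewrite /linext scaler_sumr; apply: eq_bigr => u _.
by rewrite scalerA [X in X *: _]mulrC.
Qed.

Lemma Tr_polyE n k (p : ncpoly C 'I_k) (s : 'I_k -> L * bool) w :
  Tr_poly X (n := n) p s w = \sum_(u <- msupp p) mcoeff u p * Tr_word X (map s u) w.
Proof.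
rewrite /Tr_poly /nceval raddf_sum; apply: eq_bigr => u _.
by rewrite -[LHS]/(\tr _) mxtraceZ /Tr_word big_map.
Qed.

Lemma tr_polyE n k (p : ncpoly C 'I_k) (s : 'I_k -> L * bool) w :
  tr_poly X (n := n) p s w =
  \sum_(u <- msupp p) (n.+1%:R^-1 * mcoeff u p) * Tr_word X (map s u) w.
Proof.
rewrite -[LHS]/(Tr_poly X p s w / n.+1%:R) Tr_polyE mulrC mulr_sumr.
by apply: eq_bigr => u _; rewrite mulrA.
Qed.

Lemma trace_poly_Tr n k (p : ncpoly C 'I_k) (s : 'I_k -> L * bool) :
  trace_poly X (Tr_poly X (n := n) p s).
Proof.
exists [seq (mcoeff m p, [:: map s m]) | m <- msupp p] => w; rewrite big_map Tr_polyE.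
by apply: eq_bigr => m _; rewrite big_seq1.
Qed.

Lemma Tr_word_cat n u v w : Tr_word X (n := n) (u ++ v) w = Tr_word X (v ++ u) w.
Proof. by rewrite /Tr_word !big_cat /= [\tr (_ * _)]mxtrace_mulC. Qed.

Lemma cumulant1 n (Z : 'I_1 -> T n -> C) : cumulant (P n) Z = cE (P n) (Z ord0).
Proof.
have j0 : (ord0 : 'I_1) \in [set: 'I_1]%SET by rewrite inE.
have -> : cE (P n) (Z ord0) = moment (P n) Z [set: 'I_1]%SET.
  by apply: eq_cE => w; rewrite (big_pred1 ord0) // => i; rewrite inE (ord1 i).
rewrite (moment_recursion_top _ Z j0) big1 ?addr0 // => B /andP[/andP[jB _]].
by case/negP; apply/eqP/setP => i; rewrite (ord1 i) inE jB.
Qed.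

(** The empty word: its normalised trace is 1. *)
Lemma cvg_word1' u :
  (fun n => n.+1%:R^-1 * cumulant (P n) (fun _ : 'I_1 => Tr_word X (n := n) u) : C^o) @ \oo -->
  (phi1_word PMc fc u : C^o).
Proof.
have [->|nu] := eqVneq u [::]; last exact: cvg_word1.
rewrite [X in X @ _](_ : _ = fun=> 1); first exact: cvg_cst.
apply/funext => n; rewrite cumulant1; under eq_cE do rewrite Tr_nil.
by rewrite cE_cst mulVf // pnatr_eq0.
Qed.

Lemma trace_poly_pair n (f g : T n -> C) : trace_poly X f -> trace_poly X g ->
  forall i, trace_poly X (pair2 f g i).
Proof. by move=> hf hg i; rewrite /pair2; case: ifP. Qed.

(** An empty word has constant trace and contributes no covariance. *)
Lemma cvg_word2' u v :
  (fun n => cumulant (P n) (pair2 (Tr_word X (n := n) u) (Tr_word X (n := n) v)) : C^o) @ \oo -->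
  (phi2_word PMc fc u v : C^o).
Proof.
have z j : phi2_word PMc fc u v = 0 -> (forall n, pair2 (Tr_word X (n := n) u) (Tr_word X v) j =1 Tr_word X [::]) ->
  (fun n => cumulant (P n) (pair2 (Tr_word X (n := n) u) (Tr_word X (n := n) v)) : C^o) @ \oo -->
  (phi2_word PMc fc u v : C^o).
  move=> -> h; rewrite [X in X @ _](_ : _ = fun=> 0); first exact: cvg_cst.
  apply/funext => n; apply: (cumulant_nil HG (j := j)) => //.
  by apply: trace_poly_pair; apply: trace_poly_word.
have [u0|nu] := eqVneq u [::]; first by apply: (z ord0); rewrite u0.
have [v0|nv] := eqVneq v [::]; last exact: cvg_word2.
by apply: (z ord_max); rewrite v0 // /phi2_word eqxx orbT.
Qed.

Lemma cvgC_unique (f g : nat -> C^o) (a b : C) : f =1 g ->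
  f @ \oo --> (a : C^o) -> g @ \oo --> (b : C^o) -> a = b.
Proof. by move=> /funext ->; apply: (cvg_unique (@norm_hausdorff _ C^o)). Qed.

Lemma cvgC_eq (f : nat -> C^o) (a b : C) : a = b -> f @ \oo --> (a : C^o) -> f @ \oo --> (b : C^o).
Proof. by move=> ->. Qed.

Lemma cvg_mulC (c : C) (f : nat -> C^o) (a : C) : f @ \oo --> (a : C^o) ->
  (fun n => c * f n : C^o) @ \oo --> (c * a : C^o).
Proof. by move=> h; apply: (cvgM (cvg_cst (c : C^o)) h). Qed.

(** The matrix trace is tracial, and limits are unique. *)
Lemma phi1_word_cat u v : phi1_word PMc fc (u ++ v) = phi1_word PMc fc (v ++ u).
Proof.
have h := cvgC_unique _ (@cvg_word1' (u ++ v)) (@cvg_word1' (v ++ u)); apply: h => n /=.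
by congr (_ * _); apply: eq_upd => i w; rewrite Tr_word_cat.
Qed.

Lemma phi2_word_catl u v w : phi2_word PMc fc (u ++ v) w = phi2_word PMc fc (v ++ u) w.
Proof.
have h := cvgC_unique _ (@cvg_word2' (u ++ v) w) (@cvg_word2' (v ++ u) w); apply: h => n /=.
by apply: eq_upd => i t; rewrite /pair2; case: ifP => // _; apply: Tr_word_cat.
Qed.

Lemma phi2_word_catr u v w : phi2_word PMc fc w (u ++ v) = phi2_word PMc fc w (v ++ u).
Proof.
have h := cvgC_unique _ (@cvg_word2' w (u ++ v)) (@cvg_word2' w (v ++ u)); apply: h => n /=.
by apply: eq_upd => i t; rewrite /pair2; case: ifP => // _; apply: Tr_word_cat.
Qed.

Lemma phi_space : second_order_space (A := A) (phi1 PMc fc) (phi2 PMc fc).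
Proof.
split.
- by move=> c a b; rewrite !phi1E linext_is_linear.
- by rewrite phi1E ncmon1 linext_mon.
- move=> a b; exact: (@linext_tracial C _ C^o (phi1_word PMc fc) phi1_word_cat a b).
- by move=> x c a b; rewrite !phi2E linext_is_linear.
- by move=> x c a b; rewrite !phi2E' linext_is_linear.
- move=> x a b; apply: etrans (phi2E _ _) _; apply: etrans _ (esym (phi2E _ _)).
  apply: (@linext_tracial C _ C^o) => u v.
  by apply: eq_bigr => w _; rewrite phi2_word_catl.
- move=> x a b; apply: etrans (phi2E' _ _) _; apply: etrans _ (esym (phi2E' _ _)).
  apply: (@linext_tracial C _ C^o) => u v.
  by apply: eq_bigr => w _; rewrite phi2_word_catr.
- by move=> a; rewrite phi2E ncmon1 linext_mon /linext big1 // => v _; rewrite /phi2_word /= scaler0.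
by move=> a; rewrite phi2E' ncmon1 linext_mon /linext big1 // => v _; rewrite /phi2_word orbT scaler0.
Qed.

Lemma phi1_nceval k (p : ncpoly C 'I_k) (s : 'I_k -> L * bool) :
  phi1 PMc fc (nceval (fun j => ncvar C (s j)) p) =
  \sum_(u <- msupp p) mcoeff u p * phi1_word PMc fc (map s u).
Proof.
rewrite phi1E (nceval_ncvar s p) linext_sum; apply: eq_bigr => u _.
by rewrite linext_mon.
Qed.

Lemma phi2_nceval k1 k2 (p1 : ncpoly C 'I_k1) (p2 : ncpoly C 'I_k2)
    (s1 : 'I_k1 -> L * bool) (s2 : 'I_k2 -> L * bool) :
  phi2 PMc fc (nceval (fun j => ncvar C (s1 j)) p1) (nceval (fun j => ncvar C (s2 j)) p2) =
  \sum_(u <- msupp p1) mcoeff u p1 *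
    \sum_(v <- msupp p2) mcoeff v p2 * phi2_word PMc fc (map s1 u) (map s2 v).
Proof.
rewrite phi2E (nceval_ncvar s1 p1) linext_sum; apply: eq_bigr => u _; congr (_ * _).
rewrite linext_mon (nceval_ncvar s2 p2) linext_sum; apply: eq_bigr => v _.
by rewrite linext_mon.
Qed.

Lemma upd_pair2l n (f g h : T n -> C) : upd (pair2 h g) ord0 f = pair2 f g.
Proof. by apply/funext => i; rewrite /upd /pair2; case: (i == ord0). Qed.

Lemma upd_pair2r n (f g h : T n -> C) : upd (pair2 f h) ord_max g = pair2 f g.
Proof.
apply/funext => i; have [->|->] : i = ord0 \/ i = ord_max by
  case: i => [[|[|//]] hi]; [left|right]; apply/val_inj.
  by [].
by [].
Qed.

Lemma cvg_poly1 k (p : ncpoly C 'I_k) (s : 'I_k -> L * bool) :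
  (fun n => cumulant (P n) (fun _ : 'I_1 => tr_poly X (n := n) p s) : C^o) @ \oo
      --> (phi1 PMc fc (nceval (fun j => ncvar C (s j)) p) : C^o).
Proof.
rewrite phi1_nceval.
rewrite [X in X @ _](_ : _ = (fun n => \sum_(u <- msupp p) mcoeff u p *
    (n.+1%:R^-1 * cumulant (P n) (fun _ : 'I_1 => Tr_word X (n := n) (map s u))) : C^o)).
  apply: cvg_sumC => u _; apply: cvg_mulC; exact: cvg_word1'.
apply/funext => n; pose Z (_ : 'I_1) := Tr_word X (n := n) [::].
have up f : upd Z ord0 f = fun=> f by apply/funext => i; rewrite /upd (ord1 i).
have hZ i : trace_poly X (Z i) by apply: trace_poly_word.
have h := cumulant_sum HG ord0 (msupp p : seq (fmonom 'I_k)) (fun m => n.+1%:R^-1 * mcoeff m p)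
  (fun m => map s m) hZ.
rewrite up in h.
rewrite (eq_upd P (Z' := fun=> fun w => \sum_(u <- msupp p) (n.+1%:R^-1 * mcoeff u p) * Tr_word X (map s u) w)); last by move=> i w; rewrite tr_polyE.
by rewrite h; apply: eq_bigr => u _; rewrite up -mulrA mulrCA.
Qed.

Lemma cvg_poly2 k1 k2 (p1 : ncpoly C 'I_k1) (p2 : ncpoly C 'I_k2)
      (s1 : 'I_k1 -> L * bool) (s2 : 'I_k2 -> L * bool) :
    (fun n => cumulant (P n)
       (pair2 (Tr_poly X (n := n) p1 s1) (Tr_poly X (n := n) p2 s2)) : C^o) @ \oo
      --> (phi2 PMc fc (nceval (fun j => ncvar C (s1 j)) p1) (nceval (fun j => ncvar C (s2 j)) p2) : C^o).
Proof.
rewrite phi2_nceval.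
rewrite [X in X @ _](_ : _ = (fun n => \sum_(u <- msupp p1) mcoeff u p1 * (\sum_(v <- msupp p2) mcoeff v p2 *
   cumulant (P n) (pair2 (Tr_word X (n := n) (map s1 u)) (Tr_word X (map s2 v)))) : C^o)).
  apply: cvg_sumC => u _; apply: cvg_mulC.
  apply: cvg_sumC => v _; apply: cvg_mulC; exact: cvg_word2'.
apply/funext => n.
have w0 := trace_poly_word X n [::].
rewrite (eq_upd P (Z' := pair2 (fun w => \sum_(u <- msupp p1) mcoeff u p1 * Tr_word X (map s1 u) w) (Tr_poly X (n := n) p2 s2))); last first.
  by move=> i w; rewrite /pair2; case: ifP => // _; rewrite Tr_polyE.
rewrite -(upd_pair2l _ _ (Tr_word X [::])) (cumulant_sum HG); last by apply: trace_poly_pair => //; apply: trace_poly_Tr.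
apply: eq_bigr => u _; rewrite upd_pair2l; congr (_ * _).
rewrite (eq_upd P (Z' := pair2 (Tr_word X (map s1 u)) (fun w => \sum_(v <- msupp p2) mcoeff v p2 * Tr_word X (map s2 v) w))); last first.
  by move=> i w; rewrite /pair2; case: ifP => // _; rewrite Tr_polyE.
rewrite -(upd_pair2r _ _ (Tr_word X [::])) (cumulant_sum HG); last by apply: trace_poly_pair => //; apply: trace_poly_word.
by apply: eq_bigr => v _; rewrite upd_pair2r.
Qed.

(** Replace words by polynomials one argument at a time: [Z m w] has polynomials
    in the first [m] places and words elsewhere. *)
Lemma cvg_polyr r (k : 'I_r -> nat) (p : forall i, ncpoly C 'I_(k i))
      (s : forall i, 'I_(k i) -> L * bool) : (3 <= r)%N ->
    (fun n => cumulant (P n) (fun i => Tr_poly X (n := n) (p i) (s i)) : C^o) @ \oo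
      --> (0 : C^o).
Proof.
move=> r3; pose Z m (w : 'I_r -> seq (L * bool)) n (i : 'I_r) : T n -> C :=
  if (i < m)%N then Tr_poly X (p i) (s i) else Tr_word X (w i).
have tp m w n i : trace_poly X (Z m w n i).
  by rewrite /Z; case: ifP => _; [apply: trace_poly_Tr|apply: trace_poly_word].
suff h m : (m <= r)%N -> forall w, (fun n => cumulant (P n) (Z m w n) : C^o) @ \oo --> (0 : C^o).
  have := h r (leqnn r) (fun _ => [::]).
  rewrite (_ : (fun n => _) = (fun n => cumulant (P n) (fun i => Tr_poly X (n := n) (p i) (s i)) : C^o)) //.
  by apply/funext => n; apply: eq_upd => i w; rewrite /Z ltn_ord.
elim: m => [|m IH] mr w; first exact: (cvg_words HG w r3).
pose j := Ordinal mr.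
rewrite [X in X @ _](_ : _ = (fun n => \sum_(u <- msupp (p j)) mcoeff u (p j) *
   cumulant (P n) (Z m (fun i => if i == j then map (s j) u else w i) n) : C^o)).
  have z : \sum_(u <- msupp (p j)) mcoeff u (p j) * 0 = 0 :> C by rewrite big1 // => u _; rewrite mulr0.
  apply: (cvgC_eq z); apply: cvg_sumC => u _; apply: cvg_mulC; exact: IH (ltnW mr) _.
apply/funext => n.
rewrite (eq_upd P (Z' := upd (Z m w n) j (fun t => \sum_(u <- msupp (p j)) mcoeff u (p j) * Tr_word X (map (s j) u) t))); last first.
  move=> i t; rewrite /upd /Z ltnS; case: eqP => [->|/eqP ni]; first by rewrite leqnn Tr_polyE.
  by rewrite leq_eqVlt (_ : (i == m :> nat) = false) //; apply/negbTE; apply: contra ni => /eqP e; apply/eqP/val_inj.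
rewrite (cumulant_sum HG) //; apply: eq_bigr => u _; congr (_ * _); apply: eq_upd => i t.
rewrite /upd /Z; case: eqP => [->|//]; by rewrite ltnn.
Qed.

End Polynomials.

Theorem lemma5p12 (R : realType) (L : choiceType)
    (d : nat -> measure_display) (T : forall n, measurableType (d n))
    (P : forall n, probability (T n) R)
    (X : forall n, L -> T n -> 'M[R[i]]_n.+1)
    (PMc : forall I : {fset nat}, {set {perm (I * bool)}})
    (fc : nat -> forall I : {fset nat}, (I -> L) -> {perm (I * bool)} -> R[i]) :
  condition_G P X PMc fc ->
  second_order_limit P X (A := ncpoly R[i] (L * bool)%type)
    (phi1 PMc fc) (phi2 PMc fc) (fun s => ncvar R[i] s).
Proof.
move=> HG; split.
- exact: phi_space HG.
- move=> n r k p s; apply: (trace_poly_int HG); apply: trace_poly_prod => i; exact: trace_poly_Tr.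
- exact: cvg_poly1 HG.
- exact: cvg_poly2 HG.
- exact: cvg_polyr HG.
by exists (@nctr R[i] L); apply: nctr_transpose.
Qed.
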